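(* Let $0<\alpha<2\pi$ and let $A=(A_{11},A_{12},\mathrm{Id}_\ell)$ be a Neumann well-posed monic elliptic tuple with standard root $V=(S+i\,\mathrm{Id}_\ell)D$. For $\lambda\in\mathbb{C}\setminus\{0\}$, the model problem for $A$ with angle $\alpha$ and Neumann boundary conditions has a solution $r^\lambda v\neq0$ if and only if $0\in\sigma(M_{\lambda,\alpha})$ for $$M_{\lambda,\alpha}=E\,Z_\alpha^{\lambda_+}E^{-1}-\overline{E}\;\overline{Z_\alpha}^{\,\lambda_-}\,\overline{E}^{\,-1},\qquad E=\tfrac12D^{-1/2}[S,D]D^{-1/2}+i\,\mathrm{Id}_\ell,$$ where $Z_\alpha=\cos(\alpha)\,\mathrm{Id}_\ell+\sin(\alpha)\,D^{1/2}SD^{1/2}+i\sin(\alpha)\,D$ and $[X,Y]=XY-YX$.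
   Context: **Monic elliptic tuples.** $A=(A_{11},A_{12},\mathrm{Id}_\ell)$ with $A_{11},A_{12}\in\operatorname{Mat}_\ell(\mathbb{R})$ symmetric is a monic elliptic tuple if $A_{11}$ is positive definite and $L_A(\xi)=A_{11}\xi_1^2+2A_{12}\xi_1\xi_2+\mathrm{Id}_\ell\,\xi_2^2$ satisfies $\det L_A(\xi)\neq0$ for all $\xi\in\mathbb{R}^2\setminus\{0\}$. Put $A_{22}=\mathrm{Id}_\ell$, $A_{21}=A_{12}$, $L_A(\partial_{x_1},\partial_{x_2})=\sum_{i,j=1}^2A_{ij}\partial_{x_i}\partial_{x_j}$. Its standard root is the unique $V\in\operatorname{Mat}_\ell(\mathbb{C})$ with $\sigma(V)\subset\{\operatorname{Im}z>0\}$ and $L_A(1,\beta)=(V^*-\beta\,\mathrm{Id}_\ell)(V-\beta\,\mathrm{Id}_\ell)$ for all $\beta\in\mathbb{C}$; it can be written $V=(S+i\,\mathrm{Id}_\ell)D$ with $S,D\in\operatorname{Mat}_\ell(\mathbb{R})$ symmetric, $D$ positive definite ($D=\operatorname{Im}V$, $S=(\operatorname{Re}V)D^{-1}$). With $C=\operatorname{Re}V$, $A$ is *Neumann well-posed* if $2i\notin\sigma([D^{-1},C])$. **Complex powers.** For $z\in\mathbb{C}\setminus\{0\}$ and $\lambda\in\mathbb{C}$, $z^{\lambda_\pm}:=\exp(\lambda\log_\pm z)$ with $\log_\pm z:=\log|z|+i\arg_\pm z$, $\arg_+z\in[0,2\pi)$, $\arg_-z\in(-2\pi,0]$. Powers of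 matrices are defined by the holomorphic functional calculus; bars denote entrywise complex conjugation. For $0<\alpha<2\pi$ the spectra of $Z_\alpha$ and $\overline{Z_\alpha}$ do not meet $[0,\infty)$. **Model problem.** Use polar coordinates on the angle $\mathcal{K}_\alpha=\{r>0,0\le\varphi\le\alpha\}$ with sides $\Gamma^-=\{\varphi=0\}$, $\Gamma^+=\{\varphi=\alpha\}$. The conormal derivative on the side at angle $\varphi\in\{0,\alpha\}$ is $\sum_{i,j=1}^2A_{ij}n_i\partial_{x_j}$ with $n=(-\sin\varphi,\cos\varphi)$. A solution $r^\lambda v$ of the model problem with Neumann boundary conditions is a function $u(r,\varphi)=r^\lambda v(\varphi)$, $v:[0,\alpha]\to\mathbb{C}^\ell$ smooth, with $L_A(\partial_{x_1},\partial_{x_2})u=0$ on $\mathcal{K}_\alpha$ and vanishing conormal derivative on both $\Gamma^-$ and $\Gamma^+$. *)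

(* Defs.v *)
From HB Require Import structures.
From mathcomp Require Import all_boot all_order all_algebra.
From mathcomp Require Import all_classical all_reals all_analysis.
From mathcomp.real_closed Require Import complex.

Set Implicit Arguments.
Unset Strict Implicit.
Unset Printing Implicit Defensive.

Import Order.TTheory GRing.Theory Num.Theory.
Import numFieldNormedType.Exports.

Local Open Scope classical_set_scope.
Local Open Scope ring_scope.
Local Open Scope complex_scope.

Section Matrices.
Context {R : realType} {l : nat}.
Implicit Types (D : 'M[R]_l) (V : 'M[R[i]]_l).

Definition cmx {m n : nat} (A : 'M[R]_(m, n)) : 'M[R[i]]_(m, n) :=
  map_mx (real_complex R) A.

Definition Re_mx V : 'M[R]_l := map_mx (@complex.Re R) V.
Definition Im_mx V : 'M[R]_l := map_mx (@complex.Im R) V.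
Definition conj_mx V : 'M[R[i]]_l := map_mx conjc V.
Definition adj_mx V : 'M[R[i]]_l := (conj_mx V)^T.

Definition commutator_mx {F : pzRingType} (X Y : 'M[F]_l) : 'M[F]_l :=
  X *m Y - Y *m X.

Definition posdef_mx D : Prop :=
  D^T = D /\ forall x : 'cV[R]_l, x != 0 -> 0 < (x^T *m D *m x) 0 0.

Definition sqrt_mx D : 'M[R]_l :=
  xget 0 [set B | posdef_mx B /\ B *m B = D].

(* L_A(x, y) for the tuple (A11, A12, Id), over R or over R[i]. *)
Definition symbol {F : comPzRingType} (A11 A12 : 'M[F]_l) (x y : F) : 'M[F]_l :=
  x ^+ 2 *: A11 + (2%:R * x * y) *: A12 + y ^+ 2 *: 1%:M.

Definition monic_elliptic (A11 A12 : 'M[R]_l) : Prop :=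
  [/\ A11^T = A11, A12^T = A12, posdef_mx A11 &
      forall x y : R, (x, y) != (0, 0) -> \det (symbol A11 A12 x y) != 0].

Definition standard_root (A11 A12 : 'M[R]_l) V : Prop :=
  (forall z : R[i], eigenvalue V z -> 0 < complex.Im z) /\
  (forall b : R[i], symbol (cmx A11) (cmx A12) 1 b =
                    (adj_mx V - b%:M) *m (V - b%:M)).

(* D and S in the factorisation V = (S + i Id) D of a standard root. *)
Definition rootD V : 'M[R]_l := Im_mx V.
Definition rootS V : 'M[R]_l := Re_mx V *m invmx (rootD V).

(* Well-posedness of a tuple, expressed through its standard root V. *)
Definition neumann_well_posed V : Prop :=
  ~~ eigenvalue (cmx (commutator_mx (invmx (rootD V)) (Re_mx V))) (0 +i* 2%:R).

End Matrices.

Section ComplexPowers.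
Context {R : realType}.
Implicit Types (z lambda : R[i]) (r rho : R).

Definition cexp z : R[i] :=
  (expR (complex.Re z) * cos (complex.Im z)) +i*
  (expR (complex.Re z) * sin (complex.Im z)).

Definition cnorm z : R := ComplexField.Normc.normc z.

(* For z != 0, the arguments of z in [0, 2 pi) and in (-2 pi, 0]:
   acos (Re z / |z|) is the unsigned angle in [0, pi] between z and 1. *)
Definition arg_plus z : R :=
  let t := acos (complex.Re z / cnorm z) in
  if 0 <= complex.Im z then t else 2%:R * pi - t.
Definition arg_minus z : R :=
  let t := acos (complex.Re z / cnorm z) in
  if complex.Im z <= 0 then - t else t - 2%:R * pi.

Definition log_plus z : R[i] := ln (cnorm z) +i* arg_plus z.
Definition log_minus z : R[i] := ln (cnorm z) +i* arg_minus z.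

Definition cpow_plus lambda z : R[i] := cexp (lambda * log_plus z).
Definition cpow_minus lambda z : R[i] := cexp (lambda * log_minus z).

Definition rpow r lambda : R[i] := cexp (lambda * (ln r)%:C).

Definition cintegral (a b : R) (g : R -> R[i]) : R[i] :=
  (\int[lebesgue_measure]_(t in `[a, b]) complex.Re (g t)) +i*
  (\int[lebesgue_measure]_(t in `[a, b]) complex.Im (g t)).

(* Contour integral over the positively oriented circle |z - c| = rho. *)
Definition circle_integral (f : R[i] -> R[i]) (c : R[i]) rho : R[i] :=
  cintegral 0 (2%:R * pi) (fun t =>
    let w := rho%:C * cexp (0 +i* t) in f (c + w) * ((0 +i* 1) * w)).

(* Riesz-Dunford calculus f(M) = (2 pi i)^-1 \oint f(z) (z - M)^-1 dz. The
   contour is the union of the circles of radius rho around the eigenvalues of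
   M; for f holomorphic near the spectrum the integral does not depend on rho
   once rho is small enough, so the limit as rho -> 0+ is this common value. *)
Definition dunford_sum {l : nat} (f : R[i] -> R[i]) (M : 'M[R[i]]_l) rho
    (i j : 'I_l) : R[i] :=
  (0 +i* (2%:R * pi))^-1 *
  \sum_(c \in [set c | eigenvalue M c])
     circle_integral (fun z => f z * invmx (z%:M - M) i j) c rho.

Definition holo_calculus {l : nat} (f : R[i] -> R[i]) (M : 'M[R[i]]_l) :
    'M[R[i]]_l :=
  \matrix_(i, j)
    (lim (complex.Re (dunford_sum f M rho i j) @[rho --> 0^'+]) +i*
     lim (complex.Im (dunford_sum f M rho i j) @[rho --> 0^'+])).

End ComplexPowers.

Section ModelProblem.
Context {R : realType} {l : nat}.
Implicit Types (u : 'rV[R]_2 -> 'cV[R[i]]_l).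

(* The matrices A_ij (indices 0, 1 for 1, 2), with A_21 = A_12, A_22 = Id. *)
Definition coef (A11 A12 : 'M[R]_l) (i j : 'I_2) : 'M[R]_l :=
  if i != j then A12 else if i == 0 then A11 else 1%:M.

Definition partial_deriv (i : 'I_2) u (x : 'rV[R]_2) : 'cV[R[i]]_l :=
  \col_k ('D_(delta_mx 0 i) (fun y => complex.Re (u y k 0)) x +i*
          'D_(delta_mx 0 i) (fun y => complex.Im (u y k 0)) x).

Definition L_op (A11 A12 : 'M[R]_l) u (x : 'rV[R]_2) : 'cV[R[i]]_l :=
  \sum_(i < 2) \sum_(j < 2)
    cmx (coef A11 A12 i j) *m partial_deriv i (partial_deriv j u) x.

Definition polar (r phi : R) : 'rV[R]_2 :=
  \row_(i < 2) (if i == 0 then r * cos phi else r * sin phi).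

Definition normal (phi : R) (i : 'I_2) : R :=
  if i == 0 then - sin phi else cos phi.

Definition conormal (A11 A12 : 'M[R]_l) (phi : R) u (x : 'rV[R]_2) : 'cV[R[i]]_l :=
  \sum_(i < 2) \sum_(j < 2)
    (normal phi i)%:C *: (cmx (coef A11 A12 i j) *m partial_deriv j u x).

Definition smooth_on (a b : R) (v : R -> 'cV[R[i]]_l) : Prop :=
  forall (k : 'I_l) (n : nat) (t : R), a < t < b ->
    derivable (derive1n n (fun s => complex.Re (v s k 0))) t 1 /\
    derivable (derive1n n (fun s => complex.Im (v s k 0))) t 1.

(* u = r^lambda v solves the model problem with Neumann conditions. Smoothness
   up to the sides is expressed by letting v be smooth on ]-e, alpha + e[ for
   some e > 0, so that u = r^lambda v(phi) is defined, in Cartesian coordinates,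
   around every point of the closed angle (vertex excluded). The equations
   involve only phi in [0, alpha], where the derivatives of u depend only on the
   restriction of v to [0, alpha]. *)
Definition neumann_solution (A11 A12 : 'M[R]_l) (alpha : R) (lambda : R[i])
    (v : R -> 'cV[R[i]]_l) : Prop :=
  exists (e : R) (u : 'rV[R]_2 -> 'cV[R[i]]_l),
    [/\ 0 < e /\ smooth_on (- e) (alpha + e) v,
        forall r phi, 0 < r -> - e < phi < alpha + e ->
          u (polar r phi) = rpow r lambda *: v phi,
        forall r phi, 0 < r -> 0 <= phi <= alpha ->
          L_op A11 A12 u (polar r phi) = 0,
        forall r, 0 < r -> conormal A11 A12 0 u (polar r 0) = 0 &
        forall r, 0 < r -> conormal A11 A12 alpha u (polar r alpha) = 0].

End ModelProblem.

Section CharacteristicMatrix.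
Context {R : realType} {l : nat}.
Implicit Types (V : 'M[R[i]]_l) (alpha : R) (lambda : R[i]).

Definition Emx V : 'M[R[i]]_l :=
  let D := rootD V in let S := rootS V in
  let H := invmx (sqrt_mx D) in
  cmx (2%:R^-1 *: (H *m commutator_mx S D *m H)) + (0 +i* 1)%:M.

Definition Zmx V alpha : 'M[R[i]]_l :=
  let D := rootD V in let S := rootS V in
  let Q := sqrt_mx D in
  (cos alpha)%:C%:M + (sin alpha)%:C *: cmx (Q *m S *m Q)
    + ((0 +i* 1) * (sin alpha)%:C) *: cmx D.

Definition Mmx V lambda alpha : 'M[R[i]]_l :=
  Emx V *m holo_calculus (cpow_plus lambda) (Zmx V alpha) *m invmx (Emx V)
  - conj_mx (Emx V)
    *m holo_calculus (cpow_minus lambda) (conj_mx (Zmx V alpha))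
    *m invmx (conj_mx (Emx V)).

End CharacteristicMatrix.

(* Main.v *)
From HB Require Import structures.
Require Import Defs.
From mathcomp Require Import all_boot all_order all_algebra.
From mathcomp Require Import all_classical all_reals all_analysis.
From mathcomp.real_closed Require Import complex.
From mathcomp Require Import ring lra.

Set Implicit Arguments.
Unset Strict Implicit.
Unset Printing Implicit Defensive.

Import Order.TTheory GRing.Theory Num.Theory.
Import numFieldNormedType.Exports.

Local Open Scope ring_scope.
Local Open Scope complex_scope.

(** Write V for the standard root, W for its adjoint and bars for complex
    conjugates. The factorisation of the symbol turns into
    L_A = (W d1 - d2) (V d1 - d2), because A11 = W V and 2 A12 = - (V + W); both
    coefficients being real, the conjugate factorisation holds as well. Hence
    (x1 + x2 V)^lambda c and its conjugate analogue (x1 + x2 Vbar)^lambda c' solve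
    the equation, and for lambda <> 0 their sums are all the solutions of the form
    r^lambda v. Indeed the flux q = lambda T' v - T v', with
    T = cos phi + sin phi V, is the angular part of (V d1 - d2) u; it solves a
    first-order system with W in place of V, so it is determined by q at 0, and the
    conjugate powers realise every value of q at 0 since V - Vbar = 2 i D is
    invertible ([solution_form], [form_injective]). Only two facts about systems
    are used: powers of T are explicit, and a power with the opposite exponent is
    an integrating factor ([family_unique]).

    Where the flux vanishes, twice the conormal derivative is
    lambda r^(lambda - 1) (V - W) v ([angular_N_flux0]). The two Neumann
    conditions therefore read F c + Fbar c' = 0 and F P c + Fbar P' c' = 0, where
    F = V - W and where P and P' are the two powers at the angle alpha. Well-posedness says
    that F is invertible; eliminating c' leaves the singularity of
    F P F^-1 - Fbar P' Fbar^-1 ([boundary_system]). Since F = 2 D^(1/2) E D^(1/2) and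
    D^(1/2) T D^(-1/2) = Z at the angle alpha, conjugation by D^(1/2) turns this
    matrix into the characteristic one ([Mmx_eigen]).

    Two points need work beyond this. First, D has to be positive definite
    for D^(1/2) to exist: V^* D - D V = - 2 i D^2 is a Lyapunov equation, and
    the spectrum of V lies in the upper half plane ([rootD_posdef]). Secondly, the powers
    in the characteristic matrix are contour integrals with a cut along the
    positive axis, whereas the differential equation needs powers of T which are
    smooth in phi. The latter are finite sums over the spectrum, by the binomial
    series in the nilpotent part, with a logarithm of cos phi + c sin phi that is
    continued along phi ([ray_log]); its imaginary part increases from 0 to 2 pi over a full
    turn, so at alpha it is the argument in the definition. The contour integrals
    are evaluated from the same spectral splitting: around an eigenvalue the
    integrand is a Laurent polynomial plus a term of order rho, so that only
    the integrals of exp (i k t) over a period are needed ([holo_calculus_partition]). *)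

(** * Splitting the identity over the spectrum *)

(** Induction on the points, with one Bezout relation between a new factor and the
    product of the previous ones; the empty family is covered because the sum is
    only asked to be 1 modulo p. *)
Lemma coprime_partition (F : fieldType) (m : nat) (s : seq F) : uniq s ->
  let p := \prod_(c <- s) ('X - c%:P) ^+ m in
  exists q : F -> {poly F},
    p %| 1 - \sum_(c <- s) q c /\
    {in s, forall c, p %| ('X - c%:P) ^+ m * q c}.
Proof.
elim: s => [_|c s IHs] /=.
  by exists (fun=> 0); rewrite !big_nil subr0 dvdpp.
case/andP=> c_s /IHs [q [q1 qs]]; rewrite big_cons.
set a := ('X - c%:P) ^+ m; set p := \prod_(c <- s) _ in q1 qs *.
have /Bezout_eq1_coprimepP [[u v] /= uv1] : coprimep a p.
  rewrite coprimep_sym coprimep_expr // coprimep_XsubC.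
  apply: contra c_s; rewrite /root horner_prod prodf_seq_eq0 => /hasP[d ds].
  rewrite /= horner_exp !hornerE expf_eq0 subr_eq0 => /andP[_ /eqP ->] //.
have ne d : d \in s -> (d == c) = false.
  by move=> ds; apply/negbTE; apply: contraNneq c_s => <-.
exists (fun d => if d == c then v * p else u * a * q d); split.
  rewrite big_cons eqxx big_seq_cond.
  under eq_bigr => d /andP[/ne -> _] do rewrite -mulrA.
  rewrite -big_seq_cond -mulr_sumr -mulr_sumr.
  have -> : 1 - (v * p + u * (a * \sum_(i <- s) q i)) =
            u * (a * (1 - \sum_(c <- s) q c)).
    by rewrite -[X in X - _]uv1; ring.
  by rewrite dvdp_mull // dvdp_mul.
move=> d; rewrite inE; case: eqVneq => [-> _|dc /= ds].
  by rewrite mulrCA dvdp_mull.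
have -> : ('X - d%:P) ^+ m * (u * a * q d) = u * (a * (('X - d%:P) ^+ m * q d)).
  by ring.
by rewrite dvdp_mull // dvdp_mul // qs.
Qed.

(** By Cayley-Hamilton, the polynomials of a partition of unity modulo a multiple of
    the characteristic polynomial become, at A, the projections onto the generalised
    eigenspaces. That they are polynomials in A matters later: they commute with A. *)
Lemma spectral_partition (C : closedFieldType) n (A : 'M[C]_n.+1) :
  exists (s : seq C) (q : C -> {poly C}),
    [/\ {in s, forall c, eigenvalue A c},
        \sum_(c <- s) horner_mx A (q c) = 1 &
        {in s, forall c, (A - c%:M) ^+ n.+1 * horner_mx A (q c) = 0}].
Proof.
have [r] := closed_field_poly_normal (char_poly A).
rewrite (monicP (char_poly_monic A)) scale1r => char_r.
have size_r : size r = n.+1.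
  by have := size_char_poly A; rewrite char_r size_prod_XsubC => -[].
set p := \prod_(c <- undup r) ('X - c%:P) ^+ n.+1.
have p0 : horner_mx A p = 0.
  have : char_poly A %| p.
    rewrite char_r -prodr_undup_exp_count /p.
    elim: (undup r) => [|c s IHs]; rewrite ?big_nil ?dvdpp // !big_cons.
    by rewrite dvdp_mul // dvdp_exp2l // -size_r count_size.
  case/dvdpP=> d ->; rewrite rmorphM /= Cayley_Hamilton mulr0 //.
have [q [q1 qs]] := coprime_partition n.+1 (undup_uniq r).
exists (undup r), q; split=> [c||c cr].
- by rewrite mem_undup eigenvalue_root_char char_r root_prod_XsubC.
- case/dvdpP: q1 => d /(congr1 (horner_mx A)).
  rewrite rmorphB rmorphM /= p0 mulr0 rmorph1 rmorph_sum => /eqP.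
  by rewrite subr_eq0 => /eqP <-.
- have /dvdpP[d /(congr1 (horner_mx A))] := qs c cr.
  rewrite !rmorphM /= p0 mulr0 rmorphXn rmorphB /= horner_mx_X horner_mx_C //.
Qed.

(** * Lyapunov's inertia argument *)

Section Lyapunov.
Context {R : realType}.
Local Notation C := R[i].

Definition adjm {m n} (A : 'M[C]_(m, n)) : 'M[C]_(n, m) := (map_mx conjc A)^T.

Definition posherm {n} (A : 'M[C]_n) : Prop :=
  forall x : 'cV[C]_n, x != 0 -> 0 < (adjm x *m A *m x) 0 0.

Lemma mulmx11 (F : pzRingType) (A B : 'M[F]_1) : (A *m B) 0 0 = A 0 0 * B 0 0.
Proof. by rewrite mxE big_ord1. Qed.

Lemma adjmK m n (A : 'M[C]_(m, n)) : adjm (adjm A) = A.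
Proof. by apply/matrixP => i j; rewrite !mxE conjcK. Qed.

Lemma adjmM m n p (A : 'M[C]_(m, n)) (B : 'M[C]_(n, p)) :
  adjm (A *m B) = adjm B *m adjm A.
Proof. by rewrite /adjm map_mxM trmx_mul. Qed.

Lemma adjmD m n (A B : 'M[C]_(m, n)) : adjm (A + B) = adjm A + adjm B.
Proof. by rewrite /adjm map_mxD linearD. Qed.

Lemma adjmZ m n a (A : 'M[C]_(m, n)) : adjm (a *: A) = conjc a *: adjm A.
Proof. by rewrite /adjm map_mxZ linearZ. Qed.

Lemma adjm0 m n : adjm (0 : 'M[C]_(m, n)) = 0.
Proof. by rewrite /adjm map_mx0 trmx0. Qed.

Lemma herm_sqrD n p (M : 'M[C]_n) (u v : 'M[C]_(n, p)) :
  adjm (u + v) *m M *m (u + v) =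
  adjm u *m M *m u + adjm u *m M *m v + (adjm v *m M *m u + adjm v *m M *m v).
Proof. by rewrite adjmD !mulmxDl !mulmxDr [RHS]addrACA -addrACA. Qed.

(** A vector in the kernel would make the form vanish. *)
Lemma posherm_unit n (A : 'M[C]_n) : posherm A -> A \in unitmx.
Proof.
move=> Apos; rewrite unitmxE unitfE -det_tr; apply/negP => /det0P[v v0 vA].
have := Apos v^T; rewrite -mulmxA -[A *m _]trmxK trmx_mul trmxK vA trmx0 mulmx0.
by rewrite mxE ltxx trmx_eq0 v0 => /(_ isT).
Qed.

Lemma lyapunov_scalar (v delta q : C) : 0 < complex.Im v -> conjc delta = delta ->
  (conjc v - v) * delta = Complex 0 (- 2%:R) * q -> 0 < q -> 0 < delta.
Proof.
case: v delta q => [v w] [d e] [q q'] /= w0 /(congr1 (@complex.Im R))/= ee.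
move=> /(congr1 (@complex.Im R))/=; rewrite !ltcE /= => eqIm /andP[/eqP q'0 q0].
have e0 : e = 0 by lra.
have dE : w * d = q by rewrite e0 in eqIm; lra.
by rewrite e0 eqxx /=; move: q0; rewrite -dE pmulr_rgt0.
Qed.

(** Induction on the dimension. The last coordinates span an invariant hyperplane,
    on which D is positive; the D-orthogonal complement of this hyperplane is
    spanned by one vector e, with V e = x e modulo the hyperplane, and the equation
    tested on e determines the sign of the form on e from that of Im x. *)
Lemma lyapunov_trig n (V D Q : 'M[C]_n) : is_trig_mx V ->
  (forall i, 0 < complex.Im (V i i)) -> adjm D = D ->
  adjm V *m D - D *m V = Complex 0 (- 2%:R) *: Q -> posherm Q -> posherm D.
Proof.
move=> Vtrig; elim/trigsqmx_ind: Vtrig D Q => {n V}.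
  by move=> D Q _ _ _ _ x; rewrite flatmx0 eqxx.
move=> n x w V Vtrig IH D Q ImV.
rewrite -(submxK D) -(submxK Q).
set a := ulsubmx D; set b := ursubmx D; set b' := dlsubmx D.
set D' := drsubmx D; set q := ulsubmx Q; set Q' := drsubmx Q.
rewrite /adjm map_block_mx tr_block_mx => /eq_block_mx[a_herm b_herm _ D_herm].
rewrite -[X in X *m _ - _]/(adjm (block_mx x 0 w V)).
move=> eqn Qpos.
have D'pos : posherm D'.
  apply: (IH _ Q') => //.
  - by move=> i; have := ImV (rshift 1 i); rewrite block_mxEdr.
  - move: eqn; rewrite /adjm map_block_mx tr_block_mx !mulmx_block.
    rewrite opp_block_mx add_block_mx scale_block_mx => /eq_block_mx[_ _ _].
    by rewrite map_mx0 trmx0 mulmx0 mul0mx !add0r.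
  - move=> z z0; have := Qpos (col_mx 0 z).
    rewrite col_mx_eq0 eqxx z0 => /(_ isT).
    rewrite -mulmxA mul_block_col !mulmx0 !add0r /adjm map_col_mx tr_col_mx.
    by rewrite mul_row_col map_mx0 trmx0 mul0mx add0r mulmxA.
have D'unit := posherm_unit D'pos.
have b'E : b' = adjm b by rewrite -b_herm -/(adjm b') adjmK.
(* The vector e is D-orthogonal to the last coordinates. *)
pose y := - (invmx D' *m b'); pose e := col_mx (1%:M : 'M[C]_1) y.
pose delta := a + b *m y.
have De : block_mx a b b' D' *m e = col_mx delta 0.
  by rewrite mul_block_col !mulmx1; congr col_mx; rewrite /y mulmxN mulKVmx // subrr.
have Ve : block_mx x 0 w V *m e = col_mx x (w + V *m y).
  by rewrite mul_block_col !mulmx1 mul0mx addr0.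
have deltaE : adjm e *m block_mx a b b' D' *m e = delta.
  rewrite -mulmxA De /e /adjm map_col_mx tr_col_mx mul_row_col mulmx0 addr0.
  by rewrite map_mx1 trmx1 mul1mx.
have DD : adjm (block_mx a b b' D') = block_mx a b b' D'.
  by rewrite /adjm map_block_mx tr_block_mx a_herm D_herm -/(adjm b) -/(adjm b') b'E adjmK.
have dd : adjm delta = delta.
  by rewrite -deltaE !adjmM adjmK DD mulmxA.
have d00 : conjc (delta 0 0) = delta 0 0.
  by have := congr1 (fun M : 'M[C]_1 => M 0 0) dd; rewrite mxE mxE.
have eD : adjm e *m block_mx a b b' D' = adjm (col_mx delta 0).
  by rewrite -De adjmM DD.
have dpos : 0 < delta 0 0.
  have e0 : e != 0 by rewrite col_mx_eq0 negb_and oner_eq0.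
  have := congr1 (fun M => (adjm e *m M *m e) 0 0) eqn.
  rewrite mulmxBr mulmxBl. rewrite !mulmxA. rewrite -adjmM Ve.
  rewrite eD.
  rewrite -[_ *m block_mx a b b' D' *m e]mulmxA De.
  rewrite -[_ *m block_mx x 0 w V *m e]mulmxA Ve.
  rewrite -scalemxAr -scalemxAl.
  rewrite {1 2}/adjm !map_col_mx !tr_col_mx !mul_row_col map_mx0 trmx0 mulmx0 mul0mx !addr0.
  move=> eq00; apply: (lyapunov_scalar (v := x 0 0)) (Qpos e e0).
  - by have := ImV (lshift n 0); rewrite block_mxEul.
  - exact: d00.
  - move: eq00; rewrite [in X in _ = X -> _]mxE => <-.
    rewrite [RHS]mxE [X in _ = _ + X]mxE !mulmx11 mulrBl.
    have aE (M : 'M[C]_1) : adjm M 0 0 = conjc (M 0 0) by rewrite !mxE.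
    by rewrite ?dd ?d00 !aE ?d00 ?mulNr; congr (_ - _); rewrite mulrC.
move=> z z0.
pose z1 := usubmx z; pose z2 := dsubmx z - y *m z1.
have zE : z = e *m z1 + col_mx 0 z2.
  rewrite mul_col_mx mul1mx add_col_mx addr0 /z2 addrCA subrr addr0.
  by rewrite vsubmxK.
have e2 : adjm e *m block_mx a b b' D' *m col_mx 0 z2 = 0.
  rewrite eD {1}/adjm map_col_mx tr_col_mx.
  by rewrite mul_row_col map_mx0 trmx0 mul0mx mulmx0 addr0.
have eq2 : adjm (col_mx 0 z2) *m block_mx a b b' D' *m e = 0.
  have := congr1 (@adjm _ _) e2.
  by rewrite adjmM adjmM adjmK DD mulmxA adjm0.
have e3 : adjm (col_mx 0 z2) *m block_mx a b b' D' *m col_mx 0 z2 =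
    adjm z2 *m D' *m z2.
  rewrite -mulmxA mul_block_col !mulmx0 !add0r {1}/adjm map_col_mx tr_col_mx.
  by rewrite mul_row_col map_mx0 trmx0 mul0mx add0r mulmxA.
have -> : adjm z *m block_mx a b b' D' *m z =
    adjm z1 *m delta *m z1 + adjm z2 *m D' *m z2.
  have t1 : adjm (e *m z1) *m block_mx a b b' D' *m (e *m z1) =
      adjm z1 *m delta *m z1 by rewrite -deltaE adjmM !mulmxA.
  have t2 : adjm (e *m z1) *m block_mx a b b' D' *m col_mx 0 z2 = 0.
    by rewrite adjmM -2!mulmxA [adjm e *m _]mulmxA e2 mulmx0.
  have t3 : adjm (col_mx 0 z2) *m block_mx a b b' D' *m (e *m z1) = 0.
    by rewrite mulmxA eq2 mul0mx.
  by rewrite [in LHS]zE herm_sqrD t1 t2 t3 e3 addr0 add0r.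
rewrite mxE.
have z1E : (adjm z1 *m delta *m z1) 0 0 = delta 0 0 * (`|z1 0 0| ^+ 2).
  by rewrite !mulmx11 !mxE sqr_normc mulrC mulrA mulrC mulrCA.
rewrite z1E; have [z20|z20] := eqVneq z2 0.
  rewrite z20 mulmx0 [X in _ + X]mxE addr0 mulr_gt0 // exprn_gt0 // normr_gt0.
  apply: contraNneq z0 => z100; rewrite zE z20.
  have -> : z1 = 0 by apply/matrixP => i j; rewrite !ord1 z100 mxE.
  by rewrite mulmx0 add0r col_mx0.
by rewrite ltr_wpDl ?D'pos // mulr_ge0 ?exprn_ge0 // ltW.
Qed.

(** A Schur basis, being orthonormal, reduces to the triangular case. *)
Lemma lyapunov_posherm n (V D Q : 'M[C]_n) :
  (forall z, eigenvalue V z -> 0 < complex.Im z) -> adjm D = D ->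
  adjm V *m D - D *m V = Complex 0 (- 2%:R) *: Q -> posherm Q -> posherm D.
Proof.
case: n => [|n] in V D Q *.
  by move=> _ _ _ _ x; rewrite flatmx0 eqxx.
move=> ImV Dherm eqn Qpos.
have [P Punit] := Schur V isT.
have Pu := unitarymx_unit Punit.
have PP : P *m adjm P = 1%:M by move/unitarymxP: Punit; rewrite /adjm map_trmx.
have PP' : adjm P *m P = 1%:M by apply: mulmx1C.
have PV : invmx P = adjm P by rewrite -[LHS]mulmx1 -PP mulKmx.
rewrite /similar_to conjumx // PV => VT.
set T := P *m V *m adjm P in VT.
have Tpos : posherm (P *m D *m adjm P).
  apply: (lyapunov_trig (V := T) (Q := P *m Q *m adjm P)) => //.
  - move=> i; apply: ImV; have : eigenvalue T (T i i).
      rewrite eigenvalue_root_char char_poly_trig // rootE horner_prod.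
      by rewrite (bigD1 i) //= hornerXsubC subrr mul0r.
    case/eigenvalueP => v vT v0; apply/eigenvalueP; exists (v *m P).
      by rewrite scalemxAl -vT /T -!mulmxA PP' mulmx1.
    by apply: contraNneq v0 => vP; rewrite -[v]mulmx1 -PP mulmxA vP mul0mx.
  - by rewrite !adjmM adjmK Dherm mulmxA.
  - have PMP (M N : 'M[C]_n.+1) :
        P *m M *m adjm P *m (P *m N *m adjm P) = P *m (M *m N) *m adjm P.
      rewrite -[LHS]mulmxA [adjm P *m _]mulmxA [adjm P *m _]mulmxA PP' mul1mx.
      by rewrite -!mulmxA.
    have -> : adjm T = P *m adjm V *m adjm P by rewrite /T !adjmM adjmK mulmxA.
    by rewrite !PMP -mulmxBl -mulmxBr eqn -scalemxAr -scalemxAl.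
  - move=> x x0; rewrite -{1}[P]adjmK !mulmxA -adjmM -mulmxA; apply: Qpos.
    by apply: contraNneq x0 => Px; rewrite -[x]mul1mx -PP -mulmxA Px mulmx0.
move=> x x0; have := Tpos (P *m x).
rewrite adjmM !mulmxA -(mulmxA _ (adjm P) P) PP' mulmx1.
rewrite -(mulmxA _ (adjm P) P) PP' mulmx1; apply.
by apply: contraNneq x0 => Px; rewrite -[x]mul1mx -PP' -mulmxA Px mulmx0.
Qed.
End Lyapunov.

(** * The structure of a standard root *)

Lemma eigenvalue_det (F : fieldType) n (A : 'M[F]_n) (a : F) :
  eigenvalue A a = (\det (A - a%:M) == 0).
Proof.
by rewrite /eigenvalue /eigenspace kermx_eq0 row_free_unit unitmxE unitfE negbK.
Qed.

Lemma right_eigenvalue (F : fieldType) n (A : 'M[F]_n) (a : F) (x : 'cV[F]_n) :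
  x != 0 -> A *m x = a *: x -> eigenvalue A a.
Proof.
move=> x0 Ax; rewrite eigenvalue_det -det_tr; apply/det0P; exists x^T.
  by rewrite trmx_eq0.
by rewrite -trmx_mul mulmxBl Ax mul_scalar_mx subrr trmx0.
Qed.

Section RootStructure.
Context {R : realType}.
Local Notation C := R[i].
Local Notation ii := (Complex (0 : R) 1).

Lemma cmxM m n p (A : 'M[R]_(m, n)) (B : 'M[R]_(n, p)) :
  cmx (A *m B) = cmx A *m cmx B.
Proof. exact: map_mxM. Qed.

Lemma cmxD m n (A B : 'M[R]_(m, n)) : cmx (A + B) = cmx A + cmx B.
Proof. exact: map_mxD. Qed.

Lemma cmxN m n (A : 'M[R]_(m, n)) : cmx (- A) = - cmx A.
Proof. exact: map_mxN. Qed.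

Lemma cmxZ m n (a : R) (A : 'M[R]_(m, n)) : cmx (a *: A) = a%:C *: cmx A.
Proof. exact: map_mxZ. Qed.

Lemma cmx_scalar n (a : R) : cmx (a%:M : 'M[R]_n) = (a%:C)%:M.
Proof. exact: map_scalar_mx. Qed.

Lemma cmx_inj m n : injective (@cmx R m n).
Proof. exact: map_mx_inj. Qed.

Lemma cmx_unit n (A : 'M[R]_n) : (cmx A \in unitmx) = (A \in unitmx).
Proof. exact: map_unitmx. Qed.

Lemma cmx_inv n (A : 'M[R]_n) : cmx (invmx A) = invmx (cmx A).
Proof. exact: map_invmx. Qed.

Lemma adjm_cmx m n (A : 'M[R]_(m, n)) : adjm (cmx A) = cmx A^T.
Proof. by apply/matrixP => i j; rewrite !mxE conjc_real. Qed.

Lemma conj_cmx n (A : 'M[R]_n) : conj_mx (cmx A) = cmx A.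
Proof. by apply/matrixP => i j; rewrite !mxE conjc_real. Qed.

Lemma ReImE n (V : 'M[C]_n) : V = cmx (Re_mx V) + ii *: cmx (Im_mx V).
Proof. by apply/matrixP => i j; rewrite !mxE [LHS]complexE. Qed.

Lemma Im_mx_rect n (A B : 'M[R]_n) : Im_mx (cmx A + ii *: cmx B) = B.
Proof. by apply/matrixP => i j; rewrite !mxE /= !(mul0r, mulr0, mul1r) !add0r. Qed.

Lemma cmx_rect_mul m n p (A B : 'M[R]_(m, n)) (X Y : 'M[R]_(n, p)) :
  (cmx A - ii *: cmx B) *m (cmx X + ii *: cmx Y) =
  cmx (A *m X + B *m Y) + ii *: cmx (A *m Y - B *m X).
Proof.
have BY : ii *: cmx B *m (ii *: cmx Y) = - cmx (B *m Y).
  by rewrite -scalemxAl -scalemxAr scalerA -expr2 sqr_i scaleN1r cmxM.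
rewrite mulmxBl !mulmxDr BY -scalemxAr -scalemxAl -!cmxM [in LHS]opprD opprK.
rewrite [- _ + cmx (B *m Y)]addrC addrACA -scalerBr -cmxD.
by rewrite [in RHS](cmxD (A *m Y)) cmxN.
Qed.

Lemma posherm_cmx n (A : 'M[R]_n) : A^T = A -> posherm (cmx A) -> posdef_mx A.
Proof.
move=> As Ap; split=> // x x0; have := Ap (cmx x).
have -> : cmx x != 0.
  by apply: contraNneq x0 => xx; apply/eqP/(@cmx_inj _ _); rewrite xx /cmx map_mx0.
move=> /(_ isT); rewrite adjm_cmx -!cmxM mxE ltcE /= => /andP[_] //.
Qed.

Lemma posdef_posherm n (A : 'M[R]_n) : posdef_mx A -> posherm (cmx A).
Proof.
case=> As Ap x x0; pose a : 'cV[R]_n := map_mx (@complex.Re R) x.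
pose b : 'cV[R]_n := map_mx (@complex.Im R) x.
have xE : x = cmx a + ii *: cmx b.
  by apply/matrixP => j k; rewrite !mxE [LHS]complexE.
have -> : adjm x = cmx a^T - ii *: cmx b^T.
  rewrite xE adjmD adjmZ !adjm_cmx -scaleNr; congr (_ + _ *: _).
  by apply/eqP; rewrite eq_complex /= oppr0 !eqxx.
rewrite -mulmxA [X in _ *m (_ *m X)]xE mulmxDr -scalemxAr -!cmxM cmx_rect_mul.
have -> : a^T *m (A *m b) - b^T *m (A *m a) = 0.
  apply/eqP; rewrite subr_eq0; apply/eqP/matrixP => i j; rewrite !ord1.
  have <- : (b^T *m (A *m a))^T = a^T *m (A *m b).
    by rewrite !trmx_mul trmxK As mulmxA.
  by rewrite mxE.
rewrite /cmx map_mx0 scaler0 addr0 mxE ltcE /= eqxx /= mxE !mulmxA.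
have pos_or0 (y : 'cV[R]_n) : 0 <= (y^T *m A *m y) 0 0.
  by have [->|/Ap/ltW //] := eqVneq y 0; rewrite mulmx0 mxE.
have [a0|a0] := eqVneq a 0; last by rewrite ltr_pwDl // Ap.
have [b0|b0] := eqVneq b 0; last by rewrite ltr_wpDl // Ap.
by move: x0; rewrite xE a0 b0 /cmx !map_mx0 scaler0 addr0 eqxx.
Qed.

Lemma posdef_unit n (A : 'M[R]_n) : posdef_mx A -> A \in unitmx.
Proof.
case=> As Ap; rewrite unitmxE unitfE -det_tr; apply/negP => /det0P[v v0 vA].
have := Ap v^T; rewrite -mulmxA -[A *m _]trmxK trmx_mul trmxK vA trmx0 mulmx0.
by rewrite mxE ltxx trmx_eq0 v0 => /(_ isT).
Qed.

Lemma adjm_sqr_gt0 n (y : 'cV[C]_n) : y != 0 -> 0 < (adjm y *m y) 0 0.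
Proof.
move=> y0; rewrite mxE.
have [k yk] : exists k, y k 0 != 0.
  apply/existsP; apply: contraNT y0 => /existsPn yk; apply/eqP/matrixP => i j.
  by rewrite ord1 mxE; apply/eqP/negPn.
rewrite (bigD1 k) //= ltr_wpDr //.
  by apply: sumr_ge0 => i _; rewrite !mxE mulrC mulcJ_ge0.
by rewrite !mxE mulrC -sqr_normc exprn_gt0 // normr_gt0.
Qed.

(** This is applied to the kernel of D, which the adjoint of a standard root
    preserves. *)
Lemma stable_eigenvector n (K g : 'M[C]_n) : stablemx K g -> K != 0 ->
  exists (a : C) (y : 'rV[C]_n), [/\ y != 0, (y <= K)%MS & y *m g = a *: y].
Proof.
move=> Kg K0; have rK : (0 < \rank K)%N by rewrite lt0n mxrank_eq0.
pose B := row_base K; pose f := B *m g *m pinvmx B.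
have [a /eigenvalueP[v vf v0]] := eigenvalue_closed f rK.
have BgB : (B *m g <= B)%MS.
  by rewrite (eqmxMr g (eq_row_base K)) eq_row_base.
exists a, (v *m B); split.
- by rewrite mulmx_free_eq0 ?row_base_free.
- by rewrite mulmx_sub // eq_row_base.
- by rewrite scalemxAl -vf /f -[LHS]mulmxA -[in LHS](mulmxKpV BgB) !mulmxA.
Qed.

Section Root.
Context {n : nat} (V : 'M[C]_n) (A11 A12 : 'M[R]_n).
Hypothesis V_root : standard_root A11 A12 V.
Let D := rootD V.
Let X := Re_mx V.

Lemma root_mul : cmx A11 = adjm V *m V.
Proof.
have [_ /(_ 0)] := V_root; rewrite /symbol !expr1n scale1r !mulr0 scale0r.
by rewrite expr0n scale0r !addr0 raddf0 !subr0.
Qed.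

Lemma root_add : 2%:R *: cmx A12 = - (V + adjm V).
Proof.
have [_ /(_ 1)] := V_root; rewrite /symbol !expr1n !scale1r !mulr1 root_mul.
rewrite -/(adjm V) mulmxBl mulmxBr mulmx1 mul1mx -addrA -[RHS]addrA => /addrI.
move=> e; apply: (addIr 1%:M); rewrite e opprB opprD addrA addrAC.
by rewrite [- adjm V - V]addrC.
Qed.

Lemma adjm_rootE : adjm V = cmx X^T - ii *: cmx D^T.
Proof.
rewrite [in LHS](ReImE V) adjmD adjmZ !adjm_cmx -scaleNr; congr (_ + _ *: _).
by apply/eqP; rewrite eq_complex /= oppr0 !eqxx.
Qed.

(** The imaginary part of - 2 A12 = V + V^* vanishes. *)
Lemma rootD_sym : D^T = D.
Proof.
have := congr1 (@Im_mx _ _) root_add; rewrite adjm_rootE [in V + _](ReImE V).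
rewrite -/X -/D.
have -> : - (cmx X + ii *: cmx D + (cmx X^T - ii *: cmx D^T)) =
    cmx (- (X + X^T)) + ii *: cmx (D^T - D).
  apply/matrixP => a b; rewrite !mxE; apply/eqP; rewrite eq_complex /=.
  by apply/andP; split; apply/eqP; ring.
have -> : 2%:R *: cmx A12 = cmx (2%:R *: A12) + ii *: cmx 0.
  by rewrite cmxZ /cmx map_mx0 scaler0 addr0 rmorph_nat.
by rewrite !Im_mx_rect => /esym/eqP; rewrite subr_eq0 => /eqP.
Qed.

(** The imaginary part of A11 = V^* V vanishes. *)
Lemma rootD_commut : X^T *m D = D *m X.
Proof.
have := congr1 (@Im_mx _ _) root_mul; rewrite adjm_rootE [in _ *m V](ReImE V).
rewrite -/X -/D rootD_sym.
have -> : (cmx X^T - ii *: cmx D) *m (cmx X + ii *: cmx D) =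
    cmx (X^T *m X + D *m D) + ii *: cmx (X^T *m D - D *m X).
  exact: cmx_rect_mul.
have -> : cmx A11 = cmx A11 + ii *: cmx 0.
  by rewrite /cmx map_mx0 scaler0 addr0.
by rewrite !Im_mx_rect => /esym/eqP; rewrite subr_eq0 => /eqP.
Qed.

Lemma lyapunov_root :
  adjm V *m cmx D - cmx D *m V = Complex 0 (- 2%:R) *: (cmx D *m cmx D).
Proof.
rewrite adjm_rootE [in _ *m V](ReImE V) -/X -/D rootD_sym mulmxDr mulmxBl.
rewrite -!cmxM rootD_commut opprD addrACA subrr add0r -scalemxAl -scalemxAr.
rewrite -opprD -scalerDl -scaleNr -cmxM; congr (_ *: _).
by apply/eqP; rewrite eq_complex /=; apply/andP; split; apply/eqP; lra.
Qed.

(** On the kernel of D the adjoint of V is a real matrix, so that its eigenvalues there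
    come in conjugate pairs, against the position of the spectrum of V. *)
Lemma rootD_unit : D \in unitmx.
Proof.
rewrite -cmx_unit -row_free_unit -kermx_eq0; apply/negPn/negP => K0.
have KD : kermx (cmx D) *m cmx D = 0 by apply: mulmx_ker.
have Kst : stablemx (kermx (cmx D)) (adjm V).
  apply/sub_kermxP; rewrite -mulmxA.
  have -> : adjm V *m cmx D = cmx D *m (V + Complex 0 (- 2%:R) *: cmx D).
    by rewrite mulmxDr -scalemxAr -lyapunov_root addrC subrK.
  by rewrite mulmxA KD mul0mx.
have [a [y [y0 /sub_kermxP yD ya]]] := stable_eigenvector Kst K0.
have VE : V = adjm V + (V - adjm V) by rewrite addrC subrK.
have yX : y *m cmx X^T = a *: y.
  move: ya; rewrite adjm_rootE rootD_sym mulmxBr -scalemxAr yD scaler0 subr0 //.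
have eigV b (z : 'rV[C]_n) : z != 0 -> z *m cmx D = 0 -> z *m cmx X^T = b *: z ->
    eigenvalue V (conjc b).
  move=> z0 zD zX; apply: (@right_eigenvalue _ _ _ _ (adjm z)).
    by rewrite trmx_eq0 map_mx_eq0.
  rewrite [in LHS](ReImE V) mulmxDl -scalemxAl.
  have -> : cmx (Im_mx V) *m adjm z = 0.
    rewrite -[cmx _]adjmK adjm_cmx -/(rootD V) -/D rootD_sym -adjmM zD.
    by rewrite adjm0.
  by rewrite scaler0 addr0 -[cmx _]adjmK adjm_cmx -adjmM zX adjmZ.
have [ImV _] := V_root.
have := ImV _ (eigV a y y0 yD yX); have := ImV _ (eigV (conjc a) (map_mx conjc y) _ _ _).
have -> : complex.Im (conjc a) = - complex.Im a by case: (a).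
rewrite conjcK => H1 H2; have : 0 < complex.Im a; last lra.
apply: H1; first by rewrite map_mx_eq0.
  by rewrite -[cmx D]conj_cmx /conj_mx -map_mxM yD map_mx0.
by rewrite -[cmx X^T]conj_cmx /conj_mx -map_mxM yX map_mxZ.
Qed.

Lemma rootD_posdef : posdef_mx D.
Proof.
apply: posherm_cmx rootD_sym _; have [ImV _] := V_root.
apply: lyapunov_posherm lyapunov_root _ => //; first by rewrite adjm_cmx rootD_sym.
have := rootD_unit; rewrite -cmx_unit => Du x x0.
rewrite -{1}rootD_sym -adjm_cmx. rewrite mulmxA -adjmM -mulmxA.
set y := cmx D *m x.
have y0 : y != 0 by apply: contraNneq x0 => yy; rewrite -[x](mulKmx Du) -/y yy mulmx0.
by apply: adjm_sqr_gt0.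
Qed.

End Root.
End RootStructure.

(** * Square roots of positive definite matrices, and the matrices E and Z *)

Lemma interpolation (F : fieldType) (s : seq F) (g : F -> F) : uniq s ->
  exists p : {poly F}, {in s, forall x, p.[x] = g x}.
Proof.
elim: s => [_|c s IHs] /=; first by exists 0.
case/andP=> cs /IHs[p ps]; pose w := \prod_(d <- s) ('X - d%:P).
have wc : w.[c] != 0.
  by rewrite -[_ == _]/(root w c) root_prod_XsubC.
exists (p + ((g c - p.[c]) / w.[c]) *: w) => x; rewrite inE hornerD hornerZ.
case: eqVneq => [-> _|_ /= xs]; first by rewrite divfK // addrC subrK.
have /rootP -> : root w x by rewrite root_prod_XsubC.
by rewrite mulr0 addr0 ps.
Qed.

(** Used to see that a polynomial in a symmetric matrix is symmetric. *)
Lemma trmx_horner (F : comNzRingType) n (A : 'M[F]_n.+1) (p : {poly F}) :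
  (horner_mx A p)^T = horner_mx A^T p.
Proof.
elim/poly_ind: p => [|p c IHp]; first by rewrite !rmorph0 trmx0.
rewrite !rmorphD !rmorphM /= !horner_mx_X !horner_mx_C linearD /= tr_scalar_mx.
rewrite -[(_ * A)%R]/(_ *m A) trmx_mul IHp; congr (_ + _).
exact/comm_mx_horner/comm_mx_refl.
Qed.

(** A real polynomial that takes the value x^(1/4) at each eigenvalue x of D gives a
    real root, although D is diagonalised over the complex numbers. A fourth root is
    taken because its square is then visibly positive definite. *)
Lemma posdef_fourth_root (R : realType) n (D : 'M[R]_n.+1) : posdef_mx D ->
  exists B : 'M[R]_n.+1, B^T = B /\ B *m B *m (B *m B) = D.
Proof.
move=> [Ds Dp].
have Dn : cmx D \is normalmx.
  apply/normalmxP.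
  have DD : map_mx conjc (cmx D)^T = cmx D.
    by rewrite -map_trmx -/(adjm (cmx D)) adjm_cmx Ds.
  by have := erefl (cmx D *m cmx D); rewrite -{2 3}DD.
have [P [d [Pu PP DE]]] : exists (P : 'M[R[i]]_n.+1) (d : 'rV[R[i]]_n.+1),
    [/\ P \in unitmx, P *m adjm P = 1%:M & cmx D = invmx P *m diag_mx d *m P].
  exists (spectralmx (cmx D)), (spectral_diag (cmx D)); split.
  - exact: spectral_unit.
  - by have /unitarymxP := spectral_unitarymx (cmx D); rewrite /adjm map_trmx.
  - exact/orthomx_spectralP.
have PV : invmx P = adjm P by rewrite -[LHS]mulmx1 -PP mulKmx.
have d_gt0 i : 0 < d 0 i.
  have [x Px] : exists x, P *m x = delta_mx i (0 : 'I_1).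
    by exists (invmx P *m delta_mx i 0); rewrite mulKVmx.
  have Px' : adjm x *m adjm P = delta_mx 0 i.
    by rewrite -adjmM Px /adjm map_delta_mx trmx_delta.
  have xDx : (adjm x *m cmx D *m x) 0 0 = d 0 i.
    rewrite DE PV !mulmxA -mulmxA Px Px' -rowE -colE !mxE eqxx mulr1n //.
  rewrite -xDx posdef_posherm //; apply: contraTneq (oner_neq0 R[i]) => x0.
  have := congr1 (fun M : 'cV_n.+1 => M i 0) Px.
  by rewrite x0 mulmx0 !mxE !eqxx /= => /eqP; rewrite eq_sym oner_eq0.
have [p ps] := interpolation (fun x => Num.sqrt (Num.sqrt x))
  (undup_uniq [seq complex.Re (d 0 i) | i : 'I_n.+1]).
pose pd := map_mx (horner (map_poly (real_complex R) p)) d.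
have [B [Bs BE]] : exists B : 'M[R]_n.+1,
    B^T = B /\ cmx B = invmx P *m diag_mx pd *m P.
  exists (horner_mx D p); split; first by rewrite trmx_horner Ds.
  transitivity (horner_mx (cmx D) (map_poly (real_complex R) p)).
    exact: map_horner_mx.
  by rewrite DE horner_mx_uconjC // horner_mx_diag.
exists B; split=> //; apply: (@cmx_inj _ _ _).
have conjM (M N : 'M[R[i]]_n.+1) :
    (invmx P *m M *m P) *m (invmx P *m N *m P) = invmx P *m (M *m N) *m P.
  by rewrite !mulmxA mulmxK.
rewrite [LHS]cmxM !cmxM BE conjM conjM mulmx_diag mulmx_diag DE.
congr (_ *m diag_mx _ *m _).
apply/rowP => i; rewrite !mxE.
have dE : d 0 i = (complex.Re (d 0 i))%:C.
  by rewrite RRe_real // gtr0_real.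
have dR : 0 <= complex.Re (d 0 i) by have := d_gt0 i; rewrite ltcE => /andP[_ /ltW].
rewrite dE horner_map /= ps; last first.
  by rewrite mem_undup; apply/mapP; exists i; rewrite ?mem_enum.
have sqrtM (y : R) : 0 <= y -> Num.sqrt y * Num.sqrt y = y.
  by move=> y0; rewrite -expr2 sqr_sqrtr.
by rewrite -!rmorphM /= !sqrtM ?sqrtr_ge0.
Qed.

Lemma sqrt_mx_spec (R : realType) n (D : 'M[R]_n.+1) : posdef_mx D ->
  posdef_mx (sqrt_mx D) /\ sqrt_mx D *m sqrt_mx D = D.
Proof.
move=> Dpos; have [B [Bs BD]] := posdef_fourth_root Dpos.
have Bu : B \in unitmx.
  have := posdef_unit Dpos; rewrite -BD !unitmx_mul; by case/andP=> /andP[].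
suff : [set A : 'M[R]_n.+1 | posdef_mx A /\ A *m A = D]%classic (sqrt_mx D) by [].
apply: (@xgetPex _ 0); exists (B *m B); split=> //; split.
  by rewrite trmx_mul Bs.
move=> x x0; rewrite -{1}Bs mulmxA -trmx_mul -mulmxA.
have : B *m x != 0 by apply: contraNneq x0 => Bx; rewrite -[x](mulKmx Bu) Bx mulmx0.
move: (B *m x) => y y0; have := adjm_sqr_gt0 (y := cmx y).
rewrite map_mx_eq0 y0 => /(_ isT); rewrite adjm_cmx -cmxM mxE ltcE /= => /andP[] //.
Qed.

Lemma conjugate_affine {K : fieldType} {n : nat} (Q S : 'M[K]_n) (i c s : K) :
    Q \in unitmx ->
  Q *m (c%:M + s *: ((S + i%:M) *m (Q *m Q))) *m invmx Q =
  c%:M + s *: (Q *m S *m Q) + (i * s) *: (Q *m Q).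
Proof.
move=> Qu; rewrite mulmxDr mulmxDl mul_mx_scalar -scalemxAl mulmxV // -addrA scalemx1.
congr (_ + _); rewrite -scalemxAr -scalemxAl mulmxDl mulmxDr mulmxDl scalerDr.
by rewrite !mulmxA mulmxK // mul_mx_scalar -!scalemxAl mulmxK // scalerA mulrC.
Qed.

Section RootFactor.
Context {R : realType} {n : nat} (V : 'M[R[i]]_n.+1) (A11 A12 : 'M[R]_n.+1).
Hypothesis V_root : standard_root A11 A12 V.
Local Notation ii := (Complex (0 : R) 1).
Let D := rootD V.
Let S := rootS V.
Let Q := cmx (sqrt_mx D).

Lemma sqrtD_unit : Q \in unitmx.
Proof.
by rewrite cmx_unit; apply: posdef_unit; case: (sqrt_mx_spec (rootD_posdef V_root)).
Qed.

Lemma sqrtD_sqr : Q *m Q = cmx D.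
Proof. by rewrite -cmxM; case: (sqrt_mx_spec (rootD_posdef V_root)) => _ ->. Qed.

Lemma root_factor : V = (cmx S + ii%:M) *m cmx D.
Proof.
rewrite [LHS](ReImE V) mulmxDl mul_scalar_mx -cmxM /S /rootS mulmxKV //.
exact: rootD_unit V_root.
Qed.

Lemma rootS_D : S *m D = Re_mx V.
Proof. by rewrite /S /rootS mulmxKV // (rootD_unit V_root). Qed.

Lemma rootD_S : D *m S = (Re_mx V)^T.
Proof.
by rewrite /S /rootS mulmxA -(rootD_commut V_root) mulmxK // (rootD_unit V_root).
Qed.

(** In terms of S and D, V - V^* = [S, D] + 2 i D. *)
Lemma Emx_conjugate : 2%:R *: (Q *m Emx V *m Q) = V - adjm V.
Proof.
rewrite (adjm_rootE V) (rootD_sym V_root) [in RHS](ReImE V) /Emx -/D -/S.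
have Hu : sqrt_mx D \in unitmx by rewrite -cmx_unit sqrtD_unit.
rewrite mulmxDr mulmxDl cmxZ !cmxM !cmx_inv -/Q -scalemxAr -scalemxAl.
rewrite !mulmxA mulmxV ?sqrtD_unit // mul1mx mulmxKV ?sqrtD_unit //.
rewrite mul_mx_scalar -scalemxAl sqrtD_sqr /commutator_mx rootS_D rootD_S.
apply/matrixP => a b; rewrite !mxE; apply/eqP; rewrite eq_complex /=.
by apply/andP; split; apply/eqP; field.
Qed.

Lemma Zmx_conjugate a :
  Zmx V a = Q *m ((cos a)%:C%:M + (sin a)%:C *: V) *m invmx Q.
Proof.
have := conjugate_affine (cmx S) ii (cos a)%:C (sin a)%:C sqrtD_unit.
by rewrite sqrtD_sqr -root_factor => ->; rewrite /Zmx -/D -/S !cmxM.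
Qed.

(** V - V^* = D ([D^-1, C] + 2 i), and the spectrum of the real matrix [D^-1, C] is
    symmetric with respect to conjugation. *)
Lemma neumann_unit : neumann_well_posed V -> V - adjm V \in unitmx.
Proof.
move=> wp; rewrite (adjm_rootE V) (rootD_sym V_root) [X in X - _](ReImE V).
have Du := rootD_unit V_root.
have -> : cmx (Re_mx V) + ii *: cmx (Im_mx V) - (cmx (Re_mx V)^T - ii *: cmx (Im_mx V))
   = cmx D *m (cmx (commutator_mx (invmx D) (Re_mx V)) - (Complex 0 (- 2%:R))%:M).
  rewrite mulmxBr mul_mx_scalar -cmxM /commutator_mx mulmxBr mulKVmx //.
  rewrite mulmxA -(rootD_commut V_root) mulmxK //.
  apply/matrixP => a b; rewrite !mxE; apply/eqP; rewrite eq_complex /=.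
  by apply/andP; split; apply/eqP; ring.
rewrite unitmx_mul cmx_unit Du /= unitmxE unitfE -eigenvalue_det.
apply: contra wp => /eigenvalueP[v vM v0]; apply/eigenvalueP.
exists (map_mx conjc v); last by rewrite map_mx_eq0.
have := congr1 (map_mx conjc) vM; rewrite map_mxM map_mxZ.
rewrite -/(conj_mx _) conj_cmx => ->; congr (_ *: _).
by apply/eqP; rewrite eq_complex /= opprK !eqxx.
Qed.

End RootFactor.

(** * Differentiation of complex functions of a real variable *)

Section ComplexCalculus.
Context {R : realType}.
Local Notation C := R[i].
Local Notation Re := (@complex.Re R).
Local Notation Im := (@complex.Im R).
Local Notation ii := (Complex (0 : R) 1).
Implicit Types (f g : R -> C) (t x y : R) (z w : C).

Lemma ReD z w : Re (z + w) = Re z + Re w. Proof. by case: z w => ? ? []. Qed.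
Lemma ImD z w : Im (z + w) = Im z + Im w. Proof. by case: z w => ? ? []. Qed.
Lemma ReN z : Re (- z) = - Re z. Proof. by case: z. Qed.
Lemma ImN z : Im (- z) = - Im z. Proof. by case: z. Qed.
Lemma ReM z w : Re (z * w) = Re z * Re w - Im z * Im w.
Proof. by case: z w => ? ? []. Qed.
Lemma ImM z w : Im (z * w) = Re z * Im w + Im z * Re w.
Proof. by case: z w => ? ? []. Qed.
Lemma ReJ z : Re (conjc z) = Re z. Proof. by case: z. Qed.
Lemma ImJ z : Im (conjc z) = - Im z. Proof. by case: z. Qed.
Lemma cplx_eq z w : Re z = Re w -> Im z = Im w -> z = w.
Proof. by case: z w => ? ? [] ? ? /= -> ->. Qed.

(** Differentiability is taken componentwise, as in the definition of the operators
    of the model problem. *)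
Definition cder f t z : Prop :=
  is_derive t 1 (fun s => Re (f s)) (Re z) /\
  is_derive t 1 (fun s => Im (f s)) (Im z).

Lemma is_derive_to (h : R -> R) (t d e : R) :
  d = e -> is_derive t 1 h d -> is_derive t 1 h e.
Proof. by move=> ->. Qed.

Lemma cder_eq f t z w : z = w -> cder f t z -> cder f t w.
Proof. by move=> ->. Qed.

Lemma cder_near f g t z : (\forall s \near t, f s = g s) -> cder f t z -> cder g t z.
Proof.
move=> fg [df dg]; split.
- by apply: near_eq_is_derive df; near=> s; congr complex.Re; near: s.
- by apply: near_eq_is_derive dg; near=> s; congr complex.Im; near: s.
Unshelve. all: by end_near. Qed.

Lemma cder_ext f g t z : f =1 g -> cder f t z -> cder g t z.
Proof. by move=> /funext ->. Qed.

Lemma cder_uniq f t z w : cder f t z -> cder f t w -> z = w.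
Proof.
move=> [[_ a] [_ b]] [[_ c] [_ d]]; apply: cplx_eq.
  by rewrite -a c.
by rewrite -b d.
Qed.

Lemma cder_cst z t : cder (fun=> z) t 0.
Proof. by split; apply: is_derive_cst. Qed.

Lemma cderD f g t z w : cder f t z -> cder g t w -> cder (fun s => f s + g s) t (z + w).
Proof.
move=> [a b] [c d]; split.
  by under eq_fun do rewrite ReD; rewrite ReD; apply: is_deriveD.
by under eq_fun do rewrite ImD; rewrite ImD; apply: is_deriveD.
Qed.

Lemma cderN f t z : cder f t z -> cder (fun s => - f s) t (- z).
Proof.
move=> [a b]; split.
  by under eq_fun do rewrite ReN; rewrite ReN; apply: is_deriveN.
by under eq_fun do rewrite ImN; rewrite ImN; apply: is_deriveN.
Qed.

Lemma cderB f g t z w : cder f t z -> cder g t w -> cder (fun s => f s - g s) t (z - w).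
Proof. by move=> a b; apply: cderD => //; apply: cderN. Qed.

Lemma cderM f g t z w : cder f t z -> cder g t w ->
  cder (fun s => f s * g s) t (z * g t + f t * w).
Proof.
move=> [a b] [c d]; split.
  under eq_fun do rewrite ReM.
  apply: is_derive_to (is_deriveB (is_deriveM a c) (is_deriveM b d)).
  by rewrite ReD !ReM -?[_ *: _]/(_ * _); ring.
under eq_fun do rewrite ImM.
apply: is_derive_to (is_deriveD (is_deriveM a d) (is_deriveM b c)).
by rewrite ImD !ImM -?[_ *: _]/(_ * _); ring.
Qed.

Lemma cderMl f t z w : cder f t z -> cder (fun s => w * f s) t (w * z).
Proof.
by move=> d; apply: cder_eq (cderM (cder_cst w t) d); rewrite mul0r add0r.
Qed.

Lemma cderMr f t z w : cder f t z -> cder (fun s => f s * w) t (z * w).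
Proof.
by move=> d; apply: cder_eq (cderM d (cder_cst w t)); rewrite mulr0 addr0.
Qed.

Lemma cder_sum (I : Type) (r : seq I) (P : pred I) (F : I -> R -> C) (d : I -> C) t :
  (forall i, P i -> cder (F i) t (d i)) ->
  cder (fun s => \sum_(i <- r | P i) F i s) t (\sum_(i <- r | P i) d i).
Proof.
move=> dF; elim: r => [|i r IHr].
  by rewrite big_nil; under [fun _ => _]eq_fun do rewrite big_nil; apply: cder_cst.
rewrite big_cons; under [fun _ => _]eq_fun do rewrite big_cons.
by case: ifP => // Pi; apply: cderD => //; apply: dF.
Qed.

Lemma cderX f t z n : cder f t z ->
  cder (fun s => f s ^+ n) t (n%:R * f t ^+ n.-1 * z).
Proof.
move=> df; elim: n => [|n IHn].
  by rewrite !mul0r; under [fun _ => _]eq_fun do rewrite expr0; apply: cder_cst.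
under [fun _ => _]eq_fun do rewrite exprS.
apply: cder_eq (cderM df IHn); case: n {IHn} => [|n] /=.
  by rewrite !expr0; ring.
by rewrite -[in RHS]natr1 exprS; ring.
Qed.

Lemma cder_real (h : R -> R) t d : is_derive t 1 h d -> cder (fun s => (h s)%:C) t d%:C.
Proof. by move=> dh; split=> //=; apply: is_derive_cst. Qed.

Lemma cder_conj f t z : cder f t z -> cder (fun s => conjc (f s)) t (conjc z).
Proof.
move=> [a b]; split.
  by under eq_fun do rewrite ReJ; rewrite ReJ.
by under eq_fun do rewrite ImJ; rewrite ImJ; apply: is_deriveN.
Qed.

Lemma cder_comp f (h : R -> R) t z d : cder f (h t) z -> is_derive t 1 h d ->
  cder (fun s => f (h s)) t (d%:C * z).
Proof.
move=> [a b] dh; split.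
  apply: is_derive_to (is_derive1_comp a dh).
  by rewrite ReM /= mul0r subr0 -?[_ *: _]/(_ * _); ring.
apply: is_derive_to (is_derive1_comp b dh).
by rewrite ImM /= mul0r addr0 -?[_ *: _]/(_ * _); ring.
Qed.

Lemma cder_cexp f t z : cder f t z -> cder (fun s => cexp (f s)) t (z * cexp (f t)).
Proof.
move=> [a b].
have e := is_derive1_comp (is_derive_expR _) a.
split.
  apply: is_derive_to (is_deriveM e (is_derive1_comp (is_derive_cos _) b)).
  by rewrite ReM /= -?[_ *: _]/(_ * _); ring.
apply: is_derive_to (is_deriveM e (is_derive1_comp (is_derive_sin _) b)).
by rewrite ImM /= -?[_ *: _]/(_ * _); ring.
Qed.

(** The square of the modulus, as a real number. *)
Definition sqn z : R := Re z ^+ 2 + Im z ^+ 2.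

Lemma sqn_ge0 z : 0 <= sqn z.
Proof. by rewrite /sqn addr_ge0 // sqr_ge0. Qed.

Lemma sqn_gt0 z : z != 0 -> 0 < sqn z.
Proof.
move=> z0; rewrite lt_neqAle sqn_ge0 andbT eq_sym.
apply: contra z0; rewrite /sqn paddr_eq0 ?sqr_ge0 // !sqrf_eq0 => /andP[/eqP a /eqP b].
by apply/eqP/cplx_eq; rewrite ?a ?b.
Qed.

Lemma mul_conjc z : z * conjc z = (sqn z)%:C.
Proof.
by apply: cplx_eq; rewrite ?ReM ?ImM ReJ ImJ /sqn /= ?expr2; ring.
Qed.

Lemma invc_sqn z : z^-1 = conjc z * ((sqn z)^-1)%:C.
Proof.
have [->|z0] := eqVneq z 0; first by rewrite invr0 conjc0 mul0r.
apply: (mulfI z0); rewrite mulfV // mulrA mul_conjc -rmorphM /= divff //.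
by rewrite gt_eqF // sqn_gt0.
Qed.

(** The inverse is the conjugate divided by the square of the modulus. *)
Lemma cder_inv f t z : f t != 0 -> cder f t z ->
  cder (fun s => (f s)^-1) t (- z / f t ^+ 2).
Proof.
move=> ft0 [a b].
have df : cder f t z by [].
have := cderM (cder_conj df) (cder_real _).
have ds : is_derive t 1 (fun s => sqn (f s)) (2%:R * (Re (f t) * Re z + Im (f t) * Im z)).
  apply: is_derive_to (is_deriveD (is_deriveX 2 a) (is_deriveX 2 b)).
  by rewrite -?[_ *: _]/(_ * _) !expr1; ring.
have n0 : sqn (f t) != 0 by rewrite gt_eqF // sqn_gt0.
move=> /(_ _ _ (@is_deriveV R (fun s => sqn (f s)) t _ 1 n0 ds)) H.
apply: (cder_ext (fun s => esym (invc_sqn (f s)))); apply: cder_eq H.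
have -> : - z / f t ^+ 2 = - z * (conjc (f t)) ^+ 2 * ((sqn (f t))^-1 ^+ 2)%:C.
  by rewrite -exprVn invc_sqn exprMn rmorphXn /= mulrA.
by apply: cplx_eq; rewrite !(ReM, ImM, ReD, ImD, ReN, ImN, ReJ, ImJ, expr2) /=
   -?[_ *: _]/(_ * _) /sqn; field; rewrite -?expr2.
Qed.

(** The mean value theorem for the real and the imaginary part. *)
Lemma cder0_const f (a b : R) : a <= b ->
  (forall t, a <= t <= b -> cder f t 0) -> f a = f b.
Proof.
move=> ab df; have key (h : R -> R) :
    (forall t, a <= t <= b -> is_derive t 1 h 0) -> h a = h b.
  move=> dh; have := @MVT_segment R h (fun=> 0) a b ab.
  case=> [t||c _ /eqP]; last by rewrite mul0r subr_eq0 => /eqP.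
    rewrite in_itv /= => /andP[/ltW at_ /ltW tb]; have atb : a <= t <= b by rewrite at_.
    exact: (dh t atb).
  by apply: derivable_within_continuous => t; rewrite in_itv /= => /dh[].
apply: cplx_eq; first by apply: (key (fun s => Re (f s))) => t /df [].
by apply: (key (fun s => Im (f s))) => t /df [].
Qed.

Lemma cder_continuous f t z : cder f t z ->
  {for t, continuous (fun s => Re (f s))} /\ {for t, continuous (fun s => Im (f s))}.
Proof.
by move=> [[a _] [b _]]; split;
  apply/differentiable_continuous; rewrite -derivable1_diffP.
Qed.

End ComplexCalculus.

(** * Exponential and logarithm *)

Section ComplexLogarithm.
Context {R : realType}.
Local Notation C := R[i].
Local Notation Re := (@complex.Re R).
Local Notation Im := (@complex.Im R).
Local Notation ii := (Complex (0 : R) 1).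
Implicit Types (f : R -> C) (t : R) (z w L lambda : C).

Lemma cexpD z w : cexp (z + w) = cexp z * cexp w.
Proof.
by apply: cplx_eq; rewrite /cexp /= !(ReD, ImD, ReM, ImM) /= expRD ?sinD ?cosD; ring.
Qed.

Lemma cexp0 : cexp (0 : C) = 1.
Proof. by rewrite /cexp /= expR0 cos0 sin0 mulr1 mulr0. Qed.

Lemma cexpN z : cexp (- z) = (cexp z)^-1.
Proof.
have e : cexp z * cexp (- z) = 1 by rewrite -cexpD subrr cexp0.
have e0 : cexp z != 0 by apply/eqP => e0; have /eqP := e; rewrite e0 mul0r eq_sym oner_eq0.
by apply: (mulfI e0); rewrite e mulfV.
Qed.

Lemma cexp_neq0 z : cexp z != 0.
Proof.
apply/eqP => e0; have /eqP := cexp0.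
by rewrite -(subrr z) cexpD e0 mul0r eq_sym oner_eq0.
Qed.

Lemma cexp_conj z : cexp (conjc z) = conjc (cexp z).
Proof. by apply: cplx_eq; rewrite /cexp /= ReJ ImJ ?sinN ?cosN ?mulrN. Qed.

Lemma cnormE z : cnorm z = Num.sqrt (sqn z).
Proof. by case: z. Qed.

Lemma cnorm_cexp z : cnorm (cexp z) = expR (Re z).
Proof.
rewrite cnormE /sqn /cexp /= !exprMn -mulrDr cos2Dsin2 mulr1 sqrtr_sqr.
by rewrite ger0_norm // expR_ge0.
Qed.

(** An argument in [0, 2 pi) is determined by its cosine and the sign of its sine. *)
Lemma log_plus_cexp L : 0 <= Im L < 2%:R * pi -> log_plus (cexp L) = L.
Proof.
case/andP=> L0 L2; rewrite /log_plus /arg_plus cnorm_cexp expRK /cexp /=.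
have e0 : 0 < expR (Re L) by apply: expR_gt0.
apply: cplx_eq => //=; rewrite pmulr_rge0 //.
rewrite mulrAC divff ?gt_eqF // mul1r.
have [Lpi|piL] := leP (Im L) pi.
  have -> : 0 <= sin (Im L) by apply: sin_ge0_pi; rewrite L0.
  by rewrite cosK // in_itv /= L0.
have -> : sin (Im L) = - sin (Im L - pi).
  by rewrite sinB cospi sinpi; ring.
have s0 : 0 < sin (Im L - pi).
  by apply: sin_gt0_pi; apply/andP; split; lra.
rewrite leNgt oppr_lt0 s0 /=.
have -> : cos (Im L) = cos (2%:R * pi - Im L).
  by rewrite mulr_natl cosB sin2pi cos2pi mul1r mul0r addr0.
by rewrite cosK ?in_itv /=; [ring | apply/andP; split; lra].
Qed.

Lemma cpow_plus_cexp lambda L : 0 <= Im L < 2%:R * pi ->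
  cpow_plus lambda (cexp L) = cexp (lambda * L).
Proof. by move=> L02; rewrite /cpow_plus log_plus_cexp. Qed.

(** The two branches are exchanged by conjugation, so that only one needs a study. *)
Lemma cpow_minusE lambda z :
  cpow_minus lambda z = conjc (cpow_plus (conjc lambda) (conjc z)).
Proof.
rewrite /cpow_minus /cpow_plus -cexp_conj rmorphM /= conjcK; congr (cexp (_ * _)).
apply: cplx_eq; rewrite ?ReJ ?ImJ /log_plus /log_minus /=.
  by rewrite !cnormE /sqn ReJ ImJ sqrrN.
rewrite /arg_minus /arg_plus !cnormE /sqn ReJ ImJ sqrrN oppr_ge0.
by case: ifP => // _; rewrite opprB.
Qed.

(** The principal logarithm on the right half plane. *)
Definition half_log z : C := ln (cnorm z) +i* atan (Im z / Re z).

Lemma cexp_half_log z : 0 < Re z -> cexp (half_log z) = z.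
Proof.
move=> Rz; have z0 : z != 0 by apply: contraTneq Rz => ->; rewrite ltxx.
have n0 : 0 < cnorm z by rewrite cnormE sqrtr_gt0 sqn_gt0.
have nc : cnorm z * cos (atan (Im z / Re z)) = Re z.
  rewrite cos_atan.
  have -> : 1 + (Im z / Re z) ^+ 2 = sqn z / Re z ^+ 2.
    by rewrite /sqn; field; rewrite gt_eqF.
  rewrite sqrtrM ?sqn_ge0 // sqrtrV ?sqr_ge0 // sqrtr_sqr gtr0_norm // -cnormE.
  by rewrite invfM invrK mulrA mulfV ?gt_eqF // mul1r.
have ns : cnorm z * sin (atan (Im z / Re z)) = Im z.
  have c0 : cos (atan (Im z / Re z)) != 0.
    by apply: contraTneq Rz => c0; rewrite -nc c0 mulr0 ltxx.
  have : sin (atan (Im z / Re z)) = (Im z / Re z) * cos (atan (Im z / Re z)).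
    by rewrite -{2}[Im z / Re z]atanK /tan divfK.
  by move=> ->; rewrite mulrCA nc divfK // gt_eqF.
by apply: cplx_eq; rewrite /cexp /half_log /= lnK.
Qed.

Lemma cder_half_log f t z : 0 < Re (f t) -> cder f t z ->
  cder (fun s => half_log (f s)) t (z / f t).
Proof.
move=> Rf df; have [a b] := df.
have f0 : f t != 0 by apply: contraTneq Rf => ->; rewrite ltxx.
have n0 := sqn_gt0 f0.
have ds : is_derive t 1 (fun s => sqn (f s)) (2%:R * (Re (f t) * Re z + Im (f t) * Im z)).
  apply: is_derive_to (is_deriveD (is_deriveX 2 a) (is_deriveX 2 b)).
  by rewrite -?[_ *: _]/(_ * _) !expr1; ring.
have zfE : z / f t = (z * conjc (f t)) * ((sqn (f t))^-1)%:C by rewrite invc_sqn mulrA.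
split.
  have R0 : Re (f t) != 0 by rewrite gt_eqF.
  have dn := @is_derive1_comp R Num.sqrt (fun s => sqn (f s)) t _ _ (is_derive1_sqrt n0) ds.
  have sn0 : 0 < Num.sqrt (sqn (f t)) by rewrite sqrtr_gt0.
  have dl := @is_derive1_comp R (@ln R) (fun s => Num.sqrt (sqn (f s))) t _ _
     (is_derive1_ln sn0) dn.
  have -> : (fun s => Re (half_log (f s))) = @ln R \o (Num.sqrt \o (fun s => sqn (f s))).
    by apply/funext => s; rewrite /half_log /= cnormE.
  apply: is_derive_to dl; rewrite zfE !(ReM, ImM, ReJ, ImJ) /= mulr0 subr0.
  have : (Num.sqrt (sqn (f t))) ^+ 2 = sqn (f t) by rewrite sqr_sqrtr // ltW.
  move: (Num.sqrt _) sn0 => q q0 <-; rewrite -?[_ *: _]/(_ * _).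
  by field; rewrite gt_eqF.
have R0 : Re (f t) != 0 by rewrite gt_eqF.
have dR := @is_deriveV R (fun s => Re (f s)) t _ 1 R0 a.
have da := @is_derive1_comp R (@atan R) (fun s => Im (f s) / Re (f s)) t _ _
  (is_derive1_atan _) (is_deriveM b dR).
apply: is_derive_to da.
rewrite zfE !(ReM, ImM, ReJ, ImJ) /= -?[_ *: _]/(_ * _).
move: n0; rewrite /sqn => n0; field; rewrite R0 /= andbT gt_eqF //.
Qed.

(** * A logarithm continued along the rays *)

(** The eigenvalue of cos phi + sin phi V that belongs to the eigenvalue c of V. *)
Definition ray (c : C) t : C := (cos t)%:C + c * (sin t)%:C.
Definition dray (c : C) t : C := - (sin t)%:C + c * (cos t)%:C.

Lemma cder_cos t : cder (fun s => (cos s)%:C) t (- (sin t)%:C).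
Proof. by rewrite -rmorphN; apply: cder_real. Qed.

Lemma cder_sin t : cder (fun s => (sin s)%:C) t (cos t)%:C.
Proof. by apply: cder_real. Qed.

Lemma cder_ray (c : C) t : cder (ray c) t (dray c t).
Proof. by apply: cderD; [apply: cder_cos | apply: cderMl; apply: cder_sin]. Qed.

Lemma ray0 (c : C) : ray c 0 = 1.
Proof. by rewrite /ray cos0 sin0 mulr0 addr0. Qed.

Lemma ray_neq0 (c : C) t : 0 < Im c -> ray c t != 0.
Proof.
move=> c0; apply/eqP => r0.
have /eqP := congr1 (@complex.Im R) r0; rewrite /ray ImD ImM /= add0r mulr0 add0r.
rewrite mulf_eq0 gt_eqF //= => /eqP s0.
have /eqP := congr1 (@complex.Re R) r0; rewrite /ray s0 mulr0 addr0 /= => /eqP c00.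
by have := cos2Dsin2 t; rewrite s0 c00 expr0n addr0 => /eqP; rewrite eq_sym oner_eq0.
Qed.

Lemma cexp_turn t : cexp (- (ii * t%:C)) = cos t +i* - sin t.
Proof.
have -> : - (ii * t%:C) = 0 +i* (- t) by apply: cplx_eq => /=; ring.
by rewrite /cexp /= expR0 cosN sinN !mul1r.
Qed.

(** Turning the ray back by its angle, and then by the argument of 1 - i c,
    brings it into the right half plane for every angle: there the principal
    logarithm is smooth, and no branch cut is ever crossed. *)
Definition turned_ray (c : C) t : C :=
  ray c t * cexp (- (ii * t%:C)) * (1 + ii * conjc c).

Lemma turned_ray_gt0 (c : C) t : 0 < Im c -> 0 < Re (turned_ray c t).
Proof.
case: c => a b; rewrite -[Im _]/b => b0.
have -> : turned_ray (a +i* b) t =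
    ray (a +i* b) t * (cos t +i* - sin t) * (1 + ii * conjc (a +i* b)).
  by rewrite /turned_ray cexp_turn.
rewrite /ray /= ?mul1r.
have := cos2Dsin2 t; move: (cos t) (sin t) => x y xy.
(* With c = a + i b, the real part is a sum of squares with positive weights. *)
rewrite [X in 0 < X](_ : _ = (x + a * y) ^+ 2 + b * x ^+ 2 + b * (1 + b) * y ^+ 2); last by ring.
have [y0|y0] := eqVneq y 0.
  have x1 : x ^+ 2 = 1 by move: xy; rewrite y0 expr0n addr0.
  by rewrite y0 expr0n !mulr0 !addr0 x1 mulr1; lra.
have A0 := sqr_ge0 (x + a * y); have B0 : 0 <= b * x ^+ 2 by rewrite mulr_ge0 ?sqr_ge0 // ltW.
have y2 : 0 < y ^+ 2 by rewrite lt_neqAle sqr_ge0 eq_sym sqrf_eq0 y0.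
have C0 : 0 < b * (1 + b) * y ^+ 2 by rewrite mulr_gt0 // mulr_gt0 // addr_gt0.
lra.
Qed.

Lemma cder_turned_ray (c : C) t : 0 < Im c ->
  cder (turned_ray c) t ((dray c t / ray c t - ii) * turned_ray c t).
Proof.
move=> c0; have r0 := ray_neq0 t c0.
have de : cder (fun s => cexp (- (ii * s%:C))) t (- ii * cexp (- (ii * t%:C))).
  apply: cder_cexp; apply: cder_eq (cderN (cderMl ii (cder_real (is_derive_id t 1)))).
  by rewrite /= mulr1.
apply: cder_eq (cderMr (1 + ii * conjc c) (cderM (cder_ray c t) de)).
by rewrite /turned_ray; field.
Qed.

(** The subtracted constant makes the logarithm vanish at the angle 0. *)
Definition ray_log (c : C) t : C :=
  ii * t%:C + half_log (turned_ray c t) - half_log (turned_ray c 0).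

Lemma ray_log0 (c : C) : ray_log c 0 = 0.
Proof. by rewrite /ray_log mulr0 add0r subrr. Qed.

Lemma cder_ray_log (c : C) t : 0 < Im c -> cder (ray_log c) t (dray c t / ray c t).
Proof.
move=> c0; have g0 := turned_ray_gt0 t c0.
have dg := cder_half_log g0 (cder_turned_ray t c0).
have di := cderMl ii (cder_real (is_derive_id t 1)).
apply: cder_eq (cderB (cderD di dg) (cder_cst _ t)).
have n0 : turned_ray c t != 0 by apply: contraTneq g0 => ->; rewrite ltxx.
by rewrite mulfK // subr0 mulr1 addrC subrK.
Qed.

Lemma cexp_ray_log (c : C) t : 0 < Im c -> cexp (ray_log c t) = ray c t.
Proof.
move=> c0; rewrite /ray_log !cexpD cexpN !cexp_half_log ?turned_ray_gt0 //.
have n0 : 1 + ii * conjc c != 0.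
  apply/eqP => /(congr1 (@complex.Re R)); rewrite ReD ReM ReJ ImJ /= => H; lra.
have e1 : cexp (- (ii * (0 : R)%:C)) = 1 by rewrite cexp_turn cos0 sin0 oppr0.
rewrite /turned_ray ray0 e1 cexpN; have e0 := cexp_neq0 (ii * t%:C); field.
by rewrite n0 e0.
Qed.

Lemma ray_log_2pi (c : C) : ray_log c (2%:R * pi) = ii * (2%:R * pi : R)%:C.
Proof.
rewrite /ray_log; have -> : turned_ray c (2%:R * pi) = turned_ray c 0.
  rewrite /turned_ray /ray; congr (_ * _ * _).
    by rewrite mulr_natl cos2pi sin2pi cos0 sin0.
  by rewrite !cexp_turn mulr_natl cos2pi sin2pi cos0 sin0.
by rewrite addrK.
Qed.

(** The derivative of the argument is Im c divided by the squared modulus of the ray,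
    and a full turn adds 2 pi. *)
Lemma ray_log_arg (c : C) (alpha : R) : 0 < Im c -> 0 < alpha -> alpha < 2%:R * pi ->
  0 < Im (ray_log c alpha) < 2%:R * pi.
Proof.
move=> c0 a0 a2.
have dI t : is_derive t 1 (fun s => Im (ray_log c s)) (Im (dray c t / ray c t)).
  by have [] := cder_ray_log t c0.
have pos t : 0 < Im (dray c t / ray c t).
  have := sqn_gt0 (ray_neq0 t c0); rewrite invc_sqn mulrA ImM /= mulr0 add0r => s0.
  rewrite mulr_gt0 ?invr_gt0 //.
  suff -> : Im (dray c t * conjc (ray c t)) = Im c * (cos t ^+ 2 + sin t ^+ 2).
    by rewrite cos2Dsin2 mulr1.
  by rewrite /dray /ray !(ImM, ReM, ReD, ImD, ReN, ImN, ReJ, ImJ) /=; ring.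
have mono x y : x < y -> Im (ray_log c x) < Im (ray_log c y).
  move=> xy; have := @MVT R (fun s => Im (ray_log c s)) _ x y xy (fun t _ => dI t).
  case=> [|t _ E].
    by apply: derivable_within_continuous => t _; case: (dI t).
  by rewrite -subr_gt0 E mulr_gt0 // subr_gt0.
have := mono _ _ a0; rewrite ray_log0 /= => ->.
by have := mono _ _ a2; rewrite ray_log_2pi ImM /=; lra.
Qed.

End ComplexLogarithm.

(** * The binomial series and its remainder *)

Section BinomialExpansion.
Context {R : realType}.
Local Notation C := R[i].
Local Notation Re := (@complex.Re R).
Local Notation Im := (@complex.Im R).
Local Notation ii := (Complex (0 : R) 1).
Implicit Types (t : R) (z w L lambda : C).

Lemma cnorm_ge0 z : 0 <= cnorm z.
Proof. by rewrite cnormE sqrtr_ge0. Qed.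

Lemma cnormM z w : cnorm (z * w) = cnorm z * cnorm w.
Proof. exact: ComplexField.Normc.normcM. Qed.

Lemma cnormV z : cnorm z^-1 = (cnorm z)^-1.
Proof. exact: ComplexField.Normc.normcV. Qed.

Lemma cnorm1 : cnorm (1 : C) = 1.
Proof. exact: ComplexField.Normc.normc1. Qed.

Lemma cnorm0 : cnorm (0 : C) = 0.
Proof. exact: ComplexField.Normc.normc0. Qed.

Lemma cnormX z n : cnorm (z ^+ n) = cnorm z ^+ n.
Proof. by elim: n => [|n IHn]; rewrite ?cnorm1 // !exprS cnormM IHn. Qed.

Lemma cnormN z : cnorm (- z) = cnorm z.
Proof. by rewrite !cnormE /sqn ReN ImN !sqrrN. Qed.

Lemma cnorm_conj z : cnorm (conjc z) = cnorm z.
Proof. by rewrite !cnormE /sqn ReJ ImJ sqrrN. Qed.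

Lemma cnorm_real t : cnorm t%:C = `|t|.
Proof. by rewrite cnormE /sqn /= expr0n addr0 sqrtr_sqr. Qed.

Lemma cnorm_gt0 z : z != 0 -> 0 < cnorm z.
Proof. by move=> z0; rewrite cnormE sqrtr_gt0 sqn_gt0. Qed.

Lemma Re_le_cnorm z : `|Re z| <= cnorm z.
Proof. by rewrite cnormE -sqrtr_sqr ler_wsqrtr // /sqn lerDl sqr_ge0. Qed.

Lemma Im_le_cnorm z : `|Im z| <= cnorm z.
Proof. by rewrite cnormE -sqrtr_sqr ler_wsqrtr // /sqn lerDr sqr_ge0. Qed.

Lemma cnormD z w : cnorm (z + w) <= cnorm z + cnorm w.
Proof. exact: le_normcD. Qed.

Lemma cnormB z w : cnorm z - cnorm w <= cnorm (z - w).
Proof. by rewrite lerBlDr; have := cnormD (z - w) w; rewrite subrK. Qed.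

Lemma cnorm_ii : cnorm ii = 1.
Proof. by rewrite cnormE /sqn /= expr0n add0r expr1n sqrtr1. Qed.

Lemma cnorm_le_ReIm z : cnorm z <= `|Re z| + `|Im z|.
Proof.
have -> : z = (Re z)%:C + ii * (Im z)%:C.
  by apply: cplx_eq; rewrite !(ReD, ImD, ReM, ImM) /=; ring.
apply: le_trans (cnormD _ _) _.
by rewrite cnormM cnorm_ii mul1r !cnorm_real !(ReD, ImD, ReM, ImM) /=
  !(mul0r, mulr0, mul1r, addr0, add0r, subr0).
Qed.

Lemma conjcD z w : conjc (z + w) = conjc z + conjc w. Proof. exact: rmorphD. Qed.
Lemma conjcB z w : conjc (z - w) = conjc z - conjc w. Proof. exact: rmorphB. Qed.
Lemma conjcM z w : conjc (z * w) = conjc z * conjc w. Proof. exact: rmorphM. Qed.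
Lemma conjcX z n : conjc (z ^+ n) = conjc z ^+ n. Proof. exact: rmorphXn. Qed.
Lemma conjc_sum (I : Type) (r : seq I) (P : pred I) (F : I -> C) :
  conjc (\sum_(i <- r | P i) F i) = \sum_(i <- r | P i) conjc (F i).
Proof. exact: rmorph_sum. Qed.

(** lambda (lambda - 1) ... (lambda - k + 1) / k!, for complex lambda. *)
Fixpoint gbin lambda (k : nat) : C :=
  if k is k'.+1 then gbin lambda k' * (lambda - k'%:R) / k'.+1%:R else 1.

Lemma gbin_absorb lambda k :
  gbin lambda k * (lambda - k%:R) = lambda * gbin (lambda - 1) k.
Proof.
elim: k => [|k IHk] /=; first by rewrite subr0 mul1r mulr1.
rewrite IHk -natr1; field.
by rewrite natr1 pnatr_eq0.
Qed.

Lemma gbinS_mul lambda k :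
  gbin lambda k.+1 * k.+1%:R = lambda * gbin (lambda - 1) k.
Proof. by rewrite /= mulrVK ?unitfE ?pnatr_eq0 // gbin_absorb. Qed.

Lemma gbin_pascal lambda k :
  gbin lambda k.+1 = gbin (lambda - 1) k.+1 + gbin (lambda - 1) k.
Proof.
have k0 : k.+1%:R != 0 :> C by rewrite pnatr_eq0.
apply: (mulIf k0); rewrite gbinS_mul mulrDl /= mulrVK ?unitfE // -natr1; ring.
Qed.

(** The principal branch of the power, meaningful for Re z > -1. *)
Definition pow1p lambda z : C := cexp (lambda * half_log (1 + z)).

Definition binom_rem (m : nat) lambda z : C :=
  pow1p lambda z - \sum_(k < m) gbin lambda k * z ^+ k.

Lemma Re1p_gt0 z : cnorm z <= 2%:R^-1 -> 0 < Re (1 + z).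
Proof.
move=> z2; have := le_trans (Re_le_cnorm z) z2; rewrite ReD ler_norml /=; lra.
Qed.

Lemma pow1p_bound lambda : exists2 K, 0 <= K &
  forall z, cnorm z <= 2%:R^-1 -> cnorm (pow1p lambda z) <= K.
Proof.
exists (expR (`|Re lambda| * ln 2%:R + `|Im lambda| * (pi / 2%:R))).
  exact: expR_ge0.
move=> z z2; have zpos := Re1p_gt0 z2.
rewrite cnorm_cexp ler_expR ReM /half_log /=.
have n1 := cnormD 1 z; rewrite cnorm1 in n1.
have n2 := cnormB 1 (- z); rewrite cnorm1 cnormN opprK in n2.
have npos : 0 < cnorm (1 + z) by lra.
apply: le_trans (ler_norm _) _; apply: le_trans (ler_normB _ _) _.
rewrite !normrM; apply: lerD; apply: ler_wpM2l => //.
  rewrite ler_norml -lnV ?posrE // ler_ln ?posrE ?invr_gt0 //.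
  by rewrite ler_ln ?posrE //; apply/andP; split; lra.
rewrite ler_norml; apply/andP; split; first by rewrite ltW // atan_gtNpi2.
by rewrite ltW // atan_ltpi2.
Qed.

Lemma cder_pow1p lambda z t : 0 < Re (1 + t%:C * z) ->
  cder (fun s => pow1p lambda (s%:C * z)) t (lambda * z * pow1p (lambda - 1) (t%:C * z)).
Proof.
move=> pos; have dl : cder (fun s => 1 + s%:C * z) t z.
  apply: cder_eq (cderD (cder_cst 1 t) (cderMr z (cder_real (is_derive_id t 1)))).
  by rewrite add0r mul1r.
apply: cder_eq (cder_cexp (cderMl lambda (cder_half_log pos dl))).
rewrite /pow1p mulrBl mul1r cexpD cexpN cexp_half_log //.
by rewrite -!mulrA; congr (_ * (_ * _)); rewrite mulrC.
Qed.

Lemma cder_binom_rem m lambda z t : 0 < Re (1 + t%:C * z) ->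
  cder (fun s => binom_rem m.+1 lambda (s%:C * z)) t
       (lambda * z * binom_rem m (lambda - 1) (t%:C * z)).
Proof.
move=> pos; have dz : cder (fun s => s%:C * z) t z.
  apply: cder_eq (cderMr z (cder_real (is_derive_id t 1))); by rewrite mul1r.
have ds : cder (fun s => \sum_(k < m.+1) gbin lambda k * (s%:C * z) ^+ k) t
    (\sum_(k < m.+1) gbin lambda k * (k%:R * (t%:C * z) ^+ k.-1 * z)).
  by apply: cder_sum => k _; apply: cderMl; apply: cderX.
apply: cder_eq (cderB (cder_pow1p lambda pos) ds).
rewrite /binom_rem mulrBr; congr (_ - _).
rewrite big_ord_recl [X in X + _](_ : _ = 0); last by rewrite /= !mul0r mulr0.
rewrite add0r mulr_sumr; apply: eq_bigr => k _.
by rewrite lift0 mulrA mulrA gbinS_mul succnK; ring.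
Qed.

(** Taylor's formula for the binomial series, with the remainder estimated by
    integrating along the segment from 0 to z: the remainder of order m + 1 and
    exponent lambda has the one of order m and exponent lambda - 1 as derivative. *)
Lemma binom_rem_bound m lambda : exists2 K, 0 <= K &
  forall z, cnorm z <= 2%:R^-1 -> cnorm (binom_rem m lambda z) <= K * cnorm z ^+ m.
Proof.
elim: m lambda => [|m IHm] lambda.
  have [K K0 HK] := pow1p_bound lambda; exists K => // z z2.
  by rewrite /binom_rem big_ord0 subr0 expr0 mulr1 HK.
have [K K0 HK] := IHm (lambda - 1).
exists (2%:R * (cnorm lambda * K)); first by rewrite !mulr_ge0 ?cnorm_ge0.
move=> z z2.
have seg t : 0 <= t <= 1 -> cnorm (t%:C * z) <= cnorm z.
  move=> /andP[t0 t1]; rewrite cnormM cnorm_real ger0_norm //.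
  by rewrite ler_piMl ?cnorm_ge0.
have pos t : 0 <= t <= 1 -> 0 < Re (1 + t%:C * z).
  by move=> /seg tz; apply: Re1p_gt0; apply: le_trans tz z2.
pose h s := binom_rem m.+1 lambda (s%:C * z).
have dh t : 0 <= t <= 1 -> cder h t (lambda * z * binom_rem m (lambda - 1) (t%:C * z)).
  by move=> /pos; apply: cder_binom_rem.
have h0 : h 0 = 0.
  rewrite /h /binom_rem mul0r big_ord_recl big1 => [|k _]; last first.
    by rewrite lift0 exprS mul0r mulr0.
  have hl1 : half_log (1 + 0 : C) = 0.
    by rewrite addr0 /half_log cnorm1 ln1 /= mul0r atan0.
  by rewrite /pow1p hl1 mulr0 cexp0 expr0 mulr1 addr0 subrr.
have bound t : 0 <= t <= 1 ->
    cnorm (lambda * z * binom_rem m (lambda - 1) (t%:C * z)) <=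
    cnorm lambda * K * cnorm z ^+ m.+1.
  move=> t01; have tz := seg t t01.
  have tz2 := le_trans tz z2.
  rewrite !cnormM exprS.
  have := HK _ tz2; have : cnorm (t%:C * z) ^+ m <= cnorm z ^+ m.
    by rewrite lerXn2r // nnegrE cnorm_ge0.
  move=> H1 H2.
  have -> : cnorm lambda * K * (cnorm z * cnorm z ^+ m) =
            cnorm lambda * cnorm z * (K * cnorm z ^+ m) by ring.
  apply: ler_wpM2l; first by rewrite mulr_ge0 ?cnorm_ge0.
  by apply: le_trans H2 _; rewrite ler_wpM2l.
have key (g : C -> R) (Hg : forall w, `|g w| <= cnorm w)
    (dg : forall t d, cder h t d -> is_derive t 1 (fun s => g (h s)) (g d)) :
    g 0 = 0 -> `|g (h 1)| <= cnorm lambda * K * cnorm z ^+ m.+1.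
  move=> g0; have := @MVT R (fun s => g (h s)) (fun t =>
    g (lambda * z * binom_rem m (lambda - 1) (t%:C * z))) 0 1 ltr01.
  case=> [t||t].
  - rewrite in_itv /= => /andP[/ltW t0 /ltW t1]; apply: dg; apply: dh.
    by rewrite t0.
  - apply: derivable_within_continuous => t; rewrite in_itv /= => t01.
    by case: (dg _ _ (dh t t01)).
  - rewrite in_itv /= => /andP[/ltW t0 /ltW t1].
    rewrite h0 g0 !subr0 mulr1 => ->; apply: le_trans (Hg _) _.
    by apply: bound; rewrite t0.
have h1 : binom_rem m.+1 lambda z = h 1 by rewrite /h mul1r.
rewrite h1; apply: le_trans (cnorm_le_ReIm _) _.
have H1 := key Re Re_le_cnorm (fun t d D => D.1) erefl.
have H2 := key Im Im_le_cnorm (fun t d D => D.2) erefl.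
by rewrite -mulrA mulr_natl mulr2n lerD.
Qed.

(** This is all that the functional calculus uses of a function holomorphic near w:
    the first clause gives the residues at w, the second one makes the integrands
    continuous. *)
Definition expands (f : C -> C) (w : C) (a : nat -> C) : Prop :=
  (forall m, exists (delta K : R), [/\ 0 < delta, 0 <= K & forall z, cnorm z < delta ->
     cnorm (f (w + z) - \sum_(k < m) a k * z ^+ k) <= K * cnorm z ^+ m]) /\
  (exists2 delta, 0 < delta & forall rho t, 0 < rho < delta -> exists d,
     cder (fun s => f (w + rho%:C * cexp (ii * s%:C))) t d).

Lemma expands_conj (f : C -> C) w a : expands f w a ->
  expands (fun z => conjc (f (conjc z))) (conjc w) (fun k => conjc (a k)).
Proof.
move=> [fa [delta d0 fd]]; split.
  move=> m; have [e [K [e0 K0 H]]] := fa m; exists e, K; split=> // z ze.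
  rewrite -(cnorm_conj z) in ze *.
  rewrite -(cnorm_conj (_ - _)) conjcB conjcK conjcD conjcK conjc_sum.
  under eq_bigr do rewrite conjcM conjcX conjcK.
  exact: H.
exists delta => // rho t rd; have [d D] := fd rho (- t) rd.
exists (conjc ((-1)%:C * d)); apply: cder_conj.
have dN : is_derive t 1 (fun s : R => - s) (- 1 : R) by apply: is_deriveNid.
have := cder_comp D dN.
apply: cder_ext => s; rewrite conjcD conjcK conjcM conjc_real -cexp_conj.
congr (f (_ + _ * cexp _)); apply: cplx_eq => /=; ring.
Qed.

Lemma cder_circle (rho : R) (t : R) :
  cder (fun s => rho%:C * cexp (ii * s%:C)) t (ii * (rho%:C * cexp (ii * t%:C))).
Proof.
apply: cder_eq (cderMl rho%:C (cder_cexp (cderMl ii (cder_real (is_derive_id t 1))))).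
by rewrite mulr1 mulrCA.
Qed.

Lemma cnorm_circle (rho : R) (t : R) : 0 <= rho -> cnorm (rho%:C * cexp (ii * t%:C)) = rho.
Proof.
move=> r0; rewrite cnormM cnorm_cexp cnorm_real ger0_norm //.
by rewrite ReM /= mul0r mulr0 subrr expR0 mulr1.
Qed.

(** Away from the cut, a small change of the point changes the argument by the principal
    argument of the quotient. *)
Lemma cpow_plus_near lambda L : 0 < Im L < 2%:R * pi ->
  exists2 delta, 0 < delta & forall z, cnorm z < delta ->
    cnorm z <= 2%:R^-1 /\
    cpow_plus lambda (cexp L * (1 + z)) = cexp (lambda * L) * pow1p lambda z.
Proof.
move=> /andP[L0 L2].
have [e e0 He] : exists2 e, 0 < e & forall u : R, `|u| < e ->
    - Im L < atan u < 2%:R * pi - Im L.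
  have c0 := @continuous_atan R 0.
  have : \forall u \near (0 : R), - Im L < atan u < 2%:R * pi - Im L.
    near=> u; apply/andP; split; near: u.
      by apply: (cvgr_gt _ c0); rewrite atan0; lra.
    by apply: (cvgr_lt _ c0); rewrite atan0; lra.
  move=> /nbhs_ballP[e /= e0 H]; exists e => // u ue; apply: H.
  by rewrite /ball /= sub0r normrN.
exists (Num.min 2%:R^-1 (e / 2%:R)).
  by rewrite lt_min; apply/andP; split; rewrite ?divr_gt0 // invr_gt0.
move=> z; rewrite lt_min => /andP[z2 ze]; split; first exact: ltW.
have zpos := Re1p_gt0 (ltW z2).
have -> : cexp L * (1 + z) = cexp (L + half_log (1 + z)).
  by rewrite cexpD cexp_half_log.
have small : `|Im (1 + z) / Re (1 + z)| < e.
  have Rz := le_trans (Re_le_cnorm z) (ltW z2).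
  have Iz := le_lt_trans (Im_le_cnorm z) ze.
  rewrite normrM normfV [`|Re _|]gtr0_norm // ltr_pdivrMr //.
  move: Rz Iz; rewrite ReD ImD /= add0r ler_norml => /andP[R1 R2] Iz.
  nra.
have /andP[a1 a2] := He _ small.
rewrite cpow_plus_cexp; last by rewrite ImD /half_log /=; apply/andP; split; lra.
by rewrite mulrDr cexpD.
Unshelve. all: by end_near. Qed.

Lemma expands_cpow_plus lambda L : 0 < Im L < 2%:R * pi ->
  expands (cpow_plus lambda) (cexp L) (fun k => gbin lambda k * cexp ((lambda - k%:R) * L)).
Proof.
move=> /(cpow_plus_near lambda)[delta d0 H].
have wn : 0 < cnorm (cexp L) by apply: cnorm_gt0; apply: cexp_neq0.
have near z : cnorm z < delta * cnorm (cexp L) -> cnorm (z / cexp L) < delta.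
  by move=> zd; rewrite cnormM cnormV ltr_pdivrMr.
have split z : cexp L + z = cexp L * (1 + z / cexp L).
  by rewrite mulrDr mulr1 mulrCA mulfV ?mulr1 // cexp_neq0.
split.
  move=> m; have [K K0 HK] := binom_rem_bound m lambda.
  exists (delta * cnorm (cexp L)), (cnorm (cexp (lambda * L)) * K * (cnorm (cexp L) ^- m)).
  split; first by rewrite mulr_gt0.
    by rewrite !mulr_ge0 ?invr_ge0 ?exprn_ge0 ?cnorm_ge0.
  move=> z /near zd; have [z2 E] := H _ zd.
  rewrite split E.
  have -> : cexp (lambda * L) * pow1p lambda (z / cexp L) -
     \sum_(k < m) gbin lambda k * cexp ((lambda - k%:R) * L) * z ^+ k =
     cexp (lambda * L) * binom_rem m lambda (z / cexp L).
    rewrite /binom_rem mulrBr mulr_sumr; congr (_ - _); apply: eq_bigr => k _.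
    rewrite mulrBl cexpD exprMn exprVn.
    have -> : cexp (- (k%:R * L)) = (cexp L ^+ k)^-1.
      rewrite cexpN; congr (_^-1); elim: (k : nat) => [|j IHj].
        by rewrite mul0r cexp0.
      by rewrite -natr1 mulrDl mul1r cexpD IHj exprSr.
    by ring.
  rewrite cnormM -!mulrA; apply: ler_wpM2l; first exact: cnorm_ge0.
  apply: le_trans (HK _ z2) _; rewrite cnormM cnormV exprMn exprVn.
  by rewrite [cnorm z ^+ m / _]mulrC.
exists (delta * cnorm (cexp L)) => [|rho t /andP[r0 rd]]; first by rewrite mulr_gt0.
have cn s : cnorm (rho%:C * cexp (ii * s%:C)) < delta * cnorm (cexp L).
  by rewrite cnorm_circle // ltW.
have dz : cder (fun s => 1 + rho%:C * cexp (ii * s%:C) / cexp L) t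
    (ii * (rho%:C * cexp (ii * t%:C)) / cexp L).
  apply: cder_eq (cderD (cder_cst 1 t) (cderMr (cexp L)^-1 (cder_circle rho t))).
  by rewrite add0r.
have pos : 0 < Re (1 + rho%:C * cexp (ii * t%:C) / cexp L).
  by apply: Re1p_gt0; have [] := H _ (near _ (cn t)).
exists (cexp (lambda * L) * (lambda * (ii * (rho%:C * cexp (ii * t%:C)) / cexp L /
   (1 + rho%:C * cexp (ii * t%:C) / cexp L)) * pow1p lambda (rho%:C * cexp (ii * t%:C) / cexp L))).
apply: cder_ext (cderMl (cexp (lambda * L)) (cder_cexp (cderMl lambda (cder_half_log pos dz)))).
by move=> s; rewrite split; have [_ ->] := H _ (near _ (cn s)).
Qed.

End BinomialExpansion.

(** * Mean values over small circles *)

Section ContourIntegrals.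
Context {R : realType}.
Local Notation C := R[i].
Local Notation Re := (@complex.Re R).
Local Notation Im := (@complex.Im R).
Local Notation ii := (Complex (0 : R) 1).
Local Notation tau := (2%:R * pi : R).
Local Notation mu := (@lebesgue_measure R).
Implicit Types (t rho : R) (z w : C).

Lemma tau_gt0 : 0 < tau.
Proof. by rewrite mulr_gt0 // pi_gt0. Qed.

(** Continuity on the whole line suffices here, and avoids subspace topologies. *)
Lemma continuous_integrable (h : R -> R) (a b : R) :
  continuous h -> mu.-integrable `[a, b]%classic (EFin \o h).
Proof.
move=> ch; apply: continuous_compact_integrable; first exact: segment_compact.
exact: continuous_subspaceT.
Qed.

Lemma Rintegral_FTC2 (F h : R -> R) (a b : R) : a < b -> continuous h ->
  (forall t, is_derive t 1 F (h t)) ->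
  \int[mu]_(t in `[a, b]) h t = F b - F a.
Proof.
move=> ab ch dF; have cF : continuous F.
  by move=> t; apply/differentiable_continuous; rewrite -derivable1_diffP; case: (dF t).
rewrite /Rintegral (@continuous_FTC2 R h F a b ab) //.
- exact: continuous_subspaceT.
- split; first by move=> t _; case: (dF t).
    by apply: cvg_at_right_filter; apply: cF.
  by apply: cvg_at_left_filter; apply: cF.
- by move=> t _; rewrite derive1E; case: (dF t).
Qed.

Lemma Rintegral_bound (h : R -> R) (a b e : R) : a <= b -> continuous h ->
  (forall t, `|h t| <= e) -> `|\int[mu]_(t in `[a, b]) h t| <= e * (b - a).
Proof.
move=> ab ch he; have ih := continuous_integrable a b ch.
apply: le_trans (le_normr_Rintegral _ ih) _ => //.
have icst : mu.-integrable `[a, b]%classic (EFin \o (fun=> e)).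
  by apply: continuous_integrable => t; apply: cvg_cst.
have inorm : mu.-integrable `[a, b]%classic (EFin \o (fun t => `|h t|)).
  apply: continuous_integrable => t; apply: continuous_comp; first exact: ch.
  exact: norm_continuous.
apply: le_trans (le_Rintegral _ inorm icst (fun t _ => he t)) _ => //.
rewrite Rintegral_cst //= lebesgue_measure_itv /= lte_fin; case: ltP => // ba.
have -> : b = a by apply/eqP; rewrite eq_le ab ba.
by rewrite subrr !mulr0.
Qed.

(** Stating that v is the mean value of g through a primitive makes the property
    stable under sums without any integrability argument. *)
Definition periodic_mean (g : R -> C) (v : C) : Prop :=
  (exists G : R -> C, (forall t, cder G t (g t)) /\ G tau - G 0 = tau%:C * v) /\
  (forall t, exists d, cder g t d).

Lemma cder_continuousT (g : R -> C) : (forall t, exists d, cder g t d) ->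
  continuous (fun t => Re (g t)) /\ continuous (fun t => Im (g t)).
Proof. by move=> dg; split=> t; have [d /cder_continuous[]] := dg t. Qed.

Lemma cintegral_approx (g main : R -> C) v (e : R) :
  (forall t, exists d, cder g t d) -> periodic_mean main v ->
  (forall t, cnorm (g t - main t) <= e) ->
  cnorm (cintegral 0 tau g - tau%:C * v) <= 2%:R * (e * tau).
Proof.
move=> dg [[G [dG <-]] dm] he.
have [cgR cgI] := cder_continuousT dg; have [cmR cmI] := cder_continuousT dm.
have key (p : C -> R) (pB : forall z w, p (z - w) = p z - p w)
    (pn : forall z, `|p z| <= cnorm z) (cg : continuous (fun t => p (g t)))
    (cm : continuous (fun t => p (main t)))
    (dp : forall t, is_derive t 1 (fun s => p (G s)) (p (main t))) :
  `|\int[mu]_(t in `[0, tau]) p (g t) - p (G tau - G 0)| <= e * tau.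
  rewrite pB -(Rintegral_FTC2 tau_gt0 cm dp).
  rewrite -RintegralB //; try exact: continuous_integrable.
  have -> : (fun t => p (g t) - p (main t)) = (fun t => p (g t - main t)).
    by apply/funext => t; rewrite pB.
  have := @Rintegral_bound (fun t => p (g t - main t)) 0 tau e (ltW tau_gt0).
  rewrite subr0; apply.
    have -> : (fun t => p (g t - main t)) = (fun t => p (g t) - p (main t)).
      by apply/funext => t; rewrite pB.
    by move=> t; apply: cvgB; [apply: cg | apply: cm].
  by move=> t; apply: le_trans (pn _) (he t).
apply: le_trans (cnorm_le_ReIm _) _.
have -> : 2%:R * (e * tau) = e * tau + e * tau by ring.
rewrite [Re (_ - _)]ReD [Im (_ - _)]ImD [Re (- _)]ReN [Im (- _)]ImN; apply: lerD.
  apply: (key Re) => //; first by move=> z w; rewrite ReD ReN.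
    exact: Re_le_cnorm.
  by move=> t; case: (dG t).
apply: (key Im) => //; first by move=> z w; rewrite ImD ImN.
  exact: Im_le_cnorm.
by move=> t; case: (dG t).
Qed.

Lemma periodic_mean0 : periodic_mean (fun=> 0) 0.
Proof.
split; last by move=> t; exists 0; apply: cder_cst.
by exists (fun=> 0); split=> [t|]; [apply: cder_cst | rewrite subrr mulr0].
Qed.

Lemma periodic_meanD g v h w : periodic_mean g v -> periodic_mean h w ->
  periodic_mean (fun t => g t + h t) (v + w).
Proof.
move=> [[G [dG eG]] dg] [[H [dH eH]] dh]; split.
  exists (fun t => G t + H t); split=> [t|]; first exact: cderD.
  by rewrite [RHS]mulrDr -eG -eH; ring.
by move=> t; have [d D] := dg t; have [d' D'] := dh t; exists (d + d'); apply: cderD.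
Qed.

Lemma periodic_mean_sum (I : Type) (r : seq I) (g : I -> R -> C) (v : I -> C) :
  (forall i, periodic_mean (g i) (v i)) ->
  periodic_mean (fun t => \sum_(i <- r) g i t) (\sum_(i <- r) v i).
Proof.
move=> gv; elim: r => [|i r IHr].
  by rewrite big_nil; under [fun _ => _]eq_fun do rewrite big_nil; apply: periodic_mean0.
rewrite big_cons; under [fun _ => _]eq_fun do rewrite big_cons.
exact: periodic_meanD.
Qed.

Lemma cexp_ii t : cexp (ii * t%:C) = cos t +i* sin t.
Proof.
have -> : ii * t%:C = 0 +i* t by apply: cplx_eq => /=; ring.
by rewrite /cexp /= expR0 !mul1r.
Qed.

Lemma cexp_int_tau (j : nat) : cexp (ii * (j%:R * tau)%:C) = 1.
Proof.
elim: j => [|j IHj]; first by rewrite mul0r mulr0 cexp0.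
rewrite -natr1 mulrDl mul1r rmorphD mulrDr cexpD IHj mul1r cexp_ii.
by rewrite mulr_natl cos2pi sin2pi.
Qed.

Lemma periodic_mean_exp (b : C) (j k : nat) :
  periodic_mean (fun t => b * cexp (ii * ((j%:R - k%:R) * t)%:C)) (if j == k then b else 0).
Proof.
have de (x : R) t : cder (fun s => ii * (x * s)%:C) t (ii * x%:C).
  apply: cderMl; apply: cder_eq (cder_real (is_deriveZ x (is_derive_id t 1))).
  by rewrite -[_ *: _]/(_ * _) mulr1.
split; last by move=> t; eexists; apply: cderMl; apply: cder_cexp; apply: de.
case: eqVneq => [->|jk].
  exists (fun t => b * t%:C); split=> [t|].
    rewrite subrr mul0r mulr0 cexp0.
    by apply: cderMl; apply: cder_real; apply: is_derive_id.
  by rewrite -mulrBr -rmorphB subr0 mulrC.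
have x0 : ii * (j%:R - k%:R : R)%:C != 0.
  rewrite mulf_neq0 //; first by rewrite eq_complex /= eqxx oner_eq0.
  by rewrite eq_complex /= eqxx andbT subr_eq0 eqr_nat.
exists (fun t => b / (ii * (j%:R - k%:R : R)%:C) * cexp (ii * ((j%:R - k%:R) * t)%:C)).
split=> [t|].
  apply: cder_eq (cderMl _ (cder_cexp (de (j%:R - k%:R) t))).
  by rewrite mulrA divfK.
have -> : cexp (ii * ((j%:R - k%:R) * tau)%:C) = 1.
  rewrite mulrBl rmorphB mulrBr cexpD cexpN !cexp_int_tau.
  by rewrite invr1 mulr1.
by rewrite !mulr0 cexp0 subrr.
Qed.

(** The mean value of g rho is v up to an error of order rho, uniformly on the
    circle of radius rho; again a property that can be added up term by term. *)
Definition circle_asymp (g : R -> R -> C) (v : C) : Prop :=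
  exists (delta K : R), [/\ 0 < delta, 0 <= K & forall rho, 0 < rho < delta ->
    (forall t, exists d, cder (g rho) t d) /\
    exists2 main, periodic_mean main v &
      forall t, cnorm (g rho t - main t) <= K * rho].

Lemma circle_asymp0 : circle_asymp (fun _ _ => 0) 0.
Proof.
exists 1, 0; split=> // rho _; split; first by move=> t; exists 0; apply: cder_cst.
by exists (fun=> 0); [apply: periodic_mean0 | move=> t; rewrite subrr cnorm0 mul0r].
Qed.

Lemma circle_asympD g v h w : circle_asymp g v -> circle_asymp h w ->
  circle_asymp (fun rho t => g rho t + h rho t) (v + w).
Proof.
move=> [d [K [d0 K0 H]]] [d' [K' [d'0 K'0 H']]].
exists (Num.min d d'), (K + K'); split; rewrite ?lt_min ?d0 ?addr_ge0 // => rho.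
move=> /andP[r0]; rewrite lt_min => /andP[rd rd'].
have /H[D [m mv mb]] : 0 < rho < d by rewrite r0.
have /H'[D' [m' mv' mb']] : 0 < rho < d' by rewrite r0.
split.
  by move=> t; have [x X] := D t; have [y Y] := D' t; exists (x + y); apply: cderD.
exists (fun t => m t + m' t); first exact: periodic_meanD.
move=> t; have -> : g rho t + h rho t - (m t + m' t) = (g rho t - m t) + (h rho t - m' t) by ring.
by apply: le_trans (cnormD _ _) _; rewrite mulrDl lerD.
Qed.

Lemma circle_asymp_sum (I : eqType) (r : seq I) (g : I -> R -> R -> C) (v : I -> C) :
  (forall i, i \in r -> circle_asymp (g i) (v i)) ->
  circle_asymp (fun rho t => \sum_(i <- r) g i rho t) (\sum_(i <- r) v i).
Proof.
elim: r => [|i r IHr] gv.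
  rewrite big_nil; under [fun _ => _]eq_fun do under [fun _ => _]eq_fun do rewrite big_nil.
  exact: circle_asymp0.
rewrite big_cons; under [fun _ => _]eq_fun do under [fun _ => _]eq_fun do rewrite big_cons.
apply: circle_asympD; first by apply: gv; rewrite mem_head.
by apply: IHr => j jr; apply: gv; rewrite in_cons jr orbT.
Qed.

Lemma circle_asymp_cintegral g v : circle_asymp g v ->
  exists (delta K : R), [/\ 0 < delta, 0 <= K & forall rho, 0 < rho < delta ->
    cnorm (cintegral 0 tau (g rho) - tau%:C * v) <= K * rho].
Proof.
move=> [d [K [d0 K0 H]]]; exists d, (2%:R * (K * tau)); split=> //.
  by rewrite !mulr_ge0 // ltW // pi_gt0.
move=> rho /H[D [m mv mb]]; apply: le_trans (cintegral_approx D mv mb) _.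
by rewrite (_ : 2%:R * (K * rho * tau) = 2%:R * (K * tau) * rho) //; ring.
Qed.

End ContourIntegrals.

(** * The holomorphic functional calculus *)

Section Dunford.
Context {R : realType}.
Local Notation C := R[i].
Local Notation Re := (@complex.Re R).
Local Notation Im := (@complex.Im R).
Local Notation ii := (Complex (0 : R) 1).
Local Notation tau := (2%:R * pi : R).
Implicit Types (t rho : R) (z w e : C).
Local Notation circ rho t := (rho%:C * cexp (ii * t%:C)).

Lemma circ_neq0 rho t : 0 < rho -> circ rho t != 0.
Proof.
move=> r0; rewrite mulf_neq0 ?cexp_neq0 // eq_complex /= eqxx andbT gt_eqF //.
Qed.

Lemma circX rho t k : circ rho t ^+ k = rho%:C ^+ k * cexp (ii * (k%:R * t)%:C).
Proof.
rewrite exprMn; congr (_ * _); elim: k => [|k IHk].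
  by rewrite mul0r mulr0 cexp0.
by rewrite exprSr IHk -cexpD -mulrDr -rmorphD /= -[in RHS]natr1 mulrDl mul1r.
Qed.

Lemma cder_circle_term (f : C -> C) e w X k rho t :
  (exists d, cder (fun s => f (e + circ rho s)) t d) -> e + circ rho t - w != 0 ->
  exists d, cder (fun s => X * f (e + circ rho s) * (ii * circ rho s) /
     (e + circ rho s - w) ^+ k.+1) t d.
Proof.
move=> [d D] n0; have dc := cder_circle rho t.
have dn := cderX k.+1 (cderB (cderD (cder_cst e t) dc) (cder_cst w t)).
have nk : (e + circ rho t - w) ^+ k.+1 != 0 by rewrite expf_neq0.
eexists; apply: cderM; last exact: (cder_inv nk dn).
by apply: cderM (cderMl X D) (cderMl ii dc).
Qed.

(** On the circle around w itself, only the term of degree k of the expansion of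
    f survives; on the other circles there is no residue. *)
Lemma circle_asymp_term (f : C -> C) e a w X k m : expands f e a -> (k < m)%N ->
  circle_asymp (fun rho t => X * f (e + circ rho t) * (ii * circ rho t) /
     (e + circ rho t - w) ^+ k.+1) (if w == e then ii * a k * X else 0).
Proof.
move=> [fa [d2 d20 fd]] km; case: eqVneq => [->|we].
  have [d1 [K [d10 K0 fK]]] := fa m.
  exists (Num.min (Num.min d1 d2) 1), (cnorm X * K).
  split; rewrite ?lt_min ?d10 ?d20 ?ltr01 ?mulr_ge0 ?cnorm_ge0 // => rho.
  rewrite !lt_min => /andP[r0 /andP[/andP[r1 r2] r3]].
  have cn t : cnorm (circ rho t) = rho by rewrite cnorm_circle // ltW.
  split=> [t|].
    apply: cder_circle_term; first by apply: fd; rewrite r0.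
    by rewrite addrAC subrr add0r circ_neq0.
  exists (fun t => \sum_(j < m) (ii * X * a j * rho%:C ^+ j / rho%:C ^+ k) *
      cexp (ii * ((j%:R - k%:R) * t)%:C)).
    have rc0 : rho%:C ^+ k != 0 :> C.
      by rewrite expf_neq0 // eq_complex /= eqxx andbT gt_eqF.
    have -> : ii * a k * X = \sum_(j < m) (if (j : nat) == k
        then ii * X * a j * rho%:C ^+ j / rho%:C ^+ k else 0).
      rewrite (bigD1 (Ordinal km)) //= eqxx big1 => [|j jk].
        by rewrite addr0 mulfK //; ring.
      by rewrite ifF //; apply/negbTE; apply: contraNneq jk => jk; apply/eqP/val_inj.
    by apply: periodic_mean_sum => j; apply: periodic_mean_exp.
  move=> t; have -> : X * f (e + circ rho t) * (ii * circ rho t) /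
      (e + circ rho t - e) ^+ k.+1 - \sum_(j < m) (ii * X * a j * rho%:C ^+ j /
      rho%:C ^+ k) * cexp (ii * ((j%:R - k%:R) * t)%:C) =
    ii * X * (f (e + circ rho t) - \sum_(j < m) a j * circ rho t ^+ j) / circ rho t ^+ k.
    have u0 := circ_neq0 t r0.
    rewrite [e + _]addrC addrK exprS mulrBr mulrBl; congr (_ - _).
      by move: (circ rho t) u0 => u u0; field; rewrite ?expf_neq0 ?u0.
    rewrite mulr_sumr mulr_suml; apply: eq_bigr => j _.
    rewrite !circX mulrBl rmorphB mulrBr cexpD cexpN.
    by rewrite invfM !mulrA; ring.
  have := fK (circ rho t); rewrite cn => /(_ r1) H.
  rewrite !cnormM cnormV cnormX cn cnorm_ii mul1r -!mulrA.
  apply: ler_wpM2l; first exact: cnorm_ge0.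
  rewrite ler_pdivrMr ?exprn_gt0 //; apply: le_trans H _.
  rewrite -mulrA -exprS; apply: ler_wpM2l => //.
  by rewrite ler_wiXn2l // ltW.
have [d1 [K [d10 K0 fK]]] := fa 0%N.
have n0 : 0 < cnorm (e - w) by apply: cnorm_gt0; rewrite subr_eq0 eq_sym.
pose d := cnorm (e - w) / 2%:R.
have d0 : 0 < d by rewrite divr_gt0.
exists (Num.min (Num.min d1 d2) d), (cnorm X * K * (d ^+ k.+1)^-1).
have dk : 0 < d ^+ k.+1 by rewrite exprn_gt0.
split; rewrite ?lt_min ?d10 ?d20 ?d0 ?mulr_ge0 ?cnorm_ge0 ?invr_ge0 ?(ltW dk) // => rho.
rewrite !lt_min => /andP[r0 /andP[/andP[r1 r2] r3]].
have cn t : cnorm (circ rho t) = rho by rewrite cnorm_circle // ltW.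
have far t : d <= cnorm (e + circ rho t - w).
  have := cnormB (e - w) (- circ rho t); rewrite cnormN cn opprK addrAC => H.
  by apply: le_trans H; move: r3; rewrite /d; lra.
split=> [t|].
  apply: cder_circle_term; first by apply: fd; rewrite r0.
  by have := far t; apply: contraTneq => ->; rewrite cnorm0 -ltNge.
exists (fun=> 0); first exact: periodic_mean0.
move=> t; have := fK (circ rho t); rewrite cn big_ord0 subr0 expr0 mulr1 => /(_ r1) H.
have cn2 : cnorm rho%:C * cnorm (cexp (ii * t%:C)) = rho by rewrite -cnormM cn.
rewrite subr0 !cnormM cnormV cnormX cnorm_ii mul1r cn2.
have H1 : (cnorm (e + circ rho t - w) ^+ k.+1)^-1 <= (d ^+ k.+1)^-1.
  rewrite lef_pV2 ?posrE ?exprn_gt0 //; last exact: lt_le_trans d0 (far t).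
  by rewrite lerXn2r // nnegrE ?(ltW d0) // cnorm_ge0.
have -> : cnorm X * K * (d ^+ k.+1)^-1 * rho = cnorm X * rho * (K * (d ^+ k.+1)^-1) by ring.
have -> : cnorm X * cnorm (f (e + circ rho t)) * rho * (cnorm (e + circ rho t - w) ^+ k.+1)^-1 =
  cnorm X * rho * (cnorm (f (e + circ rho t)) * (cnorm (e + circ rho t - w) ^+ k.+1)^-1) by ring.
apply: ler_wpM2l; first by rewrite mulr_ge0 ?cnorm_ge0 // ltW.
by apply: ler_pM; rewrite ?cnorm_ge0 // invr_ge0 exprn_ge0 // cnorm_ge0.
Qed.

(** The contour integrals converge at a linear rate, which is easier to add up than
    mere convergence. *)
Definition lin_limit (h : R -> C) (v : C) : Prop :=
  exists (delta K : R), [/\ 0 < delta, 0 <= K & forall rho, 0 < rho < delta ->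
    cnorm (h rho - v) <= K * rho].

Lemma lin_limit_sum (I : eqType) (r : seq I) (h : I -> R -> C) (v : I -> C) :
  (forall i, i \in r -> lin_limit (h i) (v i)) ->
  lin_limit (fun rho => \sum_(i <- r) h i rho) (\sum_(i <- r) v i).
Proof.
elim: r => [|i r IHr] hv.
  by exists 1, 0; split=> // rho _; rewrite !big_nil subrr cnorm0 mul0r.
have [d [K [d0 K0 H]]] := hv i (mem_head _ _).
have [|d' [K' [d'0 K'0 H']]] := IHr.
  by move=> j jr; apply: hv; rewrite in_cons jr orbT.
exists (Num.min d d'), (K + K'); split; rewrite ?lt_min ?d0 ?addr_ge0 // => rho.
move=> /andP[r0]; rewrite lt_min => /andP[rd rd'].
rewrite !big_cons opprD addrACA; apply: le_trans (cnormD _ _) _.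
by rewrite mulrDl lerD ?H ?H' // r0.
Qed.

Lemma lin_limitMl h v b : lin_limit h v -> lin_limit (fun rho => b * h rho) (b * v).
Proof.
move=> [d [K [d0 K0 H]]]; exists d, (cnorm b * K).
split; rewrite ?mulr_ge0 ?cnorm_ge0 // => rho /H H1.
by rewrite -mulrBr cnormM -mulrA ler_wpM2l ?cnorm_ge0.
Qed.

Lemma lin_limit_lim h v : lin_limit h v ->
  (lim (Re (h rho) @[rho --> 0^'+]) +i* lim (Im (h rho) @[rho --> 0^'+]))%classic = v.
Proof.
move=> [d [K [d0 K0 H]]].
have key (p : C -> R) (pB : forall z w, p (z - w) = p z - p w)
    (pn : forall z, `|p z| <= cnorm z) : lim (p (h rho) @[rho --> 0^'+])%classic = p v.
  apply/cvg_lim => //; apply/cvgrPdist_le => eps eps0.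
  near=> rho; have r0 : 0 < rho by near: rho; apply: nbhs_right_gt.
  rewrite distrC -pB; apply: le_trans (pn _) _.
  have rd : 0 < rho < d by rewrite r0 /=; near: rho; apply: nbhs_right_lt.
  apply: le_trans (H _ rd) _.
  have : rho < eps / (K + 1).
    by near: rho; apply: nbhs_right_lt; rewrite divr_gt0 // ltr_wpDl.
  rewrite ltr_pdivlMr ?ltr_wpDl // => H1; nra.
apply: cplx_eq => /=; apply: key; [| exact: Re_le_cnorm | | exact: Im_le_cnorm].
  by move=> z w; rewrite ReD ReN.
by move=> z w; rewrite ImD ImN.
Unshelve. all: by end_near. Qed.

Lemma invmx_uniq (F : comUnitRingType) n (A B : 'M[F]_n) : A *m B = 1%:M -> invmx A = B.
Proof. by move=> AB; have [Au _] := mulmx1_unit AB; rewrite -[LHS]mulmx1 -AB mulKmx. Qed.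

Section Partition.
Context {n : nat} (M : 'M[C]_n.+1) (s : seq C) (w : C -> C) (P : C -> 'M[C]_n.+1) (m : nat).
Hypothesis P1 : \sum_(c <- s) P c = 1.
Hypothesis Pm : {in s, forall c, (M - (w c)%:M) ^+ m * P c = 0}.

(** On each summand M - w is nilpotent, and the geometric series is finite. *)
Lemma resolvent_partition z : {in s, forall c, z != w c} ->
  invmx (z%:M - M) =
  \sum_(c <- s) \sum_(k < m) (z - w c) ^- k.+1 *: ((M - (w c)%:M) ^+ k * P c).
Proof.
move=> zw; apply: invmx_uniq; rewrite -[1%:M]/(1 : 'M[C]_n.+1) -P1 mulmx_sumr.
rewrite big_seq [RHS]big_seq; apply: eq_bigr => c cs.
have zc : z - w c != 0 by rewrite subr_eq0 zw.
have -> : z%:M - M = (z - w c)%:M - (M - (w c)%:M).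
  by rewrite raddfB /= opprB addrA subrK.
have := Pm cs; move: (M - _) => N Nm.
suff -> j : ((z - w c)%:M - N) *m (\sum_(k < j) (z - w c) ^- k.+1 *: (N ^+ k * P c)) =
    P c - (z - w c) ^- j *: (N ^+ j * P c) by rewrite Nm scaler0 subr0.
elim: j => [|j IHj].
  by rewrite big_ord0 mulmx0 expr0 mul1r invr1 scale1r subrr.
rewrite big_ord_recr mulmxDr IHj mulmxBl mul_scalar_mx scalerA -scalemxAr.
rewrite [in X in _ + (X - _)]exprS invfM mulrA mulfV // mul1r addrA subrK.
by rewrite -[N *m _]/(N * _) mulrA -exprS.
Qed.

(** Small circles around an eigenvalue avoid the other points. *)
Lemma isolation e : exists2 delta, 0 < delta &
  {in s, forall c, w c != e -> delta <= cnorm (e - w c)}.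
Proof.
elim: s => [|c r [d d0 dr]]; first by exists 1.
have [ce|ce] := eqVneq (w c) e.
  exists d => // c'; rewrite in_cons => /orP[/eqP -> |c'r]; last exact: dr.
  by rewrite ce eqxx.
exists (Num.min d (cnorm (e - w c))) => [|c'].
  by rewrite lt_min d0 cnorm_gt0 // subr_eq0 eq_sym.
rewrite in_cons => /orP[/eqP -> _|c'r c'e]; first by rewrite ge_min lexx orbT.
by rewrite ge_min dr.
Qed.

Variables (f : C -> C) (a : C -> nat -> C).
Hypothesis f_expands : forall e, eigenvalue M e -> expands f e (a e).
Hypothesis w_eigen : {in s, forall c, eigenvalue M (w c)}.

(** The points w c need not be distinct, and every eigenvalue contributes the terms
    whose point it is: this covers the angle pi, where all the rays meet. *)
Lemma holo_calculus_partition : holo_calculus f M =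
  \sum_(c <- s) \sum_(k < m) a (w c) k *: ((M - (w c)%:M) ^+ k * P c).
Proof.
apply/matrixP => i j; rewrite !mxE; apply: lin_limit_lim.
pose X c k := ((M - (w c)%:M) ^+ k * P c) i j.
have [r0] := closed_field_poly_normal (char_poly M).
rewrite (monicP (char_poly_monic M)) scale1r => char_r.
pose r := undup r0.
have r_eigen e : (e \in r) = eigenvalue M e.
  by rewrite mem_undup eigenvalue_root_char char_r root_prod_XsubC.
have setE : [set e | eigenvalue M e]%classic = [set` r]%classic.
  by apply/seteqP; split=> e /=; rewrite r_eigen.
(* Only the terms whose point is e have a residue at e. *)
pose v e := \sum_(c <- s) \sum_(k < m) (if w c == e then ii * a e k * X c k else 0).
have circ_lim e : e \in r -> lin_limit
    (fun rho => circle_integral (fun z => f z * invmx (z%:M - M) i j) e rho) (tau%:C * v e).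
  rewrite r_eigen => /f_expands fe.
  have asymp : circle_asymp (fun rho t => \sum_(c <- s) \sum_(k < m)
      X c k * f (e + circ rho t) * (ii * circ rho t) / (e + circ rho t - w c) ^+ k.+1) (v e).
    apply: circle_asymp_sum => c _; apply: circle_asymp_sum => k _.
    exact: circle_asymp_term fe (ltn_ord k).
  have [d1 [K [d10 K0 H]]] := circle_asymp_cintegral asymp.
  have [d2 d20 iso] := isolation e.
  exists (Num.min d1 d2), K; split; rewrite ?lt_min ?d10 // => rho.
  rewrite lt_min => /andP[rpos /andP[r1 r2]].
  have r01 : 0 < rho < d1 by rewrite rpos.
  rewrite /circle_integral; set g := (fun t => _).
  suff -> : g = (fun t => \sum_(c <- s) \sum_(k < m)
      X c k * f (e + circ rho t) * (ii * circ rho t) / (e + circ rho t - w c) ^+ k.+1) by exact: H.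
  apply/funext => t; rewrite /g.
  have -> : 0 +i* t = ii * t%:C by apply: cplx_eq => /=; ring.
  set u := circ rho t.
  have un : cnorm u = rho by rewrite cnorm_circle // ltW.
  rewrite resolvent_partition => [|c cs]; last first.
    apply/eqP => uc; have [we|we] := eqVneq (w c) e.
      have /eqP := uc; rewrite we -subr_eq0 addrAC subrr add0r.
      by rewrite (negbTE (circ_neq0 t rpos)).
    have := iso c cs we; rewrite -uc opprD addrA subrr add0r cnormN un.
    by rewrite leNgt r2.
  rewrite summxE mulr_sumr mulr_suml; apply: eq_bigr => c _.
  rewrite summxE mulr_sumr mulr_suml; apply: eq_bigr => k _.
  by rewrite mxE -/(X c k); ring.
have dE rho : dunford_sum f M rho i j = (0 +i* tau)^-1 * \sum_(e <- r)
    circle_integral (fun z => f z * invmx (z%:M - M) i j) e rho.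
  by rewrite /dunford_sum setE -fsbig_seq ?undup_uniq.
have tau0 : (0 +i* tau : C) != 0.
  by rewrite eq_complex /= eqxx gt_eqF // tau_gt0.
have vE : (0 +i* tau)^-1 * \sum_(e <- r) tau%:C * v e =
    (\sum_(c <- s) \sum_(k < m) a (w c) k *: ((M - (w c)%:M) ^+ k * P c)) i j.
  apply: (mulfI tau0); rewrite mulVKf //.
  rewrite -mulr_sumr exchange_big /= summxE !mulr_sumr big_seq [RHS]big_seq.
  apply: eq_bigr => c cs; rewrite exchange_big /= summxE !mulr_sumr.
  apply: eq_bigr => k _; rewrite mxE -/(X c k).
  rewrite (bigD1_seq (w c)) ?undup_uniq ?r_eigen ?w_eigen //= eqxx.
  rewrite big1 => [|e /negbTE ec]; last by rewrite eq_sym ec.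
  rewrite addr0; have -> : 0 +i* tau = tau%:C * ii by apply: cplx_eq => /=; ring.
  by rewrite !mulrA.
under [X in lin_limit X _]eq_fun do rewrite dE.
rewrite -vE; apply: lin_limitMl; apply: lin_limit_sum => e er; exact: circ_lim.
Qed.

End Partition.
End Dunford.

(** * Complex powers of the matrices cos phi + sin phi V *)

Section MatrixPowers.
Context {R : realType}.
Local Notation C := R[i].
Local Notation Re := (@complex.Re R).
Local Notation Im := (@complex.Im R).
Local Notation ii := (Complex (0 : R) 1).
Implicit Types (t phi alpha : R) (lambda : C).

(** Entrywise, for the matrix-valued functions of the angle. *)
Definition mder {p q} (F : R -> 'M[C]_(p, q)) t (D : 'M[C]_(p, q)) : Prop :=
  forall i j, cder (fun s => F s i j) t (D i j).

Lemma mder_eq p q (F : R -> 'M[C]_(p, q)) t D E : D = E -> mder F t D -> mder F t E.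
Proof. by move=> ->. Qed.

Lemma mder_ext p q (F G : R -> 'M[C]_(p, q)) t D : F =1 G -> mder F t D -> mder G t D.
Proof. by move=> /funext ->. Qed.

Lemma mder_cst p q (A : 'M[C]_(p, q)) t : mder (fun=> A) t 0.
Proof. by move=> i j; rewrite mxE; apply: cder_cst. Qed.

Lemma mderD p q (F G : R -> 'M[C]_(p, q)) t D E : mder F t D -> mder G t E ->
  mder (fun s => F s + G s) t (D + E).
Proof.
move=> dF dG i j; rewrite mxE; apply: cder_ext (cderD (dF i j) (dG i j)).
by move=> s; rewrite mxE.
Qed.

Lemma mderZ p q (f : R -> C) (A : R -> 'M[C]_(p, q)) t d D : cder f t d -> mder A t D ->
  mder (fun s => f s *: A s) t (d *: A t + f t *: D).
Proof.
move=> df dA i j; rewrite !mxE; apply: cder_ext (cderM df (dA i j)).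
by move=> s; rewrite mxE.
Qed.

Lemma mderZr p q (f : R -> C) (A : 'M[C]_(p, q)) t d : cder f t d ->
  mder (fun s => f s *: A) t (d *: A).
Proof.
by move=> df; apply: mder_eq (mderZ df (mder_cst A t)); rewrite scaler0 addr0.
Qed.

Lemma mderM p q r (F : R -> 'M[C]_(p, q)) (G : R -> 'M[C]_(q, r)) t D E :
  mder F t D -> mder G t E ->
  mder (fun s => F s *m G s) t (D *m G t + F t *m E).
Proof.
move=> dF dG i j; rewrite !mxE -big_split /=.
have : cder (fun s => \sum_k F s i k * G s k j) t
    (\sum_k (D i k * G t k j + F t i k * E k j)).
  by apply: cder_sum => k _; apply: cderM.
by apply: cder_ext => s; rewrite mxE.
Qed.

Lemma mderMl p q r (A : 'M[C]_(p, q)) (G : R -> 'M[C]_(q, r)) t E :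
  mder G t E -> mder (fun s => A *m G s) t (A *m E).
Proof.
by move=> dG; apply: mder_eq (mderM (mder_cst A t) dG); rewrite mul0mx add0r.
Qed.

Lemma mderMr p q r (A : 'M[C]_(q, r)) (F : R -> 'M[C]_(p, q)) t D :
  mder F t D -> mder (fun s => F s *m A) t (D *m A).
Proof.
by move=> dF; apply: mder_eq (mderM dF (mder_cst A t)); rewrite mulmx0 addr0.
Qed.

Lemma mder_sum p q (I : eqType) (r : seq I) (F : I -> R -> 'M[C]_(p, q)) t D :
  (forall i, i \in r -> mder (F i) t (D i)) ->
  mder (fun s => \sum_(i <- r) F i s) t (\sum_(i <- r) D i).
Proof.
elim: r => [|i r IHr] dF.
  by rewrite big_nil; under [fun _ => _]eq_fun do rewrite big_nil; apply: mder_cst.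
rewrite big_cons; under [fun _ => _]eq_fun do rewrite big_cons.
apply: mderD; first by apply: dF; rewrite mem_head.
by apply: IHr => j jr; apply: dF; rewrite in_cons jr orbT.
Qed.

Lemma mder_uniq p q (F : R -> 'M[C]_(p, q)) t D E : mder F t D -> mder F t E -> D = E.
Proof. by move=> dD dE; apply/matrixP => i j; apply: cder_uniq (dD i j) (dE i j). Qed.

Lemma mder_conj p q (F : R -> 'M[C]_(p, q)) t D : mder F t D ->
  mder (fun s => map_mx conjc (F s)) t (map_mx conjc D).
Proof.
move=> dF i j; rewrite mxE; apply: cder_ext (cder_conj (dF i j)).
by move=> s; rewrite mxE.
Qed.

Lemma mder_tr p q (F : R -> 'M[C]_(p, q)) t D : mder F t D -> mder (fun s => (F s)^T) t D^T.
Proof.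
move=> dF i j; rewrite mxE; apply: cder_ext (dF j i).
by move=> s; rewrite mxE.
Qed.

Lemma mder0_const p q (F : R -> 'M[C]_(p, q)) (a b : R) : a <= b ->
  (forall t, a <= t <= b -> mder F t 0) -> F a = F b.
Proof.
move=> ab dF; apply/matrixP => i j; apply: (cder0_const (f := fun s => F s i j)) ab _.
by move=> t /dF /(_ i j); rewrite mxE.
Qed.

(** The functions of the angle built from sin, cos and powers along the rays: a
    class stable under differentiation, hence made of smooth functions. *)
Inductive angular : (R -> C) -> Prop :=
| angular_cst z : angular (fun=> z)
| angular_sin : angular (fun t => (sin t)%:C)
| angular_cos : angular (fun t => (cos t)%:C)
| angular_pow (c mu : C) : 0 < Im c -> angular (fun t => cexp (mu * ray_log c t))
| angularD f g : angular f -> angular g -> angular (fun t => f t + g t)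
| angularM f g : angular f -> angular g -> angular (fun t => f t * g t)
| angular_conj f : angular f -> angular (fun t => conjc (f t)).

Lemma cder_ray_pow (c mu : C) t : 0 < Im c ->
  cder (fun s => cexp (mu * ray_log c s)) t
    (mu * (dray c t * cexp ((mu - 1) * ray_log c t))).
Proof.
move=> c0; apply: cder_eq (cder_cexp (cderMl mu (cder_ray_log t c0))).
rewrite mulrBl mul1r cexpD cexpN cexp_ray_log //.
by rewrite -!mulrA; congr (_ * (_ * _)); rewrite mulrC.
Qed.

Lemma ray_pow_shift (c mu : C) t : 0 < Im c ->
  ray c t * cexp ((mu - 1) * ray_log c t) = cexp (mu * ray_log c t).
Proof.
move=> c0; rewrite -{1}(cexp_ray_log t c0) -cexpD; congr cexp; ring.
Qed.

Lemma angular_der f : angular f -> exists2 g, angular g & forall t, cder f t (g t).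
Proof.
elim=> {f}.
- by move=> z; exists (fun=> 0); [exact: angular_cst | move=> t; apply: cder_cst].
- exists (fun t => (cos t)%:C); [exact: angular_cos | exact: cder_sin].
- exists (fun t => (- 1) * (sin t)%:C).
    by apply: angularM; [exact: angular_cst | exact: angular_sin].
  by move=> t; rewrite mulN1r; apply: cder_cos.
- move=> c mu c0; exists (fun t => mu * (((- 1) * (sin t)%:C + c * (cos t)%:C) *
      cexp ((mu - 1) * ray_log c t))).
    do ![apply: angularM | apply: angularD | exact: angular_cst | exact: angular_sin
       | exact: angular_cos | exact: angular_pow].
  by move=> t; rewrite mulN1r; apply: cder_ray_pow.
- move=> f g _ [f' af df] _ [g' ag dg]; exists (fun t => f' t + g' t).
    exact: angularD.
  by move=> t; apply: cderD.
- move=> f g af [f' af' df] ag [g' ag' dg].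
  exists (fun t => f' t * g t + f t * g' t).
    by apply: angularD; apply: angularM.
  by move=> t; apply: cderM.
- move=> f af [f' af' df]; exists (fun t => conjc (f' t)); first exact: angular_conj.
  by move=> t; apply: cder_conj.
Qed.

Lemma angular_derive1n f n : angular f -> exists2 g, angular g &
  derive1n n (fun s => Re (f s)) = (fun s => Re (g s)) /\
  derive1n n (fun s => Im (f s)) = (fun s => Im (g s)).
Proof.
move=> af; elim: n => [|n [g ag [gR gI]]]; first by exists f.
have [g' ag' dg] := angular_der ag; exists g' => //.
rewrite !derive1nS gR gI; split; apply/funext => t; rewrite derive1E.
  by case: (dg t) => -[_ ->].
by case: (dg t) => _ [_ ->].
Qed.

Lemma angular_sum (I : Type) (r : seq I) (F : I -> R -> C) :
  (forall i, angular (F i)) -> angular (fun t => \sum_(i <- r) F i t).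
Proof.
move=> aF; elim: r => [|i r IHr].
  by under [fun _ => _]eq_fun do rewrite big_nil; apply: angular_cst.
by under [fun _ => _]eq_fun do rewrite big_cons; apply: angularD.
Qed.

Lemma angularX f k : angular f -> angular (fun t => f t ^+ k).
Proof.
move=> af; elim: k => [|k IHk].
  by under [fun _ => _]eq_fun do rewrite expr0; apply: angular_cst.
by under [fun _ => _]eq_fun do rewrite exprS; apply: angularM.
Qed.

Lemma angular_smooth l (a b : R) (v : R -> 'cV[C]_l) :
  (forall k, angular (fun t => v t k 0)) -> smooth_on a b v.
Proof.
move=> av k n t _; have [g ag [-> ->]] := angular_derive1n n (av k).
by have [g' _ /(_ t)[[gR _] [gI _]]] := angular_der ag.
Qed.

Section OneMatrix.
Context {n : nat} (V : 'M[C]_n.+1).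

Definition pencil phi : 'M[C]_n.+1 := (cos phi)%:C%:M + (sin phi)%:C *: V.
Definition dpencil phi : 'M[C]_n.+1 := - (sin phi)%:C%:M + (cos phi)%:C *: V.

Variables (s : seq C) (q : C -> {poly C}).
Hypothesis s_eigen : {in s, forall c, eigenvalue V c}.
Hypothesis s_pos : forall c, eigenvalue V c -> 0 < Im c.
Let P c := horner_mx V (q c).
Let N c := V - c%:M.
Hypothesis P1 : \sum_(c <- s) P c = 1.
Hypothesis PN : {in s, forall c, N c ^+ n.+1 * P c = 0}.

Definition power_coef lambda c k phi : C :=
  gbin lambda k * (sin phi)%:C ^+ k * cexp ((lambda - k%:R) * ray_log c phi).

(** The binomial series for (w + sin phi N)^lambda on the generalised eigenspace of c,
    where w = ray c phi and N = V - c; it is finite because N is nilpotent there. *)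
Definition matrix_power lambda phi : 'M[C]_n.+1 :=
  \sum_(c <- s) \sum_(k < n.+1) power_coef lambda c k phi *: (N c ^+ k * P c).

Lemma pencil_ray c phi : pencil phi = (ray c phi)%:M + (sin phi)%:C *: N c.
Proof.
rewrite /pencil /ray /N scalerBr scale_scalar_mx raddfD /= mulrC -addrA.
by congr (_ + _); rewrite addrCA subrr addr0.
Qed.

Lemma dpencil_ray c phi : dpencil phi = (dray c phi)%:M + (cos phi)%:C *: N c.
Proof.
rewrite /dpencil /dray /N scalerBr scale_scalar_mx raddfD /= raddfN /= mulrC -addrA.
by congr (_ + _); rewrite addrCA subrr addr0.
Qed.

Lemma matrix_power0 lambda : matrix_power lambda 0 = 1.
Proof.
rewrite /matrix_power -P1; apply: eq_bigr => c _; rewrite big_ord_recl big1.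
  by rewrite addr0 /power_coef ray_log0 mulr0 cexp0 !expr0 !mul1r scale1r.
by move=> k _; rewrite /power_coef lift0 sin0 exprS !(mul0r, mulr0) scale0r.
Qed.

(** Pascal's rule; the top term vanishes by nilpotency. *)
Lemma pencil_power lambda phi :
  pencil phi *m matrix_power (lambda - 1) phi = matrix_power lambda phi.
Proof.
rewrite /matrix_power mulmx_sumr big_seq [RHS]big_seq; apply: eq_bigr => c cs.
have c0 := s_pos (s_eigen cs).
rewrite (pencil_ray c) mulmxDl mul_scalar_mx scaler_sumr big_ord_recl.
rewrite -scalemxAl mulmx_sumr scaler_sumr big_ord_recr /=.
rewrite [X in _ + (_ + X) = _](_ : _ = 0); last first.
  by rewrite -scalemxAr -[N c *m _]/(N c * _) mulrA -exprS PN // !scaler0.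
rewrite addr0 -addrA -big_split /= big_ord_recl; congr (_ + _).
  rewrite scalerA; congr (_ *: _); rewrite /power_coef !subr0 !expr0 !mul1r.
  exact: ray_pow_shift.
apply: eq_bigr => k _; rewrite /= /bump leq0n !add1n -scalemxAr !scalerA.
rewrite -[N c *m _]/(N c * _) mulrA -exprS -scalerDl; congr (_ *: _).
rewrite /power_coef (gbin_pascal lambda).
have -> : lambda - 1 - k%:R = lambda - k.+1%:R by rewrite -natr1; ring.
rewrite -(ray_pow_shift (lambda - k.+1%:R) phi c0) exprS.
have -> : lambda - 1 - k.+1%:R = lambda - k.+1%:R - 1 by ring.

ring.
Qed.

Lemma cder_power_coef lambda c k phi : 0 < Im c ->
  cder (power_coef lambda c k) phi
   (gbin lambda k * k%:R * ((sin phi)%:C ^+ k.-1 * (cos phi)%:C *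
       cexp ((lambda - k%:R) * ray_log c phi)) +
    lambda * (dray c phi * power_coef (lambda - 1) c k phi)).
Proof.
move=> c0; apply: cder_eq (cderM (cderMl _ (cderX k (cder_sin phi)))
  (cder_ray_pow (lambda - k%:R) phi c0)).
rewrite /power_coef; have -> : lambda - 1 - k%:R = lambda - k%:R - 1 by ring.
set x := cexp (_ * _); set y := cexp _; have := gbin_absorb lambda k => H.
transitivity (gbin lambda k * k%:R * ((sin phi)%:C ^+ k.-1 * (cos phi)%:C * x) +
  gbin lambda k * (lambda - k%:R) * ((sin phi)%:C ^+ k * dray c phi * y)); first by ring.
by rewrite H; ring.
Qed.

(** The derivative of the pencil is w' + cos phi N on each generalised eigenspace. Deriving
    the power of w gives the first contribution by the absorption identity, and deriving
    the power of sin phi gives the second, after a shift of the index. *)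
Lemma mder_matrix_power lambda phi :
  mder (matrix_power lambda) phi (lambda *: (dpencil phi *m matrix_power (lambda - 1) phi)).
Proof.
have -> : lambda *: (dpencil phi *m matrix_power (lambda - 1) phi) = \sum_(c <- s)
    lambda *: (dpencil phi *m \sum_(k < n.+1) power_coef (lambda - 1) c k phi *: (N c ^+ k * P c)).
  by rewrite /matrix_power mulmx_sumr scaler_sumr.
apply: mder_sum => c cs; have c0 := s_pos (s_eigen cs).
have dk : mder (fun t => \sum_(k < n.+1) power_coef lambda c k t *: (N c ^+ k * P c)) phi
   (\sum_(k < n.+1) (gbin lambda k * k%:R * ((sin phi)%:C ^+ k.-1 * (cos phi)%:C *
       cexp ((lambda - k%:R) * ray_log c phi)) +
    lambda * (dray c phi * power_coef (lambda - 1) c k phi)) *: (N c ^+ k * P c)).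
  by apply: mder_sum => k _; apply: mderZr; apply: cder_power_coef.
apply: mder_eq dk; rewrite (dpencil_ray c) mulmxDl scalerDr addrC.
under eq_bigr do rewrite scalerDl.
rewrite big_split /= addrC; congr (_ + _).
  rewrite mul_scalar_mx scalerA scaler_sumr; apply: eq_bigr => k _.
  by rewrite scalerA mulrA.
rewrite big_ord_recl mulr0 mul0r scale0r add0r.
rewrite -scalemxAl mulmx_sumr scalerA scaler_sumr big_ord_recr /=.
  rewrite [X in _ = _ + X](_ : _ = 0); last first.
    by rewrite -scalemxAr -[N c *m _]/(N c * _) mulrA -exprS PN // !scaler0.
  rewrite addr0; apply: eq_bigr => k _; rewrite /= /bump leq0n add1n -scalemxAr scalerA.
have -> : N c *m (N c ^+ k * P c) = N c ^+ k.+1 * P c.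
  by rewrite -[LHS]/(N c * _) mulrA -exprS.
congr (_ *: _); rewrite add0n [- 1 + lambda]addrC gbinS_mul /power_coef.
have -> : lambda - 1 - k%:R = lambda - k.+1%:R by rewrite -natr1; ring.
ring.
Qed.

Lemma matrix_power_comm lambda phi : comm_mx V (matrix_power lambda phi).
Proof.
rewrite /comm_mx /matrix_power mulmx_sumr mulmx_suml; apply: eq_bigr => c _.
rewrite mulmx_sumr mulmx_suml; apply: eq_bigr => k _.
rewrite -scalemxAr -scalemxAl; congr (_ *: _).
have -> : N c ^+ k * P c = horner_mx V (('X - c%:P) ^+ k * q c).
  by rewrite rmorphM rmorphXn rmorphB /= horner_mx_X horner_mx_C.
exact/comm_mx_horner/comm_mx_refl.
Qed.

Lemma angular_power lambda i j : angular (fun t => matrix_power lambda t i j).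
Proof.
have -> : (fun t => matrix_power lambda t i j) = (fun t => \sum_(c <- s)
    (if eigenvalue V c then \sum_(k < n.+1) power_coef lambda c k t * ((N c ^+ k * P c) i j)
     else 0)).
  apply/funext => t; rewrite /matrix_power summxE big_seq [RHS]big_seq.
  apply: eq_bigr => c /s_eigen ->; rewrite summxE; apply: eq_bigr => k _.
  by rewrite mxE.
apply: angular_sum => c; case Vc: (eigenvalue V c); last exact: angular_cst.
have c0 := s_pos Vc.
apply: angular_sum => k.
apply: (@angularM (power_coef lambda c k) (fun=> (N c ^+ k * P c) i j)); last exact: angular_cst.
apply: (@angularM (fun t => gbin lambda k * (sin t)%:C ^+ k)
  (fun t => cexp ((lambda - k%:R) * ray_log c t))); last exact: angular_pow.
apply: (@angularM (fun=> gbin lambda k) (fun t => (sin t)%:C ^+ k)); first exact: angular_cst.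
by apply: angularX; exact: angular_sin.
Qed.

Section Calculus.
Variables (Q : 'M[C]_n.+1) (alpha : R).
Hypothesis Q_unit : Q \in unitmx.
Hypothesis alpha_gt0 : 0 < alpha.
Hypothesis alpha_lt : alpha < 2%:R * pi.
Let Z := Q *m pencil alpha *m invmx Q.

(** At the angle pi, where the sine vanishes, any eigenvalue of V will do. *)
Lemma eigenvalue_pencil e : eigenvalue Z e ->
  exists2 c, eigenvalue V c & e = ray c alpha.
Proof.
case/eigenvalueP => y yZ y0; pose x := y *m Q.
have x0 : x != 0.
  by apply: contraNneq y0 => xx; rewrite -[y](mulmxK Q_unit) -/x xx mul0mx.
have xT : x *m pencil alpha = e *: x.
  by rewrite /x scalemxAl -yZ /Z !mulmxA mulmxKV.
have xV : (sin alpha)%:C *: (x *m V) = (e - (cos alpha)%:C) *: x.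
  rewrite scalerBl -xT /pencil mulmxDr mul_mx_scalar addrC addKr.
  by rewrite -scalemxAr.
have [s0|s0] := eqVneq (sin alpha) 0.
  have [c Vc] := eigenvalue_closed V (ltn0Sn n); exists c => //.
  move: xV; rewrite s0 scale0r => /esym/eqP; rewrite scaler_eq0 (negbTE x0) orbF.
  by rewrite subr_eq0 => /eqP ->; rewrite /ray s0 mulr0 addr0.
have sc0 : (sin alpha)%:C != 0 :> C by rewrite eq_complex /= eqxx andbT.
exists ((e - (cos alpha)%:C) / (sin alpha)%:C).
  apply/eigenvalueP; exists x => //; apply: (scalerI sc0).
  by rewrite xV scalerA mulrC divfK.
by rewrite /ray divfK // addrC subrK.
Qed.

Lemma pencil_eigenvalue c : eigenvalue V c -> eigenvalue Z (ray c alpha).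
Proof.
case/eigenvalueP => x xV x0; apply/eigenvalueP; exists (x *m invmx Q); last first.
  by apply: contraNneq x0 => xx; rewrite -[x](mulmxKV Q_unit) xx mul0mx.
rewrite /Z !mulmxA mulmxKV // scalemxAl; congr (_ *m _).
by rewrite /pencil mulmxDr mul_mx_scalar -scalemxAr xV scalerA -scalerDl /ray [c * _]mulrC.
Qed.

Let ray_coef lambda e k : C := gbin lambda k * cexp ((lambda - k%:R) * log_plus e).

Lemma expands_eigen lambda e : eigenvalue Z e ->
  expands (cpow_plus lambda) e (ray_coef lambda e).
Proof.
case/eigenvalue_pencil => c /s_pos c0 ->.
have L := ray_log_arg c0 alpha_gt0 alpha_lt.
rewrite -(cexp_ray_log alpha c0) /ray_coef log_plus_cexp.
  exact: expands_cpow_plus.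
by case/andP: L => /ltW -> ->.
Qed.

Let PZ c := Q *m P c *m invmx Q.

Lemma PZ_sum : \sum_(c <- s) PZ c = 1.
Proof. by rewrite /PZ -mulmx_suml -mulmx_sumr P1 mulmx1 mulmxV. Qed.

Lemma PZ_pow c k : (Z - (ray c alpha)%:M) ^+ k * PZ c =
  (sin alpha)%:C ^+ k *: (Q *m (N c ^+ k * P c) *m invmx Q).
Proof.
have ZN : Z - (ray c alpha)%:M = (sin alpha)%:C *: (Q *m N c *m invmx Q).
  rewrite /Z (pencil_ray c) mulmxDr mulmxDl mul_mx_scalar -scalemxAl mulmxV //.
  by rewrite scalemx1 addrC addKr -scalemxAr -scalemxAl.
elim: k => [|k IHk]; first by rewrite !expr0 !mul1r scale1r.
rewrite exprS -mulrA IHk ZN -[LHS]/(_ *m _) -scalemxAl -scalemxAr scalerA -exprS.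
have <- : N c *m (N c ^+ k * P c) = N c ^+ k.+1 * P c.
  by rewrite -[LHS]/(N c * _) mulrA -exprS.
by congr (_ *: _); rewrite !mulmxA mulmxKV.
Qed.

Lemma PZ_nil : {in s, forall c, (Z - (ray c alpha)%:M) ^+ n.+1 * PZ c = 0}.
Proof. by move=> c cs; rewrite PZ_pow PN // mulmx0 mul0mx scaler0. Qed.

Lemma holo_plus lambda :
  holo_calculus (cpow_plus lambda) Z = Q *m matrix_power lambda alpha *m invmx Q.
Proof.
rewrite (holo_calculus_partition PZ_sum PZ_nil (@expands_eigen lambda)); last first.
  by move=> c /s_eigen; apply: pencil_eigenvalue.
rewrite /matrix_power mulmx_sumr mulmx_suml big_seq [RHS]big_seq.
apply: eq_bigr => c cs; have c0 := s_pos (s_eigen cs).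
rewrite mulmx_sumr mulmx_suml; apply: eq_bigr => k _.
rewrite PZ_pow scalerA -scalemxAr -scalemxAl; congr (_ *: _).
rewrite /ray_coef /power_coef -(cexp_ray_log alpha c0) log_plus_cexp; first by ring.
by have /andP[/ltW -> ->] := ray_log_arg c0 alpha_gt0 alpha_lt.
Qed.

(** Conjugating every datum of the partition reduces to the other branch. *)
Lemma holo_minus lambda : holo_calculus (cpow_minus lambda) (conj_mx Z) =
  conj_mx (Q *m matrix_power (conjc lambda) alpha *m invmx Q).
Proof.
rewrite -holo_plus.
rewrite (holo_calculus_partition PZ_sum PZ_nil (@expands_eigen (conjc lambda))); last first.
  by move=> c /s_eigen; apply: pencil_eigenvalue.
have -> : cpow_minus lambda = (fun z => conjc (cpow_plus (conjc lambda) (conjc z))).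
  by apply/funext => z; rewrite cpow_minusE.
have conj_eigen e : eigenvalue (conj_mx Z) e = eigenvalue Z (conjc e).
  rewrite !eigenvalue_det -[in LHS](conjcK e).
  have -> : conj_mx Z - (conjc (conjc e))%:M = map_mx conjc (Z - (conjc e)%:M).
    by rewrite map_mxB map_scalar_mx.
  by rewrite det_map_mx conjc_eq0.
have sum1 : \sum_(c <- s) conj_mx (PZ c) = 1.
  by rewrite /conj_mx -map_mx_sum PZ_sum map_mx1.
have conj_pow c k : (conj_mx Z - (conjc (ray c alpha))%:M) ^+ k * conj_mx (PZ c) =
    conj_mx ((Z - (ray c alpha)%:M) ^+ k * PZ c).
  rewrite /conj_mx [in RHS]map_mxM; congr (_ * _).
  have -> : map_mx conjc Z - (conjc (ray c alpha))%:M = map_mx conjc (Z - (ray c alpha)%:M).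
    by rewrite map_mxB map_scalar_mx.
  elim: k => [|k IHk]; first by rewrite !expr0 map_mx1.
  by rewrite !exprS IHk [in RHS]map_mxM.
rewrite (@holo_calculus_partition _ _ (conj_mx Z) s (fun c => conjc (ray c alpha))
  (fun c => conj_mx (PZ c)) n.+1 sum1 _ _
  (fun e k => conjc (ray_coef (conjc lambda) (conjc e) k))).
- rewrite /conj_mx [in RHS]map_mx_sum; apply: eq_bigr => c _.
  rewrite [in RHS]map_mx_sum; apply: eq_bigr => k _.
  by rewrite conj_pow conjcK map_mxZ.
- by move=> c cs; rewrite conj_pow PZ_nil // /conj_mx map_mx0.
- by move=> e; rewrite conj_eigen => /(expands_eigen (conjc lambda))/expands_conj; rewrite conjcK.
- by move=> c /s_eigen Vc; rewrite conj_eigen conjcK; apply: pencil_eigenvalue.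
Qed.

End Calculus.
End OneMatrix.
End MatrixPowers.

(** * First-order systems, and derivatives in polar coordinates *)

Section PowerFamilies.
Context {R : realType} {n : nat}.
Local Notation C := R[i].
Implicit Types (V : 'M[C]_n.+1) (G : C -> R -> 'M[C]_n.+1) (lambda : C) (t phi : R).

Lemma map_conjZ p q a (A : 'M[C]_(p, q)) :
  map_mx conjc (a *: A) = conjc a *: map_mx conjc A.
Proof. exact: map_mxZ. Qed.

(** What the proof uses of the powers of cos phi + sin phi V. *)
Definition power_family V G : Prop :=
  [/\ forall lambda, G lambda 0 = 1%:M,
      forall lambda phi, pencil V phi *m G (lambda - 1) phi = G lambda phi,
      forall lambda phi,
        mder (G lambda) phi (lambda *: (dpencil V phi *m G (lambda - 1) phi)) &
      forall lambda phi, comm_mx V (G lambda phi)].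

Lemma pencil_conj V phi : conj_mx (pencil V phi) = pencil (conj_mx V) phi.
Proof.
have -> : conj_mx (pencil V phi) =
    (conjc (cos phi)%:C)%:M + conjc (sin phi)%:C *: conj_mx V.
  by rewrite /conj_mx map_mxD map_mxZ map_scalar_mx.
by rewrite !conjc_real.
Qed.

Lemma dpencil_conj V phi : conj_mx (dpencil V phi) = dpencil (conj_mx V) phi.
Proof.
have -> : conj_mx (dpencil V phi) =
    - (conjc (sin phi)%:C)%:M + conjc (cos phi)%:C *: conj_mx V.
  by rewrite /conj_mx map_mxD map_mxZ map_mxN map_scalar_mx.
by rewrite !conjc_real.
Qed.

Lemma power_family_conj V G : power_family V G ->
  power_family (conj_mx V) (fun lambda phi => conj_mx (G (conjc lambda) phi)).
Proof.
move=> [G0 GT dG GV]; split=> [lambda|lambda phi|lambda phi|lambda phi].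
- by rewrite G0 /conj_mx map_mx1.
- by rewrite -pencil_conj /conj_mx -map_mxM conjcB conjc1 GT.
- apply: mder_eq (mder_conj (dG (conjc lambda) phi)).
  by rewrite map_conjZ conjcK map_mxM -/(conj_mx _) -/(conj_mx _) dpencil_conj conjcB conjc1.
- by rewrite /comm_mx /conj_mx -!map_mxM GV.
Qed.

(** The pencil commutes with the powers, so the order of factors may be reversed. *)
Lemma power_family_tr V G : power_family V G ->
  power_family V^T (fun lambda phi => (G lambda phi)^T).
Proof.
have pT phi W : pencil W^T phi = (pencil W phi)^T.
  by rewrite /pencil linearD linearZ /= tr_scalar_mx.
have dT phi W : dpencil W^T phi = (dpencil W phi)^T.
  by rewrite /dpencil linearD linearN linearZ /= tr_scalar_mx.
have comm_pencil phi (A B : 'M[C]_n.+1) : comm_mx A B -> comm_mx (pencil A phi) B.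
  rewrite /comm_mx /pencil mulmxDl mulmxDr mul_scalar_mx mul_mx_scalar.
  by rewrite -scalemxAl -scalemxAr => ->.
have comm_dpencil phi (A B : 'M[C]_n.+1) : comm_mx A B -> comm_mx (dpencil A phi) B.
  rewrite /comm_mx /dpencil mulmxDl mulmxDr mulNmx mulmxN mul_scalar_mx mul_mx_scalar.
  by rewrite -scalemxAl -scalemxAr => ->.
move=> [G0 GT dG GV]; split=> [lambda|lambda phi|lambda phi|lambda phi].
- by rewrite G0 trmx1.
- by rewrite pT -trmx_mul -(comm_pencil _ _ _ (GV _ _)) GT.
- apply: mder_eq (mder_tr (dG lambda phi)).
  by rewrite linearZ /= (comm_dpencil _ _ _ (GV _ _)) trmx_mul dT.
- by rewrite /comm_mx -!trmx_mul GV.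
Qed.

Lemma power_family_adj V G : power_family V G ->
  power_family (adjm V) (fun lambda phi => adjm (G (conjc lambda) phi)).
Proof. by move=> /power_family_conj/power_family_tr. Qed.

Lemma comm_pencil V phi B : comm_mx V B -> comm_mx (pencil V phi) B.
Proof.
rewrite /comm_mx /pencil mulmxDl mulmxDr mul_scalar_mx mul_mx_scalar.
by rewrite -scalemxAl -scalemxAr => ->.
Qed.

Lemma comm_dpencil V phi B : comm_mx V B -> comm_mx (dpencil V phi) B.
Proof.
rewrite /comm_mx /dpencil mulmxDl mulmxDr mulNmx mulmxN mul_scalar_mx mul_mx_scalar.
by rewrite -scalemxAl -scalemxAr => ->.
Qed.

Section OneFamily.
Variables (V : 'M[C]_n.+1) (G : C -> R -> 'M[C]_n.+1).
Hypothesis VG : power_family V G.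

Lemma family0 lambda : G lambda 0 = 1%:M. Proof. by case: VG. Qed.
Lemma familyT lambda phi : pencil V phi *m G (lambda - 1) phi = G lambda phi.
Proof. by case: VG. Qed.
Lemma mder_family lambda phi :
  mder (G lambda) phi (lambda *: (dpencil V phi *m G (lambda - 1) phi)).
Proof. by case: VG. Qed.
Lemma family_comm lambda phi : comm_mx V (G lambda phi). Proof. by case: VG. Qed.

Lemma familyTr lambda phi : G (lambda - 1) phi *m pencil V phi = G lambda phi.
Proof. by rewrite -(comm_pencil _ (family_comm _ _)) familyT. Qed.

Lemma const_from0 p q (F : R -> 'M[C]_(p, q)) t :
  (forall s, mder F s 0) -> F t = F 0.
Proof.
move=> dF; have [t0|/ltW t0] := leP 0 t.
  by apply/esym; apply: mder0_const t0 _ => s _.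
by apply: mder0_const t0 _ => s _.
Qed.

(** The derivative of the product vanishes, and at the angle 0 it is the identity. *)
Lemma family_inv lambda phi : G lambda phi *m G (- lambda) phi = 1%:M.
Proof.
pose F s := G lambda s *m G (- lambda) s.
rewrite -/(F phi) (const_from0 (F := F)); first by rewrite /F !family0 mulmx1.
move=> s; apply: mder_eq (mderM (mder_family lambda s) (mder_family (- lambda) s)).
rewrite -scalemxAl -scalemxAr scaleNr -scalerBr.
rewrite -(familyT (- lambda)) -(familyTr lambda) -!mulmxA.
have TdT : pencil V s *m dpencil V s = dpencil V s *m pencil V s.
  apply: comm_pencil; apply: comm_mx_sym; apply: comm_dpencil; exact: comm_mx_refl.
set G1 := G (lambda - 1) s; set G2 := G (- lambda - 1) s.
suff -> : G1 *m (pencil V s *m (dpencil V s *m G2)) =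
    dpencil V s *m (G1 *m (pencil V s *m G2)) by rewrite subrr scaler0.
rewrite [pencil V s *m (_ *m G2)]mulmxA TdT !mulmxA.
by rewrite -(comm_dpencil _ (family_comm _ _)).
Qed.

(** Solutions of T v' = lambda T' v: multiply by the power of exponent - lambda
    as an integrating factor. *)
Lemma family_unique l (v v1 : R -> 'M[C]_(n.+1, l)) lambda (alpha : R) :
  (forall t, 0 <= t <= alpha -> mder v t (v1 t)) ->
  (forall t, 0 <= t <= alpha -> lambda *: (dpencil V t *m v t) = pencil V t *m v1 t) ->
  forall t, 0 <= t <= alpha -> v t = G lambda t *m v 0.
Proof.
move=> dv ode t /andP[t0 ta].
have y0 : G (- lambda) 0 *m v 0 = G (- lambda) t *m v t.
  apply: (mder0_const (F := fun s => G (- lambda) s *m v s)) t0 _ => s /andP[s0 st].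
  have sa : 0 <= s <= alpha by rewrite s0 (le_trans st ta).
  apply: mder_eq (mderM (mder_family (- lambda) s) (dv s sa)).
  rewrite -(familyTr (- lambda)) -[_ *m pencil V s *m _]mulmxA -(ode s sa).
  rewrite -scalemxAr mulmxA -(comm_dpencil _ (family_comm _ _)) -scalemxAl.
  by rewrite -scalerDl addNr scale0r.
by rewrite -[v 0]mul1mx -(family0 (- lambda)) y0 mulmxA family_inv mul1mx.
Qed.

End OneFamily.
End PowerFamilies.

Section PolarCoordinates.
Context {R : realType} {l : nat}.
Local Notation C := R[i].
Local Notation Re := (@complex.Re R).
Local Notation Im := (@complex.Im R).
Local Notation ii := (Complex (0 : R) 1).
Implicit Types (r phi t : R) (mu : C).

Lemma rpow_neq0 r mu : rpow r mu != 0.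
Proof. exact: cexp_neq0. Qed.

(** The directional derivative only sees the restriction to the line. *)
Lemma derive_line (F : 'rV[R]_2 -> R) (x e : 'rV[R]_2) (d : R) :
  is_derive (0 : R) (1 : R) (fun h : R => F (h *: e + x)) d -> 'D_e F x = d.
Proof.
case=> _ <-; rewrite /derive.
have -> : (fun h : R => h^-1 *: ((F \o shift x) (h *: e) - F x)) =
    (fun h : R => h^-1 *: (((fun h : R => F (h *: e + x)) \o shift 0) (h *: (1 : R)) -
      F ((0 : R) *: e + x))).
  by apply/funext => h /=; rewrite /shift /= scale0r add0r addr0 [h *: 1]mulr1.
by [].
Qed.

Lemma is_derive_fun (f g : R -> R) t d : f =1 g -> is_derive t 1 f d -> is_derive t 1 g d.
Proof. by move=> /funext ->. Qed.

Lemma is_derive_affine (x y t : R) : is_derive t 1 (fun s => x + s * y) y.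
Proof.
have D := is_deriveD (is_derive_cst x t (1 : R)) (is_deriveZ y (is_derive_id t (1 : R))).
apply: is_derive_to (is_derive_fun _ D) => [|s /=].
  by rewrite add0r -[_ *: _]/(_ * _) mulr1.
by rewrite [s * y]mulrC.
Qed.

(** Near a point, a straight line is described in polar coordinates by the
    principal logarithm of p + i q, where p and q are the coordinates in the
    frame adapted to the ray through the point. *)
Lemma polar_line (e1 e2 r phi h : R) :
  let z := (r + h * (e1 * cos phi + e2 * sin phi))
           +i* (h * (- e1 * sin phi + e2 * cos phi)) in
  0 < Re z ->
  h *: \row_(i < 2) (if i == 0 then e1 else e2) + polar r phi =
  polar (expR (Re (half_log z))) (phi + Im (half_log z)).
Proof.
move=> z z0; have zE := cexp_half_log z0.
have /(congr1 (@complex.Re R)) pE := zE; have /(congr1 (@complex.Im R)) qE := zE.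
move: pE qE; rewrite /cexp /=; set rho := expR _; set th := atan _ => pE qE.
have cs := cos2Dsin2 phi.
apply/rowP => i; rewrite !mxE cosD sinD; case: ifP => _.
  transitivity (cos phi * (rho * cos th) - sin phi * (rho * sin th)); last by ring.
  rewrite pE qE.
  transitivity (r * cos phi + h * e1 * (cos phi ^+ 2 + sin phi ^+ 2)); last by ring.
  by rewrite cs; ring.
transitivity (sin phi * (rho * cos th) + cos phi * (rho * sin th)); last by ring.
rewrite pE qE.
transitivity (r * sin phi + h * e2 * (cos phi ^+ 2 + sin phi ^+ 2)); last by ring.
by rewrite cs; ring.
Qed.

Section Homogeneous.
Variables (u : 'rV[R]_2 -> 'cV[C]_l) (mu : C) (v : R -> 'cV[C]_l) (a b : R).
Hypothesis u_polar : forall r phi, 0 < r -> a < phi < b ->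
  u (polar r phi) = rpow r mu *: v phi.

(** Along the line through the point, log r and the angle are the real and imaginary
    parts of one complex logarithm, whose derivative is the direction in the rotated
    frame divided by r. *)
Lemma directional_derive (e1 e2 r phi : R) (w : 'cV[C]_l) (k : 'I_l) :
  0 < r -> a < phi < b -> mder v phi w ->
  let e : 'rV[R]_2 := \row_(i < 2) (if i == 0 then e1 else e2) in
  'D_e (fun y => Re (u y k 0)) (polar r phi) +i* 'D_e (fun y => Im (u y k 0)) (polar r phi) =
  rpow r (mu - 1) * (mu * (e1 * cos phi + e2 * sin phi)%:C * v phi k 0 +
     (- e1 * sin phi + e2 * cos phi)%:C * w k 0).
Proof.
move=> r0 ab dv e.
set et := e1 * cos phi + e2 * sin phi; set en := - e1 * sin phi + e2 * cos phi.
pose z h : C := (r + h * et) +i* (h * en).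
have dz : cder z 0 (et +i* en).
  split; first exact: is_derive_affine.
  have := is_derive_affine 0 en 0; apply: is_derive_fun => s.
  by rewrite add0r.
have z00 : z 0 = r%:C by rewrite /z !mul0r addr0.
have pos0 : 0 < Re (z 0) by rewrite z00.
have dH := cder_half_log pos0 dz.
have H0 : half_log (z 0) = (ln r)%:C.
  by rewrite z00 /half_log cnorm_real gtr0_norm // mul0r atan0.
pose g h : C := cexp (mu * (Re (half_log (z h)))%:C) * v (phi + Im (half_log (z h))) k 0.
have dg : cder g 0 (rpow r (mu - 1) * (mu * et%:C * v phi k 0 + en%:C * w k 0)).
  have [dR dI] := dH.
  have dphi : is_derive (0 : R) 1 (fun h => phi + Im (half_log (z h))) (Im ((et +i* en) / z 0)).
    have D := is_deriveD (is_derive_cst phi (0 : R) (1 : R)) dI.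
    by apply: is_derive_to (is_derive_fun _ D) => //; rewrite add0r.
  have dv0 : cder (fun t => v t k 0) (phi + Im (half_log (z 0))) (w k 0).
    by rewrite H0 addr0.
  have D1 := cder_cexp (cderMl mu (cder_real dR)).
  have D2 := @cder_comp R (fun t => v t k 0) (fun h => phi + Im (half_log (z h))) 0 _ _ dv0 dphi.
  apply: cder_eq (cderM D1 D2).
  have rr : r%:C != 0 :> C by rewrite eq_complex /= eqxx andbT gt_eqF.
  have zr : (et +i* en) / z 0 = (et / r) +i* (en / r).
    rewrite z00 -fmorphV; apply: cplx_eq; rewrite ?ReM ?ImM /=; ring.
  rewrite zr H0 /= addr0 -/(rpow r mu) !rmorphM /= fmorphV /=.
  have -> : rpow r mu = rpow r (mu - 1) * r%:C.
    rewrite /rpow mulrBl mul1r cexpD cexpN.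
    have -> : cexp (ln r)%:C = r%:C.
      by rewrite /cexp /= cos0 sin0 mulr0 mulr1 lnK.
    by rewrite mulfVK.
  by field.
have near_line : \forall h \near 0, g h = u (h *: e + polar r phi) k 0.
  have [_ [cI _]] := dH.
  have contI : {for 0, continuous (fun h => Im (half_log (z h)))}.
    by have [] := cder_continuous dH.
  have contR : {for 0, continuous (fun h => Re (z h))}.
    by have [] := cder_continuous dz.
  have I0 : Im (half_log (z 0)) = 0 by rewrite H0.
  case/andP: ab => a_phi phi_b.
  near=> h.
  have zh : 0 < Re (z h).
    by near: h; apply: (cvgr_gt _ contR); rewrite z00.
  rewrite (polar_line (e1 := e1) (e2 := e2) zh) u_polar ?expR_gt0 //.
    by rewrite mxE /rpow expRK.
  apply/andP; split; rewrite -/(z h).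
    by rewrite -ltrBlDl; near: h; apply: (cvgr_gt _ contI); rewrite I0 subr_lt0.
  by rewrite -ltrBrDl; near: h; apply: (cvgr_lt _ contI); rewrite I0 subr_gt0.
have [dR dI] := cder_near near_line dg.
by apply: cplx_eq => /=; apply: derive_line.
Unshelve. all: by end_near. Qed.

Lemma partial_deriv_polar (i : 'I_2) r phi (w : 'cV[C]_l) :
  0 < r -> a < phi < b -> mder v phi w ->
  partial_deriv i u (polar r phi) = rpow r (mu - 1) *:
    (if i == 0 then (mu * (cos phi)%:C) *: v phi - (sin phi)%:C *: w
     else (mu * (sin phi)%:C) *: v phi + (cos phi)%:C *: w).
Proof.
move=> r0 ab dv; apply/matrixP => k j; rewrite !ord1 [LHS]mxE [RHS]mxE.
have eE : delta_mx 0 i = \row_(j < 2) (if j == 0 then (i == 0)%:R else (i != 0)%:R) :> 'rV[R]_2.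
  apply/rowP => m; rewrite !mxE /=; case: i => -[|[|//]] ? ; case: m => -[|[|//]] ?;
    by rewrite /= ?mulr1n ?mulr0n.
rewrite eE (directional_derive _ _ k r0 ab dv); congr (_ * _).
case: ifP => _; rewrite !mxE /= ?mulr1n ?mulr0n; apply: cplx_eq;
  rewrite !(ReD, ImD, ReM, ImM, ReN, ImN) /=; ring.
Qed.

End Homogeneous.

Lemma smooth_on_derivs (a b : R) (v : R -> 'cV[C]_l) : smooth_on a b v ->
  exists v1 v2 : R -> 'cV[C]_l, forall t, a < t < b -> mder v t (v1 t) /\ mder v1 t (v2 t).
Proof.
move=> sv.
exists (fun t => \col_k (derive1n 1 (fun s => Re (v s k 0)) t +i*
                          derive1n 1 (fun s => Im (v s k 0)) t)).
exists (fun t => \col_k (derive1n 2 (fun s => Re (v s k 0)) t +i*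
                          derive1n 2 (fun s => Im (v s k 0)) t)).
move=> t tab; split=> k j; rewrite !ord1 !mxE.
  by have [dR dI] := sv k 0%N t tab; split; rewrite /= derive1E; apply: derivableP.
have [dR dI] := sv k 1%N t tab; split; rewrite /= derive1E.
  by apply: is_derive_fun (derivableP dR) => s; rewrite mxE.
by apply: is_derive_fun (derivableP dI) => s; rewrite mxE.
Qed.

End PolarCoordinates.

(** * The angular form of the model operator *)

Section ModelOperator.
Context {R : realType} {n : nat}.
Local Notation C := R[i].
Implicit Types (phi t : R) (mu lambda : C) (x y : 'cV[C]_n.+1) (V W : 'M[C]_n.+1).

(** For u = r^mu v, with x0 and x1 the values of v and v', these are the angular
    parts of the two partial derivatives of u, which are of degree mu - 1. *)
Definition dx1 mu phi x0 x1 : 'cV[C]_n.+1 := (mu * (cos phi)%:C) *: x0 - (sin phi)%:C *: x1.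
Definition dx2 mu phi x0 x1 : 'cV[C]_n.+1 := (mu * (sin phi)%:C) *: x0 + (cos phi)%:C *: x1.

(** Their derivatives with respect to the angle; x2 stands for v''. *)
Definition dx1' mu phi x0 x1 x2 : 'cV[C]_n.+1 :=
  ((mu - 1) * (cos phi)%:C) *: x1 - (mu * (sin phi)%:C) *: x0 - (sin phi)%:C *: x2.
Definition dx2' mu phi x0 x1 x2 : 'cV[C]_n.+1 :=
  ((mu - 1) * (sin phi)%:C) *: x1 + (mu * (cos phi)%:C) *: x0 + (cos phi)%:C *: x2.

(** Symmetry of the mixed second derivatives. *)
Lemma dx_mixed mu phi x0 x1 x2 :
  dx1 (mu - 1) phi (dx2 mu phi x0 x1) (dx2' mu phi x0 x1 x2) =
  dx2 (mu - 1) phi (dx1 mu phi x0 x1) (dx1' mu phi x0 x1 x2).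
Proof. by apply/matrixP => i j; rewrite !mxE; ring. Qed.

Lemma dx_first_order V mu phi x0 x1 :
  V *m dx1 mu phi x0 x1 - dx2 mu phi x0 x1 =
  mu *: (dpencil V phi *m x0) - pencil V phi *m x1.
Proof.
rewrite /dpencil /pencil !mulmxDl mulNmx !mul_scalar_mx -!scalemxAl mulmxBr -!scalemxAr.
move: (V *m x0) (V *m x1) => y0 y1.
by apply/matrixP => i j; rewrite !mxE; ring.
Qed.

Lemma dx1_lin V mu phi x0 x1 y0 y1 :
  dx1 mu phi (V *m x0 - y0) (V *m x1 - y1) = V *m dx1 mu phi x0 x1 - dx1 mu phi y0 y1.
Proof.
rewrite mulmxBr -!scalemxAr; move: (V *m x0) (V *m x1) => z0 z1.
by apply/matrixP => i j; rewrite !mxE; ring.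
Qed.

Lemma dx2_lin V mu phi x0 x1 y0 y1 :
  dx2 mu phi (V *m x0 - y0) (V *m x1 - y1) = V *m dx2 mu phi x0 x1 - dx2 mu phi y0 y1.
Proof.
rewrite mulmxDr -!scalemxAr; move: (V *m x0) (V *m x1) => z0 z1.
by apply/matrixP => i j; rewrite !mxE; ring.
Qed.

Variables (A11 A12 : 'M[C]_n.+1).

(** The angular parts of L_A u and of the conormal derivative. *)
Definition angular_L lambda phi x0 x1 x2 : 'cV[C]_n.+1 :=
  let w1 := dx1 lambda phi x0 x1 in let w1' := dx1' lambda phi x0 x1 x2 in
  let w2 := dx2 lambda phi x0 x1 in let w2' := dx2' lambda phi x0 x1 x2 in
  (A11 *m dx1 (lambda - 1) phi w1 w1' + A12 *m dx1 (lambda - 1) phi w2 w2') +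
  (A12 *m dx2 (lambda - 1) phi w1 w1' + dx2 (lambda - 1) phi w2 w2').

Definition angular_N lambda phi x0 x1 : 'cV[C]_n.+1 :=
  let w1 := dx1 lambda phi x0 x1 in let w2 := dx2 lambda phi x0 x1 in
  - (sin phi)%:C *: (A11 *m w1 + A12 *m w2) + (cos phi)%:C *: (A12 *m w1 + w2).

Lemma angular_LD lambda phi x0 x1 x2 y0 y1 y2 :
  angular_L lambda phi (x0 + y0) (x1 + y1) (x2 + y2) =
  angular_L lambda phi x0 x1 x2 + angular_L lambda phi y0 y1 y2.
Proof.
have dx1D mu a b c d : dx1 mu phi (a + c) (b + d) = dx1 mu phi a b + dx1 mu phi c d.
  by apply/matrixP => i j; rewrite !mxE; ring.
have dx2D mu a b c d : dx2 mu phi (a + c) (b + d) = dx2 mu phi a b + dx2 mu phi c d.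
  by apply/matrixP => i j; rewrite !mxE; ring.
have dx1'D mu a b c d e f : dx1' mu phi (a + d) (b + e) (c + f) =
    dx1' mu phi a b c + dx1' mu phi d e f.
  by apply/matrixP => i j; rewrite !mxE; ring.
have dx2'D mu a b c d e f : dx2' mu phi (a + d) (b + e) (c + f) =
    dx2' mu phi a b c + dx2' mu phi d e f.
  by apply/matrixP => i j; rewrite !mxE; ring.
rewrite /angular_L (dx1D lambda x0 x1 y0 y1) (dx2D lambda x0 x1 y0 y1).
rewrite (dx1'D lambda x0 x1 x2 y0 y1 y2) (dx2'D lambda x0 x1 x2 y0 y1 y2).
move: (dx1 _ _ x0 x1) (dx2 _ _ x0 x1) (dx1' _ _ x0 x1 x2) (dx2' _ _ x0 x1 x2) => a1 a2 a1' a2'.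
move: (dx1 _ _ y0 y1) (dx2 _ _ y0 y1) (dx1' _ _ y0 y1 y2) (dx2' _ _ y0 y1 y2) => b1 b2 b1' b2'.
rewrite !dx1D !dx2D.
move: (dx1 _ _ a1 a1') (dx1 _ _ a2 a2') (dx2 _ _ a1 a1') (dx2 _ _ a2 a2') => {}a1 {}a2 {}a1' {}a2'.
move: (dx1 _ _ b1 b1') (dx1 _ _ b2 b2') (dx2 _ _ b1 b1') (dx2 _ _ b2 b2') => {}b1 {}b2 {}b1' {}b2'.
by rewrite !mulmxDr [RHS]addrACA; congr (_ + _); rewrite addrACA.
Qed.

Lemma angular_ND lambda phi x0 x1 y0 y1 :
  angular_N lambda phi (x0 + y0) (x1 + y1) =
  angular_N lambda phi x0 x1 + angular_N lambda phi y0 y1.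
Proof.
have dx1D mu a b c d : dx1 mu phi (a + c) (b + d) = dx1 mu phi a b + dx1 mu phi c d.
  by apply/matrixP => i j; rewrite !mxE; ring.
have dx2D mu a b c d : dx2 mu phi (a + c) (b + d) = dx2 mu phi a b + dx2 mu phi c d.
  by apply/matrixP => i j; rewrite !mxE; ring.
rewrite /angular_N (dx1D lambda x0 x1 y0 y1) (dx2D lambda x0 x1 y0 y1).
move: (dx1 _ _ x0 x1) (dx2 _ _ x0 x1) (dx1 _ _ y0 y1) (dx2 _ _ y0 y1) => a1 a2 b1 b2.
rewrite !mulmxDr [RHS]addrACA -!scalerDr.
by congr (_ *: _ + _ *: _); rewrite addrACA.
Qed.

Section Factored.
Variables (V W : 'M[C]_n.+1).
Hypothesis A11E : A11 = W *m V.
Hypothesis A12E : 2%:R *: A12 = - (V + W).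

(** The quantity through which the operator factors: (V d1 - d2) u. *)
Definition flux lambda phi x0 x1 : 'cV[C]_n.+1 :=
  lambda *: (dpencil V phi *m x0) - pencil V phi *m x1.

Definition flux' lambda phi x0 x1 x2 : 'cV[C]_n.+1 :=
  V *m dx1' lambda phi x0 x1 x2 - dx2' lambda phi x0 x1 x2.

Lemma double_A12 (p : nat) (x : 'M[C]_(n.+1, p)) :
  A12 *m x + A12 *m x = - (V *m x) - W *m x.
Proof. by rewrite -mulr2n -scaler_nat scalemxAl A12E mulNmx mulmxDl opprD. Qed.

(** L = (W d1 - d2) (V d1 - d2), read on the angular parts. *)
Lemma angular_L_factor lambda phi x0 x1 x2 :
  angular_L lambda phi x0 x1 x2 =
  (lambda - 1) *: (dpencil W phi *m flux lambda phi x0 x1) -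
  pencil W phi *m flux' lambda phi x0 x1 x2.
Proof.
rewrite -dx_first_order /flux -dx_first_order /flux' dx1_lin dx2_lin.
rewrite /angular_L dx_mixed [W *m (V *m _ - _)]mulmxBr (mulmxA W V) -A11E.
move: (dx2 (lambda - 1) phi (dx2 _ _ _ _) _) => b22.
move: (dx2 (lambda - 1) phi (dx1 _ _ _ _) _) => b12.
move: (dx1 (lambda - 1) phi (dx1 _ _ _ _) _) => b11.
rewrite -addrA [A12 *m b12 + (_ + _)]addrA double_A12 opprB -[RHS]addrA.
by congr (_ + _); rewrite [LHS]addrC [RHS]addrC addrA.
Qed.

Lemma angular_N_flux0 lambda phi x0 x1 : flux lambda phi x0 x1 = 0 ->
  2%:R *: angular_N lambda phi x0 x1 = lambda *: ((V - W) *m x0).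
Proof.
rewrite /flux -dx_first_order => /eqP; rewrite subr_eq0 => /eqP VE.
rewrite /angular_N -VE.
have x0E : lambda *: x0 = pencil V phi *m dx1 lambda phi x0 x1.
  rewrite /pencil mulmxDl mul_scalar_mx -scalemxAl VE.
  apply/matrixP => i j; rewrite !mxE; have := cos2Dsin2 phi.
  move/(congr1 (real_complex R)); rewrite rmorphD !rmorphXn /= => cs.
  transitivity (lambda * ((cos phi)%:C ^+ 2 + (sin phi)%:C ^+ 2) * x0 i j); last by ring.
  by rewrite cs mulr1.
rewrite scalemxAr x0E; move: (dx1 lambda phi x0 x1) => w.
have -> : 2%:R *: (- (sin phi)%:C *: (A11 *m w + A12 *m (V *m w)) +
      (cos phi)%:C *: (A12 *m w + V *m w)) =
    - (sin phi)%:C *: (2%:R *: (A11 *m w) + (A12 *m (V *m w) + A12 *m (V *m w))) +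
      (cos phi)%:C *: ((A12 *m w + A12 *m w) + 2%:R *: (V *m w)).
  move: (A11 *m w) (A12 *m w) (A12 *m (V *m w)) (V *m w) => a1 a2 a3 a4.
  by apply/matrixP => i j; rewrite !mxE; ring.
have -> : pencil V phi *m w = (cos phi)%:C *: w + (sin phi)%:C *: (V *m w).
  by rewrite /pencil mulmxDl mul_scalar_mx -scalemxAl.
rewrite !double_A12 A11E mulmxBl !mulmxDr -!scalemxAr -!mulmxA.
move: (V *m w) (W *m w) (V *m (V *m w)) (W *m (V *m w)) => y1 y2 y3 y4.
by apply/matrixP => i j; rewrite !mxE; ring.
Qed.

End Factored.

Lemma mder_flux V lambda (v v1 v2 : R -> 'cV[C]_n.+1) phi :
  mder v phi (v1 phi) -> mder v1 phi (v2 phi) ->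
  mder (fun t => flux V lambda t (v t) (v1 t)) phi
       (flux' V lambda phi (v phi) (v1 phi) (v2 phi)).
Proof.
move=> dv dv1.
have c1 : cder (fun t => lambda * (cos t)%:C) phi (lambda * - (sin phi)%:C).
  by apply: cderMl; apply: cder_cos.
have c2 : cder (fun t => lambda * (sin t)%:C) phi (lambda * (cos phi)%:C).
  by apply: cderMl; apply: cder_sin.
have d1 : mder (fun t => dx1 lambda t (v t) (v1 t)) phi
    (dx1' lambda phi (v phi) (v1 phi) (v2 phi)).
  have D := mderD (mderZ c1 dv) (mderZ (cderN (cder_sin phi)) dv1).
  apply: mder_eq (mder_ext _ D) => [|t]; last by rewrite /dx1 scaleNr.
  by apply/matrixP => i j; rewrite !mxE; ring.
have d2 : mder (fun t => dx2 lambda t (v t) (v1 t)) phi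
    (dx2' lambda phi (v phi) (v1 phi) (v2 phi)).
  have D := mderD (mderZ c2 dv) (mderZ (cder_cos phi) dv1).
  apply: mder_eq (mder_ext _ D) => [|t]; last by [].
  by apply/matrixP => i j; rewrite !mxE; ring.
have D := mderD (mderMl V d1) (mderZ (cder_cst (- 1) phi) d2).
apply: mder_eq (mder_ext _ D) => [|t].
  by rewrite /flux' scale0r add0r scaleN1r.
by rewrite /flux -dx_first_order scaleN1r.
Qed.

(** A power family solves the first-order system, hence the whole equation. *)
Lemma family_solution V W G lambda (c : 'cV[C]_n.+1) :
  A11 = W *m V -> 2%:R *: A12 = - (V + W) -> power_family V G ->
  exists v1 v2 : R -> 'cV[C]_n.+1, forall t,
    [/\ mder (fun s => G lambda s *m c) t (v1 t), mder v1 t (v2 t),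
        flux V lambda t (G lambda t *m c) (v1 t) = 0 &
        angular_L lambda t (G lambda t *m c) (v1 t) (v2 t) = 0].
Proof.
move=> A11E A12E VG.
pose v1 t := lambda *: (dpencil V t *m G (lambda - 1) t) *m c.
have dd t : mder (dpencil V) t (- pencil V t).
  have D := mderD (mderZr (1%:M : 'M[C]_n.+1) (cderN (cder_sin t))) (mderZr V (cder_cos t)).
  apply: mder_eq (mder_ext _ D) => [|s].
    by rewrite /pencil scalemx1 opprD scaleNr raddfN.
  by rewrite /dpencil scalemx1 raddfN.
have [v2 dv1] : exists v2 : R -> 'cV[C]_n.+1, forall t, mder v1 t (v2 t).
  pose v2 t := lambda *: (- pencil V t *m G (lambda - 1) t +
    dpencil V t *m ((lambda - 1) *: (dpencil V t *m G (lambda - 1 - 1) t))) *m c.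
  exists v2 => t; apply: mderMr.
  have D := mderZ (cder_cst lambda t) (mderM (dd t) (mder_family VG (lambda - 1) t)).
  by apply: mder_eq D; rewrite scale0r add0r.
exists v1, v2.
have dv t : mder (fun s => G lambda s *m c) t (v1 t).
  by apply: mderMr; apply: (mder_family VG).
have flux0 t : flux V lambda t (G lambda t *m c) (v1 t) = 0.
  rewrite /flux /v1 -scalemxAl -scalemxAr -scalerBr !mulmxA.
  have -> : pencil V t *m dpencil V t = dpencil V t *m pencil V t.
    by apply: comm_pencil; apply: comm_mx_sym; apply: comm_dpencil; apply: comm_mx_refl.
  by rewrite -[dpencil V t *m pencil V t *m _]mulmxA (familyT VG) subrr scaler0.
move=> t; split=> //.
rewrite (angular_L_factor A11E A12E) flux0 mulmx0 scaler0 sub0r.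
have -> : flux' V lambda t (G lambda t *m c) (v1 t) (v2 t) = 0.
  apply: mder_uniq (mder_flux V lambda (dv t) (dv1 t)) _.
  have -> : (fun s => flux V lambda s (G lambda s *m c) (v1 s)) = (fun=> 0).
    by apply/funext => s.
  exact: mder_cst.
by rewrite mulmx0 oppr0.
Qed.

End ModelOperator.

Section PolarOperators.
Context {R : realType} {n : nat}.
Local Notation C := R[i].
Variables (A11 A12 : 'M[R]_n.+1) (u : 'rV[R]_2 -> 'cV[C]_n.+1) (lambda : C).
Variables (v v1 v2 : R -> 'cV[C]_n.+1) (a b : R).
Hypothesis u_polar : forall r phi, 0 < r -> a < phi < b ->
  u (polar r phi) = rpow r lambda *: v phi.
Hypothesis dv : forall t, a < t < b -> mder v t (v1 t) /\ mder v1 t (v2 t).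

Lemma partial0_polar r phi : 0 < r -> a < phi < b ->
  partial_deriv 0 u (polar r phi) = rpow r (lambda - 1) *: dx1 lambda phi (v phi) (v1 phi).
Proof.
by move=> r0 ab; rewrite (partial_deriv_polar u_polar 0 r0 ab (dv ab).1).
Qed.

Lemma partial1_polar r phi : 0 < r -> a < phi < b ->
  partial_deriv 1 u (polar r phi) = rpow r (lambda - 1) *: dx2 lambda phi (v phi) (v1 phi).
Proof.
by move=> r0 ab; rewrite (partial_deriv_polar u_polar 1 r0 ab (dv ab).1).
Qed.

Lemma mder_dx1 phi : a < phi < b -> mder (fun t => dx1 lambda t (v t) (v1 t)) phi
    (dx1' lambda phi (v phi) (v1 phi) (v2 phi)).
Proof.
move=> /dv[D0 D1].
have c1 : cder (fun t => lambda * (cos t)%:C) phi (lambda * - (sin phi)%:C).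
  by apply: cderMl; apply: cder_cos.
have D := mderD (mderZ c1 D0) (mderZ (cderN (cder_sin phi)) D1).
apply: mder_eq (mder_ext _ D) => [|t]; last by rewrite /dx1 scaleNr.
by apply/matrixP => i j; rewrite !mxE; ring.
Qed.

Lemma mder_dx2 phi : a < phi < b -> mder (fun t => dx2 lambda t (v t) (v1 t)) phi
    (dx2' lambda phi (v phi) (v1 phi) (v2 phi)).
Proof.
move=> /dv[D0 D1].
have c2 : cder (fun t => lambda * (sin t)%:C) phi (lambda * (cos phi)%:C).
  by apply: cderMl; apply: cder_sin.
have D := mderD (mderZ c2 D0) (mderZ (cder_cos phi) D1).
apply: mder_eq (mder_ext _ D) => [|t]; last by [].
by apply/matrixP => i j; rewrite !mxE; ring.
Qed.

Lemma sum_ord2 (F : 'I_2 -> 'cV[C]_n.+1) : \sum_(i < 2) F i = F 0 + F 1.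
Proof. by rewrite big_ord_recl big_ord1; congr (_ + F _); apply/val_inj. Qed.

Lemma L_opE x : L_op A11 A12 u x =
  (cmx A11 *m partial_deriv 0 (partial_deriv 0 u) x +
   cmx A12 *m partial_deriv 0 (partial_deriv 1 u) x) +
  (cmx A12 *m partial_deriv 1 (partial_deriv 0 u) x +
   cmx 1%:M *m partial_deriv 1 (partial_deriv 1 u) x).
Proof. by rewrite /L_op sum_ord2; congr (_ + _); exact: sum_ord2. Qed.

Lemma conormalE phi x : conormal A11 A12 phi u x =
  ((- sin phi)%:C *: (cmx A11 *m partial_deriv 0 u x) +
   (- sin phi)%:C *: (cmx A12 *m partial_deriv 1 u x)) +
  ((cos phi)%:C *: (cmx A12 *m partial_deriv 0 u x) +
   (cos phi)%:C *: (cmx 1%:M *m partial_deriv 1 u x)).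
Proof. by rewrite /conormal sum_ord2; congr (_ + _); exact: sum_ord2. Qed.

Lemma L_op_polar r phi : 0 < r -> a < phi < b ->
  L_op A11 A12 u (polar r phi) = rpow r (lambda - 1 - 1) *:
    angular_L (cmx A11) (cmx A12) lambda phi (v phi) (v1 phi) (v2 phi).
Proof.
move=> r0 ab; rewrite L_opE.
have := partial_deriv_polar partial0_polar 0 r0 ab (mder_dx1 ab).
have := partial_deriv_polar partial0_polar 1 r0 ab (mder_dx1 ab).
have := partial_deriv_polar partial1_polar 0 r0 ab (mder_dx2 ab).
have := partial_deriv_polar partial1_polar 1 r0 ab (mder_dx2 ab).
move: (partial_deriv 0 (partial_deriv 0 u) _) (partial_deriv 1 (partial_deriv 0 u) _).
move: (partial_deriv 0 (partial_deriv 1 u) _) (partial_deriv 1 (partial_deriv 1 u) _).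
move=> p01 p11 p00 p10 -> -> -> ->.
by rewrite -!scalemxAr cmx_scalar mul1mx -!scalerDr.
Qed.

Lemma conormal_polar r phi : 0 < r -> a < phi < b ->
  conormal A11 A12 phi u (polar r phi) = rpow r (lambda - 1) *:
    angular_N (cmx A11) (cmx A12) lambda phi (v phi) (v1 phi).
Proof.
move=> r0 ab; rewrite conormalE cmx_scalar mul1mx.
have := partial0_polar r0 ab; have := partial1_polar r0 ab.
move: (partial_deriv 0 u _) (partial_deriv 1 u _) => p0 p1 -> ->.
rewrite /angular_N rmorphN /=.
move: (dx1 _ _ _ _) (dx2 _ _ _ _) => w1 w2.
rewrite -!scalemxAr; move: (cmx A11 *m w1) (cmx A12 *m w1) (cmx A12 *m w2) => y1 y2 y3.
by apply/matrixP => i j; rewrite !mxE; ring.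
Qed.

End PolarOperators.

(** * Solutions of the model problem and the characteristic matrix *)

Section Solutions.
Context {R : realType} {n : nat}.
Local Notation C := R[i].
Local Notation ii := (Complex (0 : R) 1).
Variables (V : 'M[C]_n.+1) (A11 A12 : 'M[R]_n.+1) (G : C -> R -> 'M[C]_n.+1).
Variables (lambda : C) (alpha : R).
Hypothesis V_root : standard_root A11 A12 V.
Hypothesis VG : power_family V G.
Hypothesis lambda0 : lambda != 0.
Hypothesis alpha_gt0 : 0 < alpha.
Let W := adjm V.
Let Vb := conj_mx V.
Let Wb := conj_mx W.
Let Gb mu phi := conj_mx (G (conjc mu) phi).
Let VbGb : power_family Vb Gb := power_family_conj VG.
Let WGW : power_family W (fun mu phi => adjm (G (conjc mu) phi)) := power_family_adj VG.

Lemma root_mul_conj : cmx A11 = Wb *m Vb.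
Proof. by rewrite -(conj_cmx A11) (root_mul V_root) /conj_mx map_mxM. Qed.

Lemma root_add_conj : 2%:R *: cmx A12 = - (Vb + Wb).
Proof.
have := congr1 (@conj_mx R n.+1) (root_add V_root).
rewrite /conj_mx map_conjZ map_mxN map_mxD conjc_nat.
by rewrite -[X in _ *: X]/(conj_mx (cmx A12)) conj_cmx.
Qed.

(** V - Vbar = 2 i D. *)
Lemma root_sub_conj_unit : V - Vb \in unitmx.
Proof.
have -> : V - Vb = (2%:R * ii) *: cmx (rootD V).
  apply/matrixP => i j; rewrite !mxE; case: (V i j) => x y /=.
  by apply: cplx_eq => /=; ring.
rewrite unitmxZ ?cmx_unit ?(rootD_unit V_root) // unitfE mulf_neq0 ?pnatr_eq0 //.
by rewrite eq_complex /= eqxx oner_eq0.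
Qed.

(** The flux of a solution solves a first-order equation, with the root V^* in
    place of V and one degree less. *)
Lemma flux_solution (v v1 v2 : R -> 'cV[C]_n.+1) :
  (forall t, 0 <= t <= alpha -> mder v t (v1 t) /\ mder v1 t (v2 t)) ->
  (forall t, 0 <= t <= alpha ->
     angular_L (cmx A11) (cmx A12) lambda t (v t) (v1 t) (v2 t) = 0) ->
  forall t, 0 <= t <= alpha -> flux V lambda t (v t) (v1 t) =
    adjm (G (conjc (lambda - 1)) t) *m flux V lambda 0 (v 0) (v1 0).
Proof.
move=> dv Lv.
apply: (family_unique (v := fun t => flux V lambda t (v t) (v1 t))
  (v1 := fun t => flux' V lambda t (v t) (v1 t) (v2 t)) WGW) => t ta.
  by have [D0 D1] := dv t ta; apply: mder_flux.
have := Lv t ta; rewrite (angular_L_factor (root_mul V_root) (root_add V_root)).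
by move/eqP; rewrite subr_eq0 => /eqP.
Qed.

Lemma flux0E (x x1 : 'cV[C]_n.+1) X : flux X lambda 0 x x1 = lambda *: (X *m x) - x1.
Proof.
rewrite /flux /dpencil /pencil cos0 sin0 !scale1r scale0r addr0 mul1mx.
have -> : (0 : R)%:C%:M = 0 :> 'M[C]_n.+1 by apply: (raddf0 (@scalar_mx C n.+1)).
by rewrite oppr0 add0r.
Qed.

Lemma fluxB X phi (x x1 y y1 : 'cV[C]_n.+1) :
  flux X lambda phi (x - y) (x1 - y1) = flux X lambda phi x x1 - flux X lambda phi y y1.
Proof.
have lin (P T : 'M[C]_n.+1) : lambda *: (P *m (x - y)) - T *m (x1 - y1) =
    (lambda *: (P *m x) - T *m x1) - (lambda *: (P *m y) - T *m y1).
  by rewrite !mulmxBr scalerBr !opprD !opprK addrACA.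
exact: lin.
Qed.

Lemma conj_flux (c : 'cV[C]_n.+1) (v1 v2 : R -> 'cV[C]_n.+1) :
  (forall t, [/\ mder (fun s => Gb lambda s *m c) t (v1 t), mder v1 t (v2 t),
        flux Vb lambda t (Gb lambda t *m c) (v1 t) = 0 &
        angular_L (cmx A11) (cmx A12) lambda t (Gb lambda t *m c) (v1 t) (v2 t) = 0]) ->
  forall t, 0 <= t <= alpha -> flux V lambda t (Gb lambda t *m c) (v1 t) =
    adjm (G (conjc (lambda - 1)) t) *m (lambda *: ((V - Vb) *m c)).
Proof.
move=> H t ta; have [_ _ f0 _] := H 0.
have -> : lambda *: ((V - Vb) *m c) = flux V lambda 0 (Gb lambda 0 *m c) (v1 0).
  move: f0; rewrite !flux0E (family0 VbGb) mul1mx => /eqP; rewrite subr_eq0 => /eqP <-.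
  by rewrite mulmxBl scalerBr.
apply: (flux_solution (v := fun t => Gb lambda t *m c) (v1 := v1) (v2 := v2)) => // s _.
  by have [] := H s.
by have [] := H s.
Qed.

(** The conjugate powers of a suitable c' have the same flux at the angle 0, hence
    everywhere. The difference has no flux, which is the first-order system solved by
    the powers of T. *)
Lemma solution_form (v v1 v2 : R -> 'cV[C]_n.+1) :
  (forall t, 0 <= t <= alpha -> mder v t (v1 t) /\ mder v1 t (v2 t)) ->
  (forall t, 0 <= t <= alpha ->
     angular_L (cmx A11) (cmx A12) lambda t (v t) (v1 t) (v2 t) = 0) ->
  exists c c' : 'cV[C]_n.+1, forall t, 0 <= t <= alpha ->
    v t = G lambda t *m c + Gb lambda t *m c' /\
    2%:R *: angular_N (cmx A11) (cmx A12) lambda t (v t) (v1 t) =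
    lambda *: ((V - W) *m (G lambda t *m c) + (Vb - Wb) *m (Gb lambda t *m c')).
Proof.
move=> dv Lv; have fluxv := flux_solution dv Lv.
pose c' := lambda^-1 *: (invmx (V - Vb) *m flux V lambda 0 (v 0) (v1 0)).
have c'E : lambda *: ((V - Vb) *m c') = flux V lambda 0 (v 0) (v1 0).
  by rewrite -scalemxAr mulKVmx ?root_sub_conj_unit // scalerA mulfV // scale1r.
have [w1 [w2 Hw]] := family_solution lambda c' root_mul_conj root_add_conj VbGb.
have fluxw := conj_flux Hw.
have flux_diff t : 0 <= t <= alpha -> flux V lambda t (v t - Gb lambda t *m c') (v1 t - w1 t) = 0.
  by move=> ta; rewrite fluxB fluxv // fluxw // c'E subrr.
have vE t : 0 <= t <= alpha -> v t - Gb lambda t *m c' = G lambda t *m (v 0 - c').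
  have -> : v 0 - c' = v 0 - Gb lambda 0 *m c' by rewrite (family0 VbGb) mul1mx.
  apply: (family_unique (v := fun t => v t - Gb lambda t *m c')
    (v1 := fun t => v1 t - w1 t) VG) => s sa.
    have [D _] := dv s sa; have [D' _ _ _] := Hw s.
    have DD := mderD D (mderZ (cder_cst (- 1) s) D').
    apply: mder_eq (mder_ext _ DD) => [|x].
      by rewrite scale0r add0r scaleN1r.
    by rewrite scaleN1r.
  by have := flux_diff s sa; rewrite /flux => /eqP; rewrite subr_eq0 => /eqP.
exists (v 0 - c'), c' => t ta; split; first by rewrite -vE // subrK.
have -> : angular_N (cmx A11) (cmx A12) lambda t (v t) (v1 t) =
    angular_N (cmx A11) (cmx A12) lambda t (v t - Gb lambda t *m c') (v1 t - w1 t) +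
    angular_N (cmx A11) (cmx A12) lambda t (Gb lambda t *m c') (w1 t).
  by rewrite -angular_ND !subrK.
rewrite scalerDr (angular_N_flux0 (root_mul V_root) (root_add V_root) (flux_diff t ta)).
have [_ _ fb _] := Hw t.
by rewrite (angular_N_flux0 root_mul_conj root_add_conj fb) -scalerDr vE.
Qed.

(** Each family of powers is treated with its own factorisation of the operator. *)
Lemma form_solution (c c' : 'cV[C]_n.+1) :
  exists v1 v2 : R -> 'cV[C]_n.+1, forall t,
    [/\ mder (fun s => G lambda s *m c + Gb lambda s *m c') t (v1 t), mder v1 t (v2 t),
        angular_L (cmx A11) (cmx A12) lambda t
          (G lambda t *m c + Gb lambda t *m c') (v1 t) (v2 t) = 0 &
        2%:R *: angular_N (cmx A11) (cmx A12) lambda t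
          (G lambda t *m c + Gb lambda t *m c') (v1 t) =
        lambda *: ((V - W) *m (G lambda t *m c) + (Vb - Wb) *m (Gb lambda t *m c'))].
Proof.
have [v1 [v2 Hv]] := family_solution lambda c (root_mul V_root) (root_add V_root) VG.
have [w1 [w2 Hw]] := family_solution lambda c' root_mul_conj root_add_conj VbGb.
exists (fun t => v1 t + w1 t), (fun t => v2 t + w2 t) => t.
have [D0 D1 f0 L0] := Hv t; have [D0' D1' f0' L0'] := Hw t.
split; [exact: mderD | exact: mderD | by rewrite angular_LD L0 L0' addr0 |].
rewrite angular_ND scalerDr (angular_N_flux0 (root_mul V_root) (root_add V_root) f0).
by rewrite (angular_N_flux0 root_mul_conj root_add_conj f0') -scalerDr.
Qed.

(** At an interior angle both v and v' vanish, and with them the flux; but the flux is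
    that of the conjugate powers, which starts from lambda (V - Vbar) c'. *)
Lemma form_injective (c c' : 'cV[C]_n.+1) :
  (forall t, 0 <= t <= alpha -> G lambda t *m c + Gb lambda t *m c' = 0) ->
  c = 0 /\ c' = 0.
Proof.
move=> v0.
have [v1 [v2 Hv]] := family_solution lambda c (root_mul V_root) (root_add V_root) VG.
have [w1 [w2 Hw]] := family_solution lambda c' root_mul_conj root_add_conj VbGb.
pose s := alpha / 2%:R; have s_itv : 0 < s < alpha.
  by rewrite /s divr_gt0 //= ltr_pdivrMr // ltr_pMr // ltr1n.
have sa : 0 <= s <= alpha by case/andP: s_itv => /ltW -> /ltW ->.
have [D _ f0 _] := Hv s; have [D' _ _ _] := Hw s.
have d0 : v1 s + w1 s = 0.
  apply: mder_uniq (mderD D D') _ => i j; rewrite mxE.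
  apply: cder_near (cder_cst 0 s); case/andP: s_itv => s0 s1.
  near=> t; rewrite v0 ?mxE //; apply/andP; split; apply: ltW; near: t.
    exact: lt_nbhsr.
  exact: lt_nbhsl.
have c'0 : c' = 0.
  have : flux V lambda s (Gb lambda s *m c') (w1 s) = 0.
    have -> : Gb lambda s *m c' = - (G lambda s *m c).
      by apply/eqP; rewrite -addr_eq0 addrC v0.
    have -> : w1 s = - v1 s by apply/eqP; rewrite -addr_eq0 addrC d0.
    by have := fluxB V s 0 0 (G lambda s *m c) (v1 s);
       rewrite !sub0r f0 subr0 => ->; rewrite /flux !mulmx0 scaler0 subr0.
  rewrite (conj_flux Hw sa) => /(congr1 (mulmx (adjm (G (conjc (- (lambda - 1))) s)))).
  rewrite mulmx0 mulmxA.
  have -> : adjm (G (conjc (- (lambda - 1))) s) *m adjm (G (conjc (lambda - 1)) s) = 1%:M.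
    by have := family_inv WGW (- (lambda - 1)) s; rewrite opprK.
  rewrite mul1mx => /eqP; rewrite scaler_eq0 (negbTE lambda0) /= => /eqP H.
  by rewrite -[c'](mulKmx root_sub_conj_unit) H mulmx0.
split=> //; have := v0 0; rewrite lexx ltW // => /(_ isT).
by rewrite c'0 mulmx0 addr0 (family0 VG) mul1mx.
Unshelve. all: by end_near. Qed.

End Solutions.

(** Linear algebra of the two boundary conditions: eliminate c' with the first. *)
Lemma boundary_system (F : fieldType) n (A B S T : 'M[F]_n) :
  A \in unitmx -> B \in unitmx ->
  (\det (A *m S *m invmx A - B *m T *m invmx B) == 0) <->
  (exists c c' : 'cV[F]_n, [/\ (c != 0) || (c' != 0), A *m c + B *m c' = 0 &
     A *m (S *m c) + B *m (T *m c') = 0]).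
Proof.
move=> Au Bu; split.
  rewrite -det_tr => /det0P[x x0 /(congr1 trmx)]; rewrite trmx_mul trmxK trmx0 => Mx.
  exists (invmx A *m x^T), (- (invmx B *m x^T)); split.
  - rewrite -negb_and; apply: contra x0 => /andP[/eqP cx _].
    by rewrite -(inj_eq trmx_inj) trmx0 -[x^T](mulKVmx Au) cx mulmx0.
  - by rewrite mulmxN !mulKVmx // subrr.
  - by rewrite !mulmxN !mulmxA -mulmxBl.
case=> c [c' [cc' E0 E1]]; rewrite -det_tr; apply/det0P.
have BE : B *m c' = - (A *m c) by apply/eqP; rewrite -addr_eq0 addrC E0.
have c'E : c' = - (invmx B *m (A *m c)) by rewrite -mulmxN -BE mulKmx.
exists (A *m c)^T.
  rewrite trmx_eq0; apply: contraL cc' => /eqP Ac; rewrite negb_or !negbK.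
  by rewrite c'E Ac mulmx0 oppr0 eqxx andbT -[c](mulKmx Au) Ac mulmx0.
rewrite -trmx_mul mulmxBl -[_ *m invmx A *m _]mulmxA mulKmx //.
have := E1; rewrite c'E !mulmxN !mulmxA => ->.
by rewrite trmx0.
Qed.

Lemma conjugation_scaled (F : fieldType) n (Q H X : 'M[F]_n) (k : F) :
  k != 0 -> Q \in unitmx -> H \in unitmx ->
  k *: (invmx Q *m H *m invmx Q) *m (Q *m X *m invmx Q) *m
    invmx (k *: (invmx Q *m H *m invmx Q)) = invmx Q *m (H *m X *m invmx H) *m Q.
Proof.
move=> k0 Qu Hu.
have -> : invmx (k *: (invmx Q *m H *m invmx Q)) = k^-1 *: (Q *m invmx H *m Q).
  apply: invmx_uniq; rewrite -scalemxAl -scalemxAr scalerA mulfV // scale1r.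
  by rewrite !mulmxA mulmxKV // mulmxK // mulVmx.
rewrite -!scalemxAl -scalemxAr scalerA mulfV // scale1r.
by rewrite !mulmxA mulmxKV // mulmxKV.
Qed.

(** The characteristic matrix is conjugate, by D^(1/2), to the matrix of the
    boundary system. *)
Section Characteristic.
Context {R : realType} {n : nat}.
Local Notation C := R[i].
Variables (V : 'M[C]_n.+1) (A11 A12 : 'M[R]_n.+1).
Hypothesis V_root : standard_root A11 A12 V.
Hypothesis V_wp : neumann_well_posed V.
Let F := V - adjm V.
Let Q := cmx (sqrt_mx (rootD V)).

Lemma conj_mxK_Q : conj_mx Q = Q.
Proof. exact: conj_cmx. Qed.

Lemma Emx_root : Emx V = 2%:R^-1 *: (invmx Q *m F *m invmx Q).
Proof.
rewrite /F -(Emx_conjugate V_root) -scalemxAr -scalemxAl scalerA mulVf ?pnatr_eq0 //.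
have Qu := sqrtD_unit V_root; rewrite -/Q scale1r -!mulmxA mulKmx //.
by rewrite mulmxV // mulmx1.
Qed.

Lemma conj_mx_unit (A : 'M[C]_n.+1) : (conj_mx A \in unitmx) = (A \in unitmx).
Proof. exact: map_unitmx. Qed.

Lemma conj_mxV (A : 'M[C]_n.+1) : conj_mx (invmx A) = invmx (conj_mx A).
Proof. exact: map_invmx. Qed.

Lemma conj_mxM (A B : 'M[C]_n.+1) : conj_mx (A *m B) = conj_mx A *m conj_mx B.
Proof. exact: map_mxM. Qed.

Lemma Mmx_eigen (G : C -> R -> 'M[C]_n.+1) lambda alpha :
  holo_calculus (cpow_plus lambda) (Zmx V alpha) = Q *m G lambda alpha *m invmx Q ->
  holo_calculus (cpow_minus lambda) (conj_mx (Zmx V alpha)) =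
    conj_mx (Q *m G (conjc lambda) alpha *m invmx Q) ->
  eigenvalue (Mmx V lambda alpha) 0 =
  (\det (F *m G lambda alpha *m invmx F -
    conj_mx F *m conj_mx (G (conjc lambda) alpha) *m invmx (conj_mx F)) == 0).
Proof.
move=> hp hm; have Fu : F \in unitmx := neumann_unit V_root V_wp.
have Fbu : conj_mx F \in unitmx by rewrite conj_mx_unit.
have Qu : Q \in unitmx := sqrtD_unit V_root.
have EbE : conj_mx (Emx V) = 2%:R^-1 *: (invmx Q *m conj_mx F *m invmx Q).
  rewrite Emx_root /conj_mx map_conjZ -/(conj_mx _) !conj_mxM conj_mxV conj_mxK_Q.
  by rewrite conjc_inv conjc_nat.
have QQ := conj_mxK_Q.
have [k [k0 EE EbkE]] : exists k : C, [/\ k != 0,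
    Emx V = k *: (invmx Q *m F *m invmx Q) &
    conj_mx (Emx V) = k *: (invmx Q *m conj_mx F *m invmx Q)].
  by exists 2%:R^-1; split; rewrite ?invr_eq0 ?pnatr_eq0 //; exact: Emx_root.
clear EbE; clearbody Q F.
rewrite /Mmx hp hm !conj_mxM conj_mxV QQ EbkE EE.
move: (conj_mx F) Fbu => Fb Fbu.
rewrite (conjugation_scaled _ k0 Qu Fu) (conjugation_scaled _ k0 Qu Fbu).
rewrite -mulmxBl -mulmxBr eigenvalue_det raddf0 subr0 !det_mulmx.
have dQ : (\det Q == 0) = false by move: Qu; rewrite unitmxE unitfE => /negbTE.
by rewrite !mulf_eq0 det_inv invr_eq0 dQ /= orbF.
Qed.

End Characteristic.

(** * The characteristic equation *)

Section PolarExtension.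
Context {R : realType}.
Local Notation C := R[i].

(** The double angle formula, as sin (d / 2) > 0. *)
Lemma cos_lt1 (d : R) : 0 < d < 2%:R * pi -> cos d < 1.
Proof.
move=> /andP[d0 d2]; have s0 : 0 < sin (d / 2%:R).
  by apply: sin_gt0_pi; apply/andP; split; lra.
have -> : d = d / 2%:R + d / 2%:R by lra.
rewrite cosD; have := cos2Dsin2 (d / 2%:R).
move: (sin _) (cos _) s0 => x y x0; rewrite !expr2 => xy; nra.
Qed.

Lemma angle_inj (a b phi psi : R) : b - a <= 2%:R * pi ->
  a < phi < b -> a < psi < b -> cos phi = cos psi -> sin phi = sin psi -> phi = psi.
Proof.
move=> ab; wlog le : phi psi / phi <= psi.
  move=> H p1 p2 c s; have [le|/ltW le] := leP phi psi; first exact: H.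
  by apply/esym/H.
move=> /andP[p1 p2] /andP[q1 q2] c s; apply/eqP; rewrite eq_le le /= leNgt.
apply/negP => lt; have : cos (psi - phi) < 1.
  by apply: cos_lt1; apply/andP; split; lra.
by rewrite cosB c s -!expr2 cos2Dsin2 ltxx.
Qed.

Lemma polar_inj (a b r s phi psi : R) : b - a <= 2%:R * pi -> 0 < r -> 0 < s ->
  a < phi < b -> a < psi < b -> polar r phi = polar s psi -> r = s /\ phi = psi.
Proof.
move=> ab r0 s0 p q E.
have E0 : r * cos phi = s * cos psi by have /matrixP /(_ 0 0) := E; rewrite !mxE.
have E1 : r * sin phi = s * sin psi by have /matrixP /(_ 0 1) := E; rewrite !mxE.
have rs : r = s.
  apply/eqP; rewrite -(eqrXn2 (ltn0Sn 1) (ltW r0) (ltW s0)); apply/eqP.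
  rewrite -[LHS]mulr1 -[RHS]mulr1 -{1}(cos2Dsin2 phi) -(cos2Dsin2 psi).
  by rewrite !mulrDr -!exprMn E0 E1.
split=> //; move: E0 E1; rewrite rs => /(mulfI (lt0r_neq0 s0)) c /(mulfI (lt0r_neq0 s0)) d.
exact: angle_inj ab p q c d.
Qed.

(** On a sector of opening at most 2 pi the polar coordinates are unique. *)
Lemma polar_extension l (v : R -> 'cV[C]_l) (lambda : C) (a b : R) : b - a <= 2%:R * pi ->
  exists u : 'rV[R]_2 -> 'cV[C]_l, forall r phi, 0 < r -> a < phi < b ->
    u (polar r phi) = rpow r lambda *: v phi.
Proof.
move=> ab; pose good y : set (R * R) :=
  [set p | [/\ 0 < p.1, a < p.2 < b & polar p.1 p.2 = y]]%classic.
exists (fun y => rpow (xget (0, 0) (good y)).1 lambda *: v (xget (0, 0) (good y)).2).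
move=> r phi r0 p; have : good (polar r phi) (xget (0, 0) (good (polar r phi))).
  by apply: (@xgetPex _ (0, 0)); exists (r, phi).
case: (xget _ _) => s psi [/= s0 q E].
by have [-> ->] := polar_inj ab s0 r0 q p E.
Qed.

Lemma root_powers n (V : 'M[C]_n.+1) : (forall z, eigenvalue V z -> 0 < complex.Im z) ->
  exists G : C -> R -> 'M[C]_n.+1,
    [/\ power_family V G, forall mu i j, angular (fun t => G mu t i j) &
        forall (Q : 'M[C]_n.+1) (alpha : R) mu, Q \in unitmx -> 0 < alpha -> alpha < 2%:R * pi ->
          holo_calculus (cpow_plus mu) (Q *m pencil V alpha *m invmx Q) =
            Q *m G mu alpha *m invmx Q /\
          holo_calculus (cpow_minus mu) (conj_mx (Q *m pencil V alpha *m invmx Q)) =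
            conj_mx (Q *m G (conjc mu) alpha *m invmx Q)].
Proof.
move=> Vpos; have [s [q [s_eigen q1 qn]]] := spectral_partition V.
exists (matrix_power V s q); split.
- split=> [mu|mu phi|mu phi|mu phi].
  + exact: matrix_power0.
  + exact: pencil_power.
  + exact: mder_matrix_power.
  + exact: matrix_power_comm.
- by move=> mu i j; apply: angular_power.
- move=> Q alpha mu Qu a0 a2; split; first exact: holo_plus.
  exact: holo_minus.
Qed.

End PolarExtension.

Theorem proposition5p4 (R : realType) (l : nat) (alpha : R)
    (A11 A12 : 'M[R]_l) (V : 'M[R[i]]_l) (lambda : R[i]) :
  0 < alpha -> alpha < 2%:R * pi ->
  monic_elliptic A11 A12 ->
  standard_root A11 A12 V ->
  neumann_well_posed V ->
  lambda != 0 ->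
  (exists v : R -> 'cV[R[i]]_l,
     neumann_solution A11 A12 alpha lambda v /\
     exists phi : R, 0 <= phi <= alpha /\ v phi != 0) <->
  eigenvalue (Mmx V lambda alpha) 0.
Proof.
case: l A11 A12 V => [|n] A11 A12 V a0 a2 _ V_root V_wp lambda0.
  (* In dimension 0 both sides are false. *)
  rewrite eigenvalue_det det_mx00 oner_eq0; split=> // -[v [_ [phi [_]]]].
  by rewrite [v phi]flatmx0 eqxx.
have [Vpos _] := V_root; have [G [VG Gang Gholo]] := root_powers Vpos.
have Qu := sqrtD_unit V_root.
have [hp hm] := Gholo _ alpha lambda Qu a0 a2.
rewrite -(Zmx_conjugate V_root) in hp hm.
rewrite (Mmx_eigen V_root V_wp hp hm).
have Fu := neumann_unit V_root V_wp.
have Fbu : conj_mx (V - adjm V) \in unitmx by rewrite conj_mx_unit.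
rewrite (boundary_system _ _ Fu Fbu).
have FbE : conj_mx (V - adjm V) = conj_mx V - conj_mx (adjm V) by exact: map_mxB.
rewrite FbE.
have G0 : G lambda 0 = 1%:M := family0 VG lambda.
have Gb0 : conj_mx (G (conjc lambda) 0) = 1%:M by rewrite (family0 VG) /conj_mx map_mx1.
have two0 : (2%:R : R[i]) != 0 by rewrite pnatr_eq0.
have a_0 : 0 <= (0 : R) <= alpha by rewrite lexx ltW.
have a_a : 0 <= alpha <= alpha by rewrite lexx ltW.
split.
- case=> v [[e [u [[e0 sv] uv Lu N0 Na]]] [phi0 [phi0a v0]]].
  have [v1 [v2 dv]] := smooth_on_derivs sv.
  have inner t : 0 <= t <= alpha -> - e < t < alpha + e.
    by move=> /andP[t0 ta]; apply/andP; split; lra.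
  have dva t (ta : 0 <= t <= alpha) := dv t (inner t ta).
  have Lv t : 0 <= t <= alpha ->
      angular_L (cmx A11) (cmx A12) lambda t (v t) (v1 t) (v2 t) = 0.
    move=> ta; have := Lu 1 t ltr01 ta; rewrite (L_op_polar A11 A12 uv dv ltr01 (inner t ta)).
    by move/eqP; rewrite scaler_eq0 (negbTE (rpow_neq0 _ _)) => /eqP.
  have [c [c' cv]] := solution_form V_root VG lambda0 dva Lv.
  have Nzero t : 0 <= t <= alpha -> conormal A11 A12 t u (polar 1 t) = 0 ->
      (V - adjm V) *m (G lambda t *m c) +
      (conj_mx V - conj_mx (adjm V)) *m (conj_mx (G (conjc lambda) t) *m c') = 0.
    move=> ta; rewrite (conormal_polar A11 A12 uv dv ltr01 (inner t ta)) => /eqP.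
    rewrite scaler_eq0 (negbTE (rpow_neq0 _ _)) /= => /eqP N.
    have [_] := cv t ta; rewrite N scaler0 => /esym/eqP.
    by rewrite scaler_eq0 (negbTE lambda0) => /eqP.
  exists c, c'; split.
  + rewrite -negb_and; apply: contra v0 => /andP[/eqP cc /eqP cc'].
    by have [-> _] := cv phi0 phi0a; rewrite cc cc' !mulmx0 addr0.
  + by have := Nzero 0 a_0 (N0 1 ltr01); rewrite G0 Gb0 !mul1mx.
  + exact: Nzero alpha a_a (Na 1 ltr01).
- case=> c [c' [cc' E0 Ea]].
  pose v t := G lambda t *m c + conj_mx (G (conjc lambda) t) *m c'.
  (* The extended sector must have an opening below 2 pi. *)
  pose e := (2%:R * pi - alpha) / 3%:R.
  have e0 : 0 < e by rewrite divr_gt0 // subr_gt0.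
  have width : alpha + e - - e <= 2%:R * pi.
    have : e * 3%:R = 2%:R * pi - alpha by rewrite /e divfK // pnatr_eq0.
    by move: (e) e0 => x x0; lra.
  have [u uv] := polar_extension v lambda width.
  have [v1 [v2 Hv]] := form_solution lambda V_root VG c c'.
  have dv t : - e < t < alpha + e -> mder v t (v1 t) /\ mder v1 t (v2 t).
    by move=> _; have [] := Hv t.
  have inner t : 0 <= t <= alpha -> - e < t < alpha + e.
    by move=> /andP[t0 ta]; apply/andP; split; lra.
  have Nv t r : 0 <= t <= alpha -> 0 < r ->
      (V - adjm V) *m (G lambda t *m c) +
      (conj_mx V - conj_mx (adjm V)) *m (conj_mx (G (conjc lambda) t) *m c') = 0 ->
      conormal A11 A12 t u (polar r t) = 0.
    move=> ta r0 E; rewrite (conormal_polar A11 A12 uv dv r0 (inner t ta)).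
    have [_ _ _] := Hv t; rewrite E scaler0 => /eqP.
    by rewrite scaler_eq0 (negbTE two0) /= => /eqP ->; rewrite scaler0.
  exists v; split.
    exists e, u; split=> //.
    + split=> //; apply: angular_smooth => k.
      have -> : (fun t => v t k 0) = (fun t => \sum_j G lambda t k j * c j 0 +
          \sum_j conjc (G (conjc lambda) t k j) * c' j 0).
        apply/funext => t; rewrite /v 3!mxE; congr (_ + _); apply: eq_bigr => j _.
        by rewrite mxE.
      apply: angularD; apply: angular_sum => j; apply: angularM; try exact: angular_cst.
        exact: Gang.
      by apply: angular_conj; exact: Gang.
    + move=> r phi r0 pa; rewrite (L_op_polar A11 A12 uv dv r0 (inner phi pa)).
      by have [_ _ -> _] := Hv phi; rewrite scaler0.
    + by move=> r r0; apply: Nv a_0 r0 _; rewrite G0 Gb0 !mul1mx.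
    + by move=> r r0; apply: Nv a_a r0 _.
  apply: contrapT => H; have v0 t : 0 <= t <= alpha -> v t = 0.
    move=> ta; apply/eqP; apply: contra_notT H => vt.
    by exists t.
  have [c0 c'0] := form_injective V_root VG lambda0 a0 v0.
  by move: cc'; rewrite c0 c'0 !eqxx.
Qed.
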